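(* Let $w=w^{(1)}\in\mathbb R^6$ and consider the class of isotropic standard random sets $Z$ in $\mathbb R^2$ that are almost surely topologically regular. Then $\lim_{a\to0}E\hat V_1(Z)$ exists for every such $Z$ if and only if $w_1=w_6=0$. In this case, for every such $Z$, $\lim_{a\to0}E\hat V_1(Z)=\frac1\pi c_3\,\bar V_1(Z)$, where $c_3=4\big((2-\sqrt2)w_2+(-2+2\sqrt2)w_3+(2-\sqrt2)w_5\big)$. In particular, $\hat V_1(Z)$ is asymptotically unbiased for every such $Z$ if and only if $c_3=\pi$.
   Context: Let $C=[0,1]^2$ and $C_0=\{x_0,x_1,x_2,x_3\}$ with $x_0=(0,0)$, $x_1=(1,0)$, $x_2=(0,1)$, $x_3=(1,1)$. A configuration is a subset of $C_0$, grouped into six classes: $\eta_1=\{\emptyset\}$; $\eta_2$ = the four one-point subsets; $\eta_3$ = the four adjacent pairs $\{x_0,x_1\},\{x_0,x_2\},\{x_1,x_3\},\{x_2,x_3\}$; $\eta_4=\{\{x_0,x_3\},\{x_1,x_2\}\}$; $\eta_5$ = the four three-point subsets; $\eta_6=\{C_0\}$. A standard random set $Z$ is a stationary random closed set in $\mathbb R^2$ whose realizations are a.s. locally polyconvex (locally finite unions of compact convex sets) and such that $E\,2^{N(Z\cap B(1))}<\infty$, where $N(A)$ is the minimal number of convex sets whose union is $A$. Isotropic means its distribution is rotation invariant; topologically regular means it equals the closure of its interior. Specific boundary length: $\bar V_1(Z)=\lim_{s\to\infty}EV_1(Z\cap sW)/V_2(sW)$ for compact convex $W$ with nonempty interior,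 $V_1$ being half the boundary length and $V_2$ area. For lattice distance $a>0$ the estimator is $\hat V_1(Z)=a^{-1}\sum_{j=1}^6w_jN_j/N_0$, where for a window $W$, $N_0$ is the number of $z\in a\mathbb Z^2$ with $z+aC\subseteq W$ and $N_j$ the number of those $z$ with $\{x\in C_0: z+ax\in Z\}\in\eta_j$; by stationarity $E\hat V_1(Z)=a^{-1}\sum_j w_jP(\{x\in C_0:ax\in Z\}\in\eta_j)$. Asymptotically unbiased means $\lim_{a\to0}E\hat V_1(Z)=\bar V_1(Z)$. *)

(* Defs.v *)
From mathcomp Require Import all_boot all_order all_algebra.
From mathcomp Require Import all_classical all_reals all_analysis.
Import Order.TTheory GRing.Theory Num.Theory numFieldNormedType.Exports.

Set Implicit Arguments.
Unset Strict Implicit.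
Unset Printing Implicit Defensive.

Local Open Scope classical_set_scope.
Local Open Scope ring_scope.

Section Defs.
Context {R : realType}.

(* Points of the plane R^2 are pairs; topology = product topology
   (= Euclidean topology). *)
Notation pt := (R * R)%type.

Definition edist (p q : pt) : R :=
  Num.sqrt ((p.1 - q.1) ^+ 2 + (p.2 - q.2) ^+ 2).

Definition cball (r : R) : set pt := [set p | edist (0, 0) p <= r].

Definition convex2 (A : set pt) : Prop :=
  forall p q, A p -> A q -> forall t : R, 0 <= t <= 1 ->
    A ((1 - t) * p.1 + t * q.1, (1 - t) * p.2 + t * q.2).

Definition union_of_n_convex (A : set pt) (n : nat) : Prop :=
  exists K : nat -> set pt, (forall i, convex2 (K i)) /\
    A = \bigcup_(i in `I_n) K i.

(* N(A): the minimal number of convex sets whose union is A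
   (default 0 if A is not such a finite union). *)
Definition Nconv (A : set pt) : nat :=
  xget 0%N [set n | union_of_n_convex A n /\
                    forall m, union_of_n_convex A m -> (n <= m)%N].

Definition locally_polyconvex (F : set pt) : Prop :=
  exists K : nat -> set pt,
    (forall i, compact (K i) /\ convex2 (K i)) /\
    F = \bigcup_i K i /\
    (forall C : set pt, compact C -> finite_set [set i | K i `&` C !=set0]).

Definition topologically_regular (F : set pt) : Prop :=
  F = closure (interior F).

Definition hit (K : set pt) : set (set pt) := [set F | F `&` K !=set0].
Definition fell : set (set (set pt)) :=
  <<s [set hit K | K in [set K : set pt | compact K]] >>.

Definition translate (t : pt) (F : set pt) : set pt :=
  [set (p.1 + t.1, p.2 + t.2) | p in F].
Definition rotate (theta : R) (F : set pt) : set pt :=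
  [set (cos theta * p.1 - sin theta * p.2, sin theta * p.1 + cos theta * p.2)
   | p in F].
Definition dilate (s : R) (F : set pt) : set pt :=
  [set (s * p.1, s * p.2) | p in F].

Section RandomSets.
Context {d : measure_display} {T : measurableType d} (P : probability T R).

(* Random closed set (measurability w.r.t. the Fell sigma-algebra,
   i.e. hitting events of compact sets are events). *)
Definition random_closed_set (Z : T -> set pt) : Prop :=
  (forall w, closed (Z w)) /\
  (forall K : set pt, compact K -> measurable (Z @^-1` hit K)).

Definition same_law (Z1 Z2 : T -> set pt) : Prop :=
  forall S, fell S -> P (Z1 @^-1` S) = P (Z2 @^-1` S).

Definition stationary (Z : T -> set pt) : Prop :=
  forall t : pt, same_law Z (fun w => translate t (Z w)).

Definition isotropic (Z : T -> set pt) : Prop :=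
  forall theta : R, same_law Z (fun w => rotate theta (Z w)).

Definition standard_random_set (Z : T -> set pt) : Prop :=
  [/\ random_closed_set Z, stationary Z,
      {ae P, forall w, locally_polyconvex (Z w)} &
      (\int[P]_w ((2 ^ Nconv (Z w `&` cball 1))%N%:R)%:E < +oo)%E].

Definition admissible (Z : T -> set pt) : Prop :=
  [/\ standard_random_set Z, isotropic Z &
      {ae P, forall w, topologically_regular (Z w)}].
End RandomSets.

(* Diameter (Euclidean), with diam set0 = 0. *)
Definition diam (A : set pt) : \bar R :=
  ereal_sup ([set 0%E] `|` [set (edist pq.1 pq.2)%:E | pq in A `*` A]).

Definition hausdorff_pre (delta : R) (E : set pt) : \bar R :=
  ereal_inf [set (\sum_(0 <= i <oo) diam (C i))%E
            | C in [set C : nat -> set pt |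
                      E `<=` \bigcup_i C i /\ forall i, (diam (C i) <= delta%:E)%E]].
Definition hausdorff1 (E : set pt) : \bar R :=
  ereal_sup [set hausdorff_pre delta E | delta in [set delta : R | 0 < delta]].

Definition boundary (F : set pt) : set pt := closure F `\` interior F.

Definition V1 (F : set pt) : \bar R := (2^-1%:E * hausdorff1 (boundary F))%E.

Definition area (F : set pt) : \bar R :=
  (lebesgue_measure \x lebesgue_measure)%E F.

Definition is_specific_V1 {d : measure_display} {T : measurableType d}
    (P : probability T R) (Z : T -> set pt) (L : R) : Prop :=
  forall W : set pt, compact W -> convex2 W -> interior W !=set0 ->
    ((\int[P]_w V1 (Z w `&` dilate s W)) * ((fine (area (dilate s W)))^-1)%:E)%E
      @[s --> +oo] --> L%:E.

(* Configuration classes eta_1 .. eta_6 of a configuration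
   {x in C_0 : x in F}, given by membership bits of x0,x1,x2,x3. *)
Definition config_class (b0 b1 b2 b3 : bool) : nat :=
  let n := (b0 + b1 + b2 + b3)%N in
  if n == 0%N then 1%N
  else if n == 1%N then 2%N
  else if n == 2%N then (if (b0 && b3) || (b1 && b2) then 4%N else 3%N)
  else if n == 3%N then 5%N
  else 6%N.

Definition zin (F : set pt) (p : pt) : bool := `[< F p >].

Definition eta_prob {d : measure_display} {T : measurableType d}
    (P : probability T R) (Z : T -> set pt) (a : R) (j : nat) : R :=
  fine (P [set w | config_class (zin (Z w) (0, 0)) (zin (Z w) (a, 0))
                                (zin (Z w) (0, a)) (zin (Z w) (a, a)) = j]).

Definition EhatV1 (w1 w2 w3 w4 w5 w6 : R) {d : measure_display}
    {T : measurableType d} (P : probability T R) (Z : T -> set pt) (a : R) : R :=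
  a^-1 * (w1 * eta_prob P Z a 1 + w2 * eta_prob P Z a 2 + w3 * eta_prob P Z a 3
        + w4 * eta_prob P Z a 4 + w5 * eta_prob P Z a 5 + w6 * eta_prob P Z a 6).

Definition asympt_unbiased (w1 w2 w3 w4 w5 w6 : R) {d : measure_display}
    {T : measurableType d} (P : probability T R) (Z : T -> set pt) : Prop :=
  exists L : R, is_specific_V1 P Z L /\
    EhatV1 w1 w2 w3 w4 w5 w6 P Z a @[a --> 0^'+] --> L.

Definition c3 (w2 w3 w5 : R) : R :=
  4 * ((2 - Num.sqrt 2) * w2 + (-2 + 2 * Num.sqrt 2) * w3
       + (2 - Num.sqrt 2) * w5).

End Defs.

(* Main.v *)
(* Let gamma(r) be the probability that the origin lies in Z while a given point
   at distance r does not; by isotropy the direction is irrelevant.  Going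
   through an intermediate point shows that gamma is subadditive, so
   gamma(r) / r tends to its supremum kappa as r -> 0, and kappa is finite since
   a line meets the boundary of a union of N convex sets at most 2N times.

   Counting the sign changes along the sides and along the diagonals of a cell
   gives two linear relations between the probabilities p_2, ..., p_5 of the
   classes.  A cell of class 4 has, whatever happens at its centre, a diagonal
   on which the membership changes twice, whence p_4 = o(a) because
   2 gamma(r) - gamma(2r) = o(r).  In a strip of n cells the classes 2 and 5
   balance out up to a bounded error unless the membership changes more than
   once along a side of the strip, whence p_2 - p_5 = o(a).  Hence the
   expectation of the estimator tends to c_3 kappa / 2.

   It remains to see that the specific boundary length is pi kappa / 2.  The
   boundary is covered by finitely many pieces that are almost straight, so its
   length is, up to a small relative error, a mean over finitely many directions
   u of the lengths of its projections along u, counted with multiplicity, and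
   the latter is compared with the area of the points p such that the membership
   of p and of p + r u differ.  By Fubini the expectation of this area is
   2 gamma(r) times the area of the window.  Regularity ensures that almost every
   line really changes side where it meets the boundary, and Fatou's lemma
   replaces a uniform bound.

   The conditions on w_1 and w_6 are forced by the empty set and by the plane,
   and kappa > 0 for random stripes with uniform direction and offset. *)

Require Import Defs.
From HB Require Import structures.
From mathcomp Require Import all_boot all_order all_algebra.
From mathcomp Require Import all_classical all_reals all_analysis measurable_realfun.
From mathcomp Require Import ring lra.
Import Order.TTheory GRing.Theory Num.Theory numFieldNormedType.Exports.
Import Defs.

Set Implicit Arguments.
Unset Strict Implicit.
Unset Printing Implicit Defensive.

Local Open Scope classical_set_scope.
Local Open Scope ring_scope.

(** * Plane geometry *)

Section Plane.
Context {R : realType}.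
Local Notation pt := (R * R)%type.
Implicit Types (p q t v : pt) (A B K F : set pt).

(** Directions are sampled, not integrated over: for equally spaced directions the sum of
    [|dot (u k) (nu j)|] is exactly the same for every normal of a fine net, so all nearly straight
    pieces see one constant [sigma], close to the mean [2 / pi] of the absolute cosine. Each [u k]
    points to the right, so that a direction is a slope and the plane is parametrised by intercept
    and abscissa, a measure-preserving change of coordinates.

    The length of the boundary is a Hausdorff measure, and its measurability as a function of the
    realization is not established. It is only squeezed between measurable functions: from below for
    every step [r], from above by a limit inferior along [r = 1 / n.+1].

    The boundary of the window adds a length linear in the size of the window, negligible with
    respect to its area; crude bounds are enough there.

    The coefficients of [c3] come from the two linear relations: with [p_2 = p_5] and [p_4 = 0] to
    first order, [p_3 / a] tends to [4 (sqrt 2 - 1) kappa] and [p_2 / a] to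
    [2 (2 - sqrt 2) kappa]. *)

Definition dot p q : R := p.1 * q.1 + p.2 * q.2.

Lemma edist_ge0 p q : 0 <= edist p q.
Proof. exact: sqrtr_ge0. Qed.

Lemma sqr_edist p q : edist p q ^+ 2 = (p.1 - q.1) ^+ 2 + (p.2 - q.2) ^+ 2.
Proof. by rewrite sqr_sqrtr// addr_ge0// sqr_ge0. Qed.

Lemma edistC p q : edist p q = edist q p.
Proof. by rewrite /edist -(sqrrN (p.1 - q.1)) -(sqrrN (p.2 - q.2)) !opprB. Qed.

Lemma edistxx p : edist p p = 0.
Proof. by rewrite /edist !subrr expr0n/= addr0 sqrtr0. Qed.

Lemma edist_le_sqr p q (c : R) : 0 <= c ->
  (edist p q <= c) = ((p.1 - q.1) ^+ 2 + (p.2 - q.2) ^+ 2 <= c ^+ 2).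
Proof. by move=> c0; rewrite -sqr_edist ler_sqr ?nnegrE ?edist_ge0. Qed.

Lemma edist_eq0 p q : edist p q = 0 -> p = q.
Proof.
move=> e; have := sqr_edist p q; rewrite e expr0n/= => /esym/eqP.
rewrite paddr_eq0 ?sqr_ge0// !sqrf_eq0 !subr_eq0 => /andP[/eqP + /eqP].
by case: p q {e} => ? ? [? ?] /= -> ->.
Qed.

(** Cauchy-Schwarz by Lagrange's identity: the missing square is that of [a * u.2 - b * u.1]. *)
Lemma dot_le p q u : dot (p.1 - q.1, p.2 - q.2) u <= edist p q * edist (0, 0) u.
Proof.
apply: (@le_trans _ _ `|dot (p.1 - q.1, p.2 - q.2) u|); first exact: ler_norm.
rewrite -ler_sqr ?nnegrE ?normr_ge0 ?mulr_ge0 ?edist_ge0//.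
rewrite real_normK ?num_real//.
have := sqr_edist p q; have := sqr_edist (0, 0) u; rewrite /dot/=.
move: (edist p q) (edist _ u) => D U; set a := p.1 - _; set b := p.2 - _ => hU hD.
have -> : (D * U) ^+ 2 = (a ^+ 2 + b ^+ 2) * (u.1 ^+ 2 + u.2 ^+ 2).
  by rewrite exprMn hD hU; ring.
have := sqr_ge0 (a * u.2 - b * u.1); nra.
Qed.

Lemma dot_norm_le p q u :
  `|dot (p.1 - q.1, p.2 - q.2) u| <= edist p q * edist (0, 0) u.
Proof.
rewrite ler_norml dot_le andbT lerNl edistC.
apply: le_trans (dot_le q p u); rewrite /dot/=; lra.
Qed.

Lemma edist_triangle p q t : edist p t <= edist p q + edist q t.
Proof.
rewrite edist_le_sqr ?addr_ge0 ?edist_ge0//.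
have := sqr_edist p q; have := sqr_edist q t.
have := dot_le p q (q.1 - t.1, q.2 - t.2).
have -> : edist (0, 0) (q.1 - t.1, q.2 - t.2) = edist q t.
  by rewrite /edist/= !sub0r !sqrrN.
rewrite /dot/=; nra.
Qed.

Lemma edist_fst p q : `|p.1 - q.1| <= edist p q.
Proof.
rewrite -ler_sqr ?nnegrE ?edist_ge0 ?normr_ge0// real_normK ?num_real// sqr_edist.
by rewrite lerDl sqr_ge0.
Qed.

Lemma edist_snd p q : `|p.2 - q.2| <= edist p q.
Proof.
rewrite -ler_sqr ?nnegrE ?edist_ge0 ?normr_ge0// real_normK ?num_real// sqr_edist.
by rewrite lerDr sqr_ge0.
Qed.

Lemma edist_le_add p q : edist p q <= `|p.1 - q.1| + `|p.2 - q.2|.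
Proof.
rewrite edist_le_sqr ?addr_ge0// -(real_normK (num_real (p.1 - q.1))).
rewrite -(real_normK (num_real (p.2 - q.2))).
have := normr_ge0 (p.1 - q.1); have := normr_ge0 (p.2 - q.2); nra.
Qed.

(** The topology is that of the product. The box of half-width [e / 2] lies in the disc of radius
    [e], and the disc in the box of half-width [e]. *)
Lemma nbhs_edist p A :
  nbhs p A <-> exists2 e : R, 0 < e & forall q, edist p q < e -> A q.
Proof.
split.
  move=> /nbhs_ballP[e /= e0 pA]; exists e => // q pq; apply: pA; split.
    by rewrite /ball/=; exact: le_lt_trans (edist_fst _ _) pq.
  by rewrite /ball/=; exact: le_lt_trans (edist_snd _ _) pq.
move=> [e e0 pA]; apply/nbhs_ballP; exists (e / 2); first by rewrite /= divr_gt0.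
move=> q [] /= p1 p2; apply: pA; apply: le_lt_trans (edist_le_add _ _) _.
by rewrite [e]splitr ltrD.
Qed.

Lemma closureE_edist A p :
  closure A p <-> forall e : R, 0 < e -> exists2 q, A q & edist p q < e.
Proof.
split.
  move=> clA e e0; have /clA[q [Aq /= pq]] : nbhs p [set q | edist p q < e].
    by apply/nbhs_edist; exists e.
  by exists q.
move=> h B /nbhs_edist[e e0 eB]; have [q Aq pq] := h _ e0.
by exists q; split => //; exact: eB.
Qed.

Lemma closed_edist A :
  closed A <-> forall p, (forall e : R, 0 < e -> exists2 q, A q & edist p q < e) -> A p.
Proof.
split=> [cA p h|h p /closureE_edist hp]; last exact: h.
by apply: cA; apply/closureE_edist.
Qed.

Lemma edist_continuous p : continuous (edist p).
Proof.
move=> q; apply/cvgrPdist_lt => e e0; apply/nbhs_edist; exists e => // t qt /=.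
rewrite ltr_norml; apply/andP; split.
  have := edist_triangle p q t; lra.
have := edist_triangle p t q; rewrite (edistC t); lra.
Qed.

Lemma compact_edist_bounded K : compact K ->
  exists2 M : R, 0 < M & forall p, K p -> `|p.1| <= M /\ `|p.2| <= M.
Proof.
move=> cK; have [M [Mr KM]] := compact_bounded cK.
exists (`|M| + 1); first by rewrite ltr_wpDl.
move=> p Kp; have /KM : M < `|M| + 1 by rewrite (le_lt_trans (ler_norm _))// ltrDl.
move=> /(_ _ Kp); rewrite /Num.norm/= ge_max => /andP[? ?]; split => //.
Qed.

Lemma compact_closed_pt K : compact K -> closed K.
Proof. by apply: compact_closed; exact: norm_hausdorff. Qed.

Lemma closed_bounded_compact A (M : R) : closed A ->
  (forall p, A p -> `|p.1| <= M /\ `|p.2| <= M) -> compact A.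
Proof.
move=> cA AM.
apply: (@subclosed_compact _ A (`[- M, M]%classic `*` `[- M, M]%classic)) => //.
  by apply: compact_setX; exact: segment_compact.
by move=> p /AM[]; rewrite !ler_norml => ? ?; split; rewrite /= in_itv.
Qed.

Lemma closure_minimal A B : closed B -> A `<=` B -> closure A `<=` B.
Proof. by move=> cB AB p /(closure_subset AB); exact: cB. Qed.

End Plane.

(** * One-dimensional Hausdorff measure *)

Section Hausdorff.
Context {R : realType}.
Local Notation pt := (R * R)%type.
Implicit Types (p q : pt) (A B E : set pt) (C : nat -> set pt) (delta : R).
Local Open Scope ereal_scope.

Definition fine_cover delta C E :=
  E `<=` \bigcup_i C i /\ forall i, diam (C i) <= delta%:E.

Lemma diam_ge0 A : 0 <= diam A.
Proof. by apply: ereal_sup_ubound; left. Qed.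

Lemma edist_diam A p q : A p -> A q -> (edist p q)%:E <= diam A.
Proof. by move=> Ap Aq; apply: ereal_sup_ubound; right; exists (p, q). Qed.

Lemma diam_le A (c : \bar R) : 0 <= c ->
  (forall p q, A p -> A q -> (edist p q)%:E <= c) -> diam A <= c.
Proof.
move=> c0 h; apply: ge_ereal_sup => _ [->//|[[p q] [/= Ap Aq] <-]].
exact: h.
Qed.

Lemma diam_sub A B : A `<=` B -> diam A <= diam B.
Proof.
by move=> AB; apply: diam_le (diam_ge0 _) _ => p q /AB ? /AB ?; exact: edist_diam.
Qed.

Lemma diam0 : diam (@set0 pt) = 0.
Proof. by apply/eqP; rewrite eq_le diam_ge0 andbT; exact: diam_le. Qed.

Lemma hausdorff_pre_le delta C E : fine_cover delta C E ->
  hausdorff_pre delta E <= \sum_(0 <= i <oo) diam (C i).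
Proof. by move=> ?; apply: ereal_inf_lbound; exists C. Qed.

Lemma hausdorff_pre_lt delta E x : hausdorff_pre delta E < x ->
  exists2 C, fine_cover delta C E & \sum_(0 <= i <oo) diam (C i) < x.
Proof. by move=> /ereal_inf_lt[_ [C ? <-] ?]; exists C. Qed.

Lemma hausdorff_pre_ge delta E x :
  (forall C, fine_cover delta C E -> x <= \sum_(0 <= i <oo) diam (C i)) ->
  x <= hausdorff_pre delta E.
Proof. by move=> h; apply: le_ereal_inf_tmp => _ [C ? <-]; exact: h. Qed.

Lemma hausdorff_pre_ge0 delta E : 0 <= hausdorff_pre delta E.
Proof.
by apply: hausdorff_pre_ge => C _; apply: nneseries_ge0 => i _ _; exact: diam_ge0.
Qed.

Lemma hausdorff_preS delta E A : E `<=` A ->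
  hausdorff_pre delta E <= hausdorff_pre delta A.
Proof.
move=> EA; apply: hausdorff_pre_ge => C [AC Cd].
by apply: hausdorff_pre_le; split => //; exact: subset_trans AC.
Qed.

Lemma hausdorff_pre_anti delta delta' E : (delta <= delta')%R ->
  hausdorff_pre delta' E <= hausdorff_pre delta E.
Proof.
move=> dd; apply: hausdorff_pre_ge => C [AC Cd].
apply: hausdorff_pre_le; split => // i.
by apply: le_trans (Cd i) _; rewrite lee_fin.
Qed.

Lemma hausdorff_pre_le1 delta E : (0 < delta)%R ->
  hausdorff_pre delta E <= hausdorff1 E.
Proof. by move=> d0; apply: ereal_sup_ubound; exists delta. Qed.

Lemma hausdorff1_le E x :
  (forall delta, (0 < delta)%R -> hausdorff_pre delta E <= x) -> hausdorff1 E <= x.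
Proof. by move=> h; apply: ge_ereal_sup => _ [d ? <-]; exact: h. Qed.

Lemma hausdorff1_ge0 E : 0 <= hausdorff1 E.
Proof. exact: le_trans (hausdorff_pre_ge0 1 E) (hausdorff_pre_le1 _ _). Qed.

Lemma hausdorff1S E A : E `<=` A -> hausdorff1 E <= hausdorff1 A.
Proof.
move=> EA; apply: hausdorff1_le => d d0.
exact: le_trans (hausdorff_preS _ EA) (hausdorff_pre_le1 _ d0).
Qed.

Lemma hausdorff_pre0 delta : (0 <= delta)%R -> hausdorff_pre delta (@set0 pt) = 0.
Proof.
move=> d0; apply/eqP; rewrite eq_le hausdorff_pre_ge0 andbT.
have /hausdorff_pre_le : fine_cover delta (fun=> set0) set0.
  by split => // i; rewrite diam0 lee_fin.
by move/le_trans; apply; rewrite eseries0// => i _ _; exact: diam0.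
Qed.

Lemma hausdorff1_set0 : hausdorff1 (@set0 pt) = 0.
Proof.
apply/eqP; rewrite eq_le hausdorff1_ge0 andbT; apply: hausdorff1_le => d d0.
by rewrite hausdorff_pre0// ltW.
Qed.

Lemma hausdorff_preU delta A B :
  hausdorff_pre delta (A `|` B) <= hausdorff_pre delta A + hausdorff_pre delta B.
Proof.
have [->|Aoo] := eqVneq (hausdorff_pre delta A) +oo.
  by rewrite addye ?leey// gt_eqF// (lt_le_trans _ (hausdorff_pre_ge0 _ _))// ltNye.
have [->|Boo] := eqVneq (hausdorff_pre delta B) +oo.
  by rewrite addey ?leey// gt_eqF// (lt_le_trans _ (hausdorff_pre_ge0 _ _))// ltNye.
have fA : hausdorff_pre delta A \is a fin_num.
  by rewrite ge0_fin_numE ?hausdorff_pre_ge0// ltey.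
have fB : hausdorff_pre delta B \is a fin_num.
  by rewrite ge0_fin_numE ?hausdorff_pre_ge0// ltey.
apply/lee_addgt0Pr => e e0.
have e20 : (0 < e / 2)%R by rewrite divr_gt0.
have [C [AC dC] sC] : exists2 C, fine_cover delta C A &
    \sum_(0 <= i <oo) diam (C i) < hausdorff_pre delta A + (e / 2)%:E.
  by apply: hausdorff_pre_lt; rewrite lteDl ?lte_fin.
have [D [BD dD] sD] : exists2 C, fine_cover delta C B &
    \sum_(0 <= i <oo) diam (C i) < hausdorff_pre delta B + (e / 2)%:E.
  by apply: hausdorff_pre_lt; rewrite lteDl ?lte_fin.
(* The two covers are interleaved: even indices list [C], odd ones [D]. *)
pose F i := if odd i then D i./2 else C i./2.
have /hausdorff_pre_le : fine_cover delta F (A `|` B).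
  split=> [p [/AC[i _ Ci]|/BD[i _ Di]]|i]; last by rewrite /F; case: ifP.
    by exists i.*2 => //; rewrite /F odd_double doubleK.
  by exists i.*2.+1 => //; rewrite /F /= odd_double /= uphalf_double.
move/le_trans; apply.
rewrite [e]splitr EFinD addeACA.
apply: le_trans (leeD (ltW sC) (ltW sD)).
have d0 C' i : 0 <= diam (C' i : set pt) by exact: diam_ge0.
apply: lime_le; first by apply: is_cvg_nneseries => i _ _; exact: diam_ge0.
apply: nearW => n.
have FE m : \sum_(0 <= i < m.*2) diam (F i) =
    \sum_(0 <= i < m) diam (C i) + \sum_(0 <= i < m) diam (D i).
  elim: m => [|m ih]; first by rewrite !big_geq// adde0.
  rewrite doubleS !big_nat_recr//= ih.
  rewrite /F /= odd_double /= doubleK uphalf_double.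
  by rewrite addeACA addeA.
apply: (@le_trans _ _ (\sum_(0 <= i < n.*2) diam (F i))).
  apply: lee_sum_nneg_natr => [i _ _|]; first exact: diam_ge0.
  by rewrite -addnn leq_addr.
by rewrite FE; apply: leeD; apply: nneseries_lim_ge => *; exact: diam_ge0.
Qed.

Lemma hausdorff1U A B : hausdorff1 (A `|` B) <= hausdorff1 A + hausdorff1 B.
Proof.
apply: hausdorff1_le => d d0; apply: le_trans (hausdorff_preU _ _ _) _.
by apply: leeD; exact: hausdorff_pre_le1.
Qed.

Lemma hausdorff1_bigU n (A : nat -> set pt) :
  hausdorff1 (\bigcup_(i in `I_n) A i) <= \sum_(i < n) hausdorff1 (A i).
Proof.
elim: n => [|n ih]; first by rewrite big_ord0 II0 bigcup_set0 hausdorff1_set0.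
rewrite big_ord_recr/= IIS bigcup_setU bigcup_set1.
by apply: le_trans (hausdorff1U _ _) _; apply: leeD.
Qed.

(** A set of diameter at most [delta < d0] cannot meet both [A] and [B], so every fine cover of the
    union splits into a cover of [A] and a cover of [B]. *)
Lemma hausdorff_pre_sep (d0 delta : R) A B :
  (forall p q, A p -> B q -> (d0 <= edist p q)%R) -> (delta < d0)%R ->
  hausdorff_pre delta A + hausdorff_pre delta B <= hausdorff_pre delta (A `|` B).
Proof.
move=> sep dd; apply: hausdorff_pre_ge => C [ABC dC].
pose CA i := C i `&` [set p | exists2 q, C i q & A q].
pose CB i := C i `&` [set p | exists2 q, C i q & B q].
have cA : fine_cover delta CA A.
  split=> [p Ap|i]; last by apply: le_trans (dC i); apply: diam_sub => p [].
  by have [|i _ Cip] := ABC p; [left|exists i => //; split => //; exists p].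
have cB : fine_cover delta CB B.
  split=> [p Bp|i]; last by apply: le_trans (dC i); apply: diam_sub => p [].
  by have [|i _ Cip] := ABC p; [right|exists i => //; split => //; exists p].
apply: le_trans (leeD (hausdorff_pre_le cA) (hausdorff_pre_le cB)) _.
rewrite -nneseriesD; [|by move=> *; exact: diam_ge0..].
apply: lee_nneseries => [i _ _|i _].
  by rewrite adde_ge0// diam_ge0.
have [[q Cq Aq]|nA] := pselect (exists2 q, C i q & A q); last first.
  have -> : CA i = set0 by apply/seteqP; split => // p [].
  by rewrite diam0 add0e; apply: diam_sub => p [].
have -> : CB i = set0.
  apply/seteqP; split => // p [_ [q' Cq' Bq']].
  have := le_trans (edist_diam Cq Cq') (dC i).
  by rewrite lee_fin leNgt (lt_le_trans dd)// sep.
by rewrite diam0 adde0; apply: diam_sub => p [].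
Qed.

(** This metric property replaces additivity on Borel sets: the pieces of the boundary will be
    exhausted by compact sets at positive distance from each other. *)
Lemma hausdorff1_sep (d0 : R) A B : (0 < d0)%R ->
  (forall p q, A p -> B q -> (d0 <= edist p q)%R) ->
  hausdorff1 A + hausdorff1 B <= hausdorff1 (A `|` B).
Proof.
move=> d00 sep.
have [->|Xoo] := eqVneq (hausdorff1 (A `|` B)) +oo; first exact: leey.
have lA : hausdorff1 A <= hausdorff1 (A `|` B) by apply: hausdorff1S => ? ?; left.
have lB : hausdorff1 B <= hausdorff1 (A `|` B) by apply: hausdorff1S => ? ?; right.
have fA : hausdorff1 A \is a fin_num.
  by rewrite ge0_fin_numE ?hausdorff1_ge0// (le_lt_trans lA)// ltey.
have fB : hausdorff1 B \is a fin_num.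
  by rewrite ge0_fin_numE ?hausdorff1_ge0// (le_lt_trans lB)// ltey.
apply/lee_addgt0Pr => e e0.
have e20 : (0 < e / 2)%R by rewrite divr_gt0.
have [_ [dA dA0 <-] hA] := ub_ereal_sup_adherent e20 fA.
have [_ [dB dB0 <-] hB] := ub_ereal_sup_adherent e20 fB.
pose d := Num.min (Num.min dA dB) (d0 / 2)%R.
have d_gt0 : (0 < d)%R by rewrite !lt_min dA0 dB0 divr_gt0.
have dd0 : (d < d0)%R.
  by rewrite /d gt_min; apply/orP; right; rewrite ltr_pdivrMr// ltr_pMr// ltr1n.
have h := le_trans (hausdorff_pre_sep sep dd0) (hausdorff_pre_le1 _ d_gt0).
have hA' : hausdorff_pre dA A <= hausdorff_pre d A.
  by apply: hausdorff_pre_anti; rewrite !ge_min lexx.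
have hB' : hausdorff_pre dB B <= hausdorff_pre d B.
  by apply: hausdorff_pre_anti; rewrite !ge_min lexx orbT.
have := leeD (ltW (lt_le_trans hA hA')) (ltW (lt_le_trans hB hB')).
move=> /le_trans/(_ h).
rewrite -/(hausdorff1 A) -/(hausdorff1 B) addeACA -EFinN -EFinD.
by rewrite -opprD -splitr EFinN leeBlDr.
Qed.

Lemma hausdorff1_sum_sep (d0 : R) n (A : nat -> set pt) : (0 < d0)%R ->
  (forall i j p q, (i < j < n)%N -> A i p -> A j q -> (d0 <= edist p q)%R) ->
  \sum_(i < n) hausdorff1 (A i) <= hausdorff1 (\bigcup_(i in `I_n) A i).
Proof.
move=> d00; elim: n => [|n ih] sep; first by rewrite big_ord0 hausdorff1_ge0.
rewrite big_ord_recr/= IIS bigcup_setU bigcup_set1.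
apply: le_trans (hausdorff1_sep d00 _).
  apply: leeD => //; apply: ih => i j p q /andP[ij jn].
  by apply: sep; rewrite ij ltnS ltnW.
move=> p q [i /= i_n Ap] Aq.
by apply: (sep i n) Ap Aq; rewrite i_n ltnSn.
Qed.

End Hausdorff.

(** * Oblique projections *)

Section Projections.
Context {R : realType}.
Local Notation pt := (R * R)%type.
Local Notation mu := (@lebesgue_measure R).
Local Notation mu2 := (lebesgue_measure \x lebesgue_measure)%E.
Implicit Types (p q : pt) (B E : set pt).

(** The intercept of the line of slope [s] through [p]: an oblique projection along [(1, s)] on the
    vertical axis. *)
Definition proj (s : R) p : R := p.2 - s * p.1.

Lemma dist_lt_in_itv (X : set R) (l : R) :
  (forall x y, X x -> X y -> `|x - y| <= l) -> exists a, X `<=` `[a, a + l].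
Proof.
move=> h; have [->|/set0P[x0 Xx0]] := eqVneq X set0; first by exists 0.
have hi : has_inf X.
  split; first by exists x0.
  exists (x0 - l) => y Xy; have := h _ _ Xx0 Xy; rewrite ler_norml; lra.
exists (inf X) => x Xx; rewrite /= in_itv/=; apply/andP; split.
  by apply: ge_inf => //; case: hi.
suff : x - l <= inf X by lra.
apply: lb_le_inf; first by exists x0.
by move=> y Xy; have := h _ _ Xx Xy; rewrite ler_norml; lra.
Qed.

Lemma mu_le_dist (X : set R) (l : R) : 0 <= l -> measurable X ->
  (forall x y, X x -> X y -> `|x - y| <= l) -> (mu X <= l%:E)%E.
Proof.
move=> l0 mX /dist_lt_in_itv[a Xa].
apply: (@le_trans _ _ (mu `[a, a + l]%classic)).
  by apply: le_measure => //; rewrite inE.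
by rewrite lebesgue_measure_itv/= lte_fin ltrDl; case: ifP => // _; rewrite -EFinD addrAC subrr add0r.
Qed.

(* A pair [(c, x)] stands for the point of abscissa [x] on the line of slope [s]
   and intercept [c]. *)
Definition hitset (s rho : R) B : set (R * R) :=
  [set cx | exists2 x', cx.2 <= x' <= cx.2 + rho & B (x', cx.1 + s * x')].

(** A covering set of diameter [d] is hit only from a rectangle of sides [K * d] and [rho + d] in
    the coordinates [(c, x)], and [d] is small with respect to [rho] for a fine cover. A measurable
    subset [M] is estimated because [hitset] of an arbitrary [B] may fail to be measurable. *)
Lemma mu2_hitset_le (s rho K : R) B (M : set (R * R)) : 0 < K -> 0 < rho ->
  (forall p q, B p -> B q -> `|proj s p - proj s q| <= K * edist p q) ->
  measurable M -> M `<=` hitset s rho B ->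
  (mu2 M <= (K * rho)%:E * hausdorff1 B)%E.
Proof.
move=> K0 rho0 BK mM MB.
have [->|Xoo] := eqVneq (hausdorff1 B) +oo%E.
  by rewrite gt0_muley ?leey// lte_fin mulr_gt0.
have fB : hausdorff1 B \is a fin_num.
  by rewrite ge0_fin_numE ?hausdorff1_ge0// ltey.
set h := fine (hausdorff1 B).
have hE : hausdorff1 B = h%:E by rewrite fineK.
have h0 : 0 <= h by rewrite fine_ge0 ?hausdorff1_ge0.
have key (e : R) : 0 < e -> (mu2 M <= (K * (rho + e) * (h + e))%:E)%E.
  move=> e0.
  have [C [BC dC] sC] : exists2 C, fine_cover e C B &
      (\sum_(0 <= i <oo) diam (C i) < (h + e)%:E)%E.
    apply: hausdorff_pre_lt; apply: le_lt_trans (hausdorff_pre_le1 _ e0) _.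
    by rewrite hE lte_fin ltrDl.
  have fd i : diam (C i) \is a fin_num.
    by rewrite ge0_fin_numE ?diam_ge0// (le_lt_trans (dC i))// ltry.
  pose d i := fine (diam (C i)).
  have dE i : diam (C i) = (d i)%:E by rewrite fineK.
  have d0 i : 0 <= d i by rewrite fine_ge0 ?diam_ge0.
  have dle i : d i <= e by rewrite -lee_fin -dE.
  have ded i p q : C i p -> C i q -> edist p q <= d i.
    by move=> Cp Cq; rewrite -lee_fin -dE edist_diam.
  have /choice[J hJ] i : exists J : R * R,
      forall p, C i p -> B p -> proj s p \in `[J.1, J.1 + K * d i] /\
                                p.1 \in `[J.2, J.2 + d i].
    have [|a ha] := @dist_lt_in_itv (proj s @` (C i `&` B)) (K * d i).
      move=> _ _ [p [Cp Bp] <-] [q [Cq Bq] <-]; apply: le_trans (BK _ _ Bp Bq) _.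
      by rewrite ler_pM2l// ded.
    have [|b hb] := @dist_lt_in_itv (fst @` (C i `&` B)) (d i).
      move=> _ _ [p [Cp Bp] <-] [q [Cq Bq] <-].
      by apply: le_trans (edist_fst _ _) _; rewrite ded.
    exists (a, b) => p Cp Bp; split; first by apply: ha; exists p.
    by apply: hb; exists p.
  pose X i := `[(J i).1, (J i).1 + K * d i]%classic.
  pose Y i := `[(J i).2 - rho, (J i).2 + d i]%classic.
  have mXY i : measurable (X i `*` Y i) by apply: measurableX; exact: measurable_itv.
  have MXY : M `<=` \bigcup_i (X i `*` Y i).
    move=> [c x] /MB[x' /= xx' Bx']; have [i _ Ci] := BC _ Bx'.
    exists i => //; have [] := hJ i _ Ci Bx'.
    rewrite /proj/= addrK !in_itv/= => ? ?; rewrite /X /Y; split; rewrite /= in_itv/=; lra.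
  apply: (@le_trans _ _ (\sum_(0 <= i <oo) mu2 (X i `*` Y i))%E).
    exact: measure_sigma_subadditive.
  apply: (@le_trans _ _ (\sum_(0 <= i <oo) ((K * (rho + e))%:E * diam (C i)))%E).
    apply: lee_nneseries => [i _ _|i _]; first exact: measure_ge0.
    rewrite product_measure1E; [|exact: measurable_itv..].
    change (mu (X i) * mu (Y i) <= (K * (rho + e))%:E * diam (C i))%E.
    have lX : mu (X i) = (K * d i)%:E.
      rewrite /X lebesgue_measure_itv/= lte_fin ltrDl -EFinB addrAC subrr add0r.
      case: ifPn => //; rewrite -leNgt => Kd.
      by congr _%:E; apply/eqP; rewrite eq_le Kd mulr_ge0// ltW.
    have lY : mu (Y i) = (rho + d i)%:E.
      rewrite /Y lebesgue_measure_itv/= lte_fin ifT; last by have := d0 i; lra.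
      by rewrite -EFinB; congr _%:E; ring.
    rewrite lX lY dE -!EFinM lee_fin -mulrA -mulrA ler_pM2l// mulrC.
    by rewrite ler_wpM2r// lerD2l.
  rewrite nneseriesZl; last by move=> *; exact: diam_ge0.
  by rewrite [leRHS]EFinM lee_pmul2l ?lte_fin ?mulr_gt0 ?addr_gt0// ltW.
rewrite hE -EFinM; apply/lee_addgt0Pr => e e0.
pose c := K * (rho + h + 1); have c0 : 0 < c by rewrite mulr_gt0// -addrA addr_gt0// ltr_wpDl.
(* As [f <= 1], expanding [K * (rho + f) * (h + f)] leaves an error of at most [f * c]. *)
pose f := Num.min 1 (e / c).
have f0 : 0 < f by rewrite lt_min ltr01 divr_gt0.
apply: le_trans (key f f0) _; rewrite -EFinD lee_fin.
have f1 : f <= 1 by rewrite ge_min lexx.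
have : f * c <= e by rewrite -ler_pdivlMr// ge_min lexx orbT.
rewrite /c; nra.
Qed.

(** Where [proj s] has an inverse of Lipschitz constant [L], a cover of the projection by open
    intervals lifts to a cover of [B] with diameters at most [L] times larger. The lifted sets must
    also be finer than [delta], whence the induction over [N] slices of projected width [delta / L],
    half-open so as to be disjoint. *)
Lemma hausdorff_pre_le_proj (s L : R) (delta a : R) N B : 0 < L -> 0 < delta ->
  (forall p q, B p -> B q -> edist p q <= L * `|proj s p - proj s q|) ->
  proj s @` B `<=` `[a, a + N%:R * (delta / L)[ ->
  measurable (proj s @` B) ->
  (hausdorff_pre delta B <= L%:E * mu (proj s @` B))%E.
Proof.
move=> L0 delta0; elim: N a B => [|N ih] a B BL Ba mB.
  have -> : B = set0.
    apply/seteqP; split=> // p Bp; have /= := Ba (proj s p) (ex_intro2 _ _ p Bp erefl).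
    by rewrite in_itv/= mul0r addr0; lra.
  by rewrite (hausdorff_pre0 (ltW delta0)); apply: mule_ge0 => //; rewrite lee_fin ltW.
pose I := `[a, a + delta / L[%classic.
have mI : measurable I by exact: measurable_itv.
pose B1 := B `&` proj s @^-1` I; pose B2 := B `\` proj s @^-1` I.
have B12 : B = B1 `|` B2.
  apply/seteqP; split => [p Bp|p [[]|[]]//].
  by have [Ip|nIp] := pselect (I (proj s p)); [left|right].
have pB1 : proj s @` B1 = proj s @` B `&` I.
  apply/seteqP; split => [_ [p [Bp Ip] <-]|_ [[p Bp <-] Ip]]; first by split => //; exists p.
  by exists p.
have pB2 : proj s @` B2 = proj s @` B `\` I.
  apply/seteqP; split => [_ [p [Bp Ip] <-]|_ [[p Bp <-] Ip]]; first by split => //; exists p.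
  by exists p.
have -> : mu (proj s @` B) = (mu (proj s @` B1) + mu (proj s @` B2))%E.
  rewrite pB1 pB2 -measureU//; last 3 first.
  - exact: measurableI.
  - exact: measurableD.
  - by rewrite setDE setIACA setICr setI0.
  by rewrite setUIDK.
rewrite muleDr// ?ge0_adde_def ?inE ?measure_ge0//.
rewrite B12; apply: le_trans (hausdorff_preU _ _ _) _; apply: leeD; last first.
  apply: (ih (a + delta / L)).
  - by move=> p q [Bp _] [Bq _]; exact: BL.
  - rewrite pB2 => c [/Ba]; rewrite /I /= !in_itv/= -natr1 => h /negP.
    by rewrite negb_and -ltNge -leNgt; move: h; lra.
  - by rewrite pB2; exact: measurableD.
have B1L p q : B1 p -> B1 q -> edist p q <= L * `|proj s p - proj s q|.
  by move=> [Bp _] [Bq _]; exact: BL.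
have B1d p q : B1 p -> B1 q -> edist p q <= delta.
  move=> Bp Bq; apply: le_trans (B1L _ _ Bp Bq) _.
  rewrite mulrC -ler_pdivlMr//; case: Bp Bq => _ + [_]; rewrite /I/= !in_itv/=.
  by rewrite ler_norml; lra.
have [->|Xoo] := eqVneq (mu (proj s @` B1)) +oo%E; first by rewrite gt0_muley ?leey.
have fX : mu (proj s @` B1) \is a fin_num by rewrite ge0_fin_numE ?measure_ge0// ltey.
apply/lee_addgt0Pr => e e0.
have eL : 0 < e / L by rewrite divr_gt0.
have [F [AF1 AF2] Fe] : exists2 F : nat -> set R, open_itv_cover (proj s @` B1) F &
    (\sum_(0 <= k <oo) (wlength idfun (F k)) <= mu (proj s @` B1) + (e / L)%:E)%E.
  have : ((wlength idfun)^* (proj s @` B1))%mu \is a fin_num by exact: fX.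
  rewrite outer_measure_open_itv_cover.
  move=> /lb_ereal_inf_adherent-/(_ _ eL)[_/= [F]] AF <- Fe.
  exists F => //; apply/ltW; apply: lt_le_trans Fe _.
  by rewrite -outer_measure_open_itv_cover.
pose C i := B1 `&` proj s @^-1` F i.
have cC : fine_cover delta C B1.
  split=> [p Bp|i].
    have [|i _ Fi] := AF2 (proj s p); first by exists p.
    by exists i.
  apply: diam_le; first by rewrite lee_fin ltW.
  by move=> p q [Bp _] [Bq _]; rewrite lee_fin B1d.
apply: le_trans (hausdorff_pre_le cC) _.
have -> : (L%:E * mu (proj s @` B1) + e%:E = L%:E * (mu (proj s @` B1) + (e / L)%:E))%E.
  by rewrite muleDr//; last rewrite fin_num_adde_defl//; rewrite -EFinM mulrC divfK ?gt_eqF.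
apply: (@le_trans _ _ (L%:E * \sum_(0 <= k <oo) (wlength idfun (F k)))%E); last first.
  by rewrite lee_pmul2l ?lte_fin.
rewrite -nneseriesZl; last by move=> *; exact: wlength_ge0.
apply: lee_nneseries => [i _ _|i _]; first exact: diam_ge0.
have [[u v] Fi] := AF1 i; rewrite /C Fi.
apply: diam_le; first by rewrite mule_ge0// ?lee_fin ?ltW// wlength_ge0.
move=> p q [Bp /= +] [Bq /=]; rewrite !in_itv/= => hp hq.
rewrite wlength_itv/= lte_fin ifT; last by lra.
rewrite -EFinD -EFinM lee_fin; apply: le_trans (B1L _ _ Bp Bq) _.
by rewrite ler_pM2l// ler_norml; lra.
Qed.

Lemma hausdorff1_le_proj (s L : R) (M : R) B : 0 < L ->
  (forall p, B p -> `|p.1| <= M /\ `|p.2| <= M) ->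
  (forall p q, B p -> B q -> edist p q <= L * `|proj s p - proj s q|) ->
  measurable (proj s @` B) ->
  (hausdorff1 B <= L%:E * mu (proj s @` B))%E.
Proof.
move=> L0 BM BL mB; apply: hausdorff1_le => delta delta0.
have dL : 0 < delta / L by rewrite divr_gt0.
pose a := - (M + `|s| * M).
pose N := (Num.truncn ((M + `|s| * M - a) / (delta / L))).+1.
apply: (@hausdorff_pre_le_proj s L delta a N) => // _ [p Bp <-].
have [h1 h2] := BM p Bp.
have : `|proj s p| <= M + `|s| * M.
  apply: le_trans (ler_normB _ _) _; apply: lerD => //.
  by rewrite normrM ler_wpM2l.
rewrite /= in_itv/= ler_norml -/a => /andP[-> /=] h.
rewrite -ltrBlDl -ltr_pdivrMr//; apply: le_lt_trans (truncnS_gt _).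
by rewrite ler_pM2r ?invr_gt0// lerD2r.
Qed.

End Projections.

(** * A quadrature formula for the mean projection *)

Section Quadrature.
Context {R : realType}.
Local Notation pt := (R * R)%type.
Implicit Types (x y : R) (p q u nu : pt).

Lemma cos_lip x y : `|cos x - cos y| <= `|x - y|.
Proof.
wlog xy : x y / x <= y.
  move=> h; have [|/ltW yx] := leP x y; first exact: h.
  by rewrite distrC (distrC x); exact: h.
have [c _ e] := @MVT_segment R cos (fun z => - sin z) x y xy
  (fun z _ => is_derive_cos z) (continuous_subspaceT (@continuous_cos R)).
by rewrite distrC e normrM normrN (distrC x) ler_piMl// sin_max.
Qed.

Lemma sin_lip x y : `|sin x - sin y| <= `|x - y|.
Proof. by rewrite -!cosBpihalf; apply: le_trans (cos_lip _ _) _; rewrite opprB addrA subrK. Qed.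

(** The mean value theorem gives [sin x = x * cos c], and halving the angle bounds [cos c] below.
    Weaker than Taylor's bound, but enough for [h / sin h] to tend to 1. *)
Lemma sin_bounds x : 0 <= x -> x * (1 - x ^+ 2 / 2) <= sin x <= x.
Proof.
move=> x0.
have s_le y : 0 <= y -> `|sin y| <= y.
  by move=> y0; have := sin_lip y 0; rewrite sin0 !subr0 (ger0_norm y0).
apply/andP; split; last exact: le_trans (ler_norm _) (s_le _ x0).
have [c] := @MVT_segment R sin cos 0 x x0
  (fun z _ => is_derive_sin z) (continuous_subspaceT (@continuous_sin R)).
rewrite in_itv/= sin0 !subr0 => /andP[c0 cx] ->; rewrite mulrC ler_wpM2r//.
have -> : cos c = 1 - 2 * sin (c / 2) ^+ 2.
  have := cos_mulr2n (c / 2); rewrite mulr2n -splitr => ->.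
  by rewrite mulr2n; have := cos2Dsin2 (c / 2); lra.
have := s_le (c / 2); rewrite divr_ge0// => /(_ isT) h.
have : sin (c / 2) ^+ 2 <= (x / 2) ^+ 2.
  rewrite -(real_normK (num_real (sin _))) ler_sqr ?nnegrE ?divr_ge0//.
  by apply: le_trans h _; rewrite ler_pM2r ?invr_gt0.
have : (x / 2) ^+ 2 = x ^+ 2 / 4 by field.
lra.
Qed.

(** The sign of the sine is that of the normals in [quadrature], for which [dot (u k) (nu j)]
    becomes the cosine of a sum of angles. *)
Lemma unit_angle (n : pt) : edist (0, 0) n = 1 ->
  exists2 psi : R, 0 <= psi <= 2 * pi & n = (cos psi, - sin psi).
Proof.
move=> n1; have := sqr_edist (0, 0) n; rewrite n1 expr1n/= !sub0r !sqrrN => e.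
case: n n1 e => a b /= _ e.
have ha : -1 <= a <= 1.
  by rewrite -ler_norml -ler_sqr ?nnegrE// real_normK ?num_real// expr1n e lerDl sqr_ge0.
have sa : sin (acos a) = `|b|.
  by rewrite sin_acos// e addrAC subrr add0r sqrtr_sqr.
have [b0|b0] := leP b 0.
  exists (acos a); last by rewrite acosK ?in_itv//= sa ler0_norm// opprK.
  by rewrite acos_ge0//=; apply: le_trans (acos_lepi ha) _; have := pi_ge0 R; lra.
exists (2 * pi - acos a).
  have := acos_ge0 ha; have := acos_lepi ha; have := pi_ge0 R; lra.
have -> : 2 * pi - acos a = - acos a + pi *+ 2 by rewrite mulr2n; lra.
by rewrite cosD2pi sinD2pi cosN sinN acosK ?in_itv//= sa opprK gtr0_norm.
Qed.

Lemma sum_periodic (f : nat -> R) m j : (forall i, f (i + m)%N = f i) ->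
  \sum_(k < m) f (k + j)%N = \sum_(k < m) f k.
Proof.
move=> fm; elim: j => [|j ih]; first by apply: eq_bigr => k _; rewrite addn0.
rewrite -ih; case: m fm {ih} => [|m] fm; first by rewrite !big_ord0.
rewrite big_ord_recr/= [RHS]big_ord_recl/= addrC; congr (_ + _).
  by rewrite add0n -[RHS]fm; congr f; rewrite [RHS]addnC addSnnS.
by apply: eq_bigr => k _; rewrite /bump/= add1n addSnnS.
Qed.

(* The half-circle is sampled at the midpoints [- pi / 2 + (2 k + 1) h] and the
   normals at the multiples of [2 h], [h = pi / (2 m)]: all the sums
   [\sum_k |<u_k, nu_j>|] are then equal to [1 / sin h]. *)
Lemma quadrature (eta : R) : 0 < eta -> exists (m J : nat) (u nu : nat -> pt) (sigma eps : R),
  [/\ (0 < m)%N,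
      (forall k, (k < m)%N -> edist (0, 0) (u k) = 1 /\ 0 < (u k).1),
      (forall j, (j < J)%N -> edist (0, 0) (nu j) = 1 /\
                      \sum_(k < m) `|dot (u k) (nu j)| = m%:R * sigma),
      (forall n, edist (0, 0) n = 1 -> exists2 j, (j < J)%N & edist n (nu j) <= eps) &
      [/\ 0 < eps, eps < eta, 2 / pi <= sigma & sigma < 2 / pi + eta]].
Proof.
move=> eta0; have pi0 := pi_gt0 R; have pi2 := pi_ge2 R.
(* The three terms make [h] smaller than [eta / 4], since [eps] will be [4 * h], and smaller than
   [eta / 50] and [1 / 50], for the error on [sigma]. *)
have [m mgt0 mlt] : exists2 m : nat, (0 < m)%N & 2 * pi / eta + 100 / eta + 100 < m%:R.
  by exists (Num.truncn (2 * pi / eta + 100 / eta + 100)).+1 => //; exact: truncnS_gt.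
have t1 : 0 < 2 * pi / eta by rewrite divr_gt0// mulr_gt0.
have t2 : 0 < 100 / eta by rewrite divr_gt0.
have m0 : 0 < m%:R :> R by rewrite ltr0n.
pose h : R := pi / (2 * m%:R).
have h0 : 0 < h by rewrite divr_gt0// mulr_gt0.
have mh : m%:R * h = pi / 2 by rewrite /h; field; rewrite gt_eqF.
have h_lt : h < eta / 4.
  rewrite /h ltr_pdivrMr ?mulr_gt0//; have : 2 * pi / eta < m%:R by lra.
  by rewrite ltr_pdivrMr//; lra.
have h_lt2 : h < eta / 50.
  rewrite /h ltr_pdivrMr ?mulr_gt0//; have : 100 / eta < m%:R by lra.
  rewrite ltr_pdivrMr//; have := pihalf_lt2 R; lra.
have h_lt3 : h < 1 / 50.
  rewrite /h ltr_pdivrMr ?mulr_gt0//; have := pihalf_lt2 R; lra.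
pose th (k : nat) : R := - (pi / 2) + (2 * k%:R + 1) * h.
pose S := (sin h)^-1.
have /andP[sh1 sh2] := sin_bounds (ltW h0).
have sh0 : 0 < sin h.
  by apply: lt_le_trans sh1; rewrite mulr_gt0//; nra.
have th_itv k : (k < m)%N -> - (pi / 2) < th k < pi / 2.
  move=> km; have : (2 * k%:R + 1) * h < pi.
    have : (2 * k%:R + 1) * h < (2 * m%:R) * h; last by rewrite -mulrA mh; lra.
    rewrite ltr_pM2r//; have : k.+1%:R <= m%:R :> R by rewrite ler_nat.
    by rewrite -natr1; lra.
  have : 0 < (2 * k%:R + 1) * h by rewrite mulr_gt0// ltr_wpDl// mulr_ge0.
  by rewrite /th; lra.
have sumcos : \sum_(k < m) `|cos (th k)| = S.
  (* Since [2 * sin h * cos (th k) = sin (th k + h) - sin (th k - h)] and consecutive midpoints are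
     [2 * h] apart, the sum telescopes. *)
  have -> : \sum_(k < m) `|cos (th k)| =
      \sum_(k < m) (sin (- (pi / 2) + 2 * k.+1%:R * h) - sin (- (pi / 2) + 2 * k%:R * h)) / (2 * sin h).
    apply: eq_bigr => k _; rewrite gtr0_norm; last by apply: cos_gt0_pihalf; exact: th_itv.
    have -> : - (pi / 2) + 2 * k.+1%:R * h = th k + h by rewrite /th -natr1; ring.
    have -> : - (pi / 2) + 2 * k%:R * h = th k - h by rewrite /th; ring.
    by rewrite sinD sinB; field; rewrite gt_eqF.
  rewrite -mulr_suml -(big_mkord xpredT (fun k => sin (- (pi / 2) + 2 * k.+1%:R * h) - sin (- (pi / 2) + 2 * k%:R * h))).
  rewrite telescope_sumr// -mulrA mh mulr0 mul0r addr0.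
  have -> : - (pi / 2) + 2 * (pi / 2) = pi / 2 :> R by lra.
  by rewrite sinN sin_pihalf /S; field; rewrite gt_eqF.
(* One normal more than [2 * m], because the angle [2 * pi] itself is rounded down to the index
   [2 * m]. Each coordinate of the rounded normal is off by at most [2 * h], whence
   [eps = 4 * h]. *)
exists m, (2 * m)%N.+1, (fun k => (cos (th k), sin (th k))),
  (fun j => (cos (2 * j%:R * h), - sin (2 * j%:R * h))), (S / m%:R), (4 * h).
have unit_cs (x : R) : edist (0, 0) (cos x, sin x) = 1.
  by rewrite /edist/= !sub0r !sqrrN cos2Dsin2 sqrtr1.
split => //.
- by move=> k km; split => //=; apply: cos_gt0_pihalf; exact: th_itv.
- move=> j _; split; first by rewrite /edist/= !sub0r opprK sqrrN cos2Dsin2 sqrtr1.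
  rewrite [RHS]mulrC divfK ?gt_eqF// -sumcos.
  (* Passing to the next normal shifts the index [k] by one, and the summand has period [m] because
     [2 * m * h = pi]. *)
  rewrite -[RHS](sum_periodic (f := fun k => `|cos (th k)|) j); last first.
    move=> i; have -> : th (i + m)%N = th i + pi.
      by rewrite /th natrD; have := mh; lra.
    by rewrite cosDpi normrN.
  apply: eq_bigr => k _; congr `|_|; rewrite /dot/=.
  have -> : th (k + j)%N = th k + 2 * j%:R * h by rewrite /th natrD; ring.
  by rewrite cosD; ring.
- move=> n /unit_angle[psi /andP[psi0 psi1] ->].
  exists (Num.truncn (psi / (2 * h))).
    rewrite ltnS -(ler_nat R); apply: (@le_trans _ _ (psi / (2 * h))).
      by rewrite truncn_le divr_ge0// mulr_ge0// ltW.
    have -> : (2 * m)%N%:R = 2 * m%:R :> R by exact: natrM.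
    rewrite ler_pdivrMr; last by rewrite mulr_gt0.
    have -> : 2 * m%:R * (2 * h) = 4 * (m%:R * h) by ring.
    by rewrite mh; lra.
  set j := Num.truncn _.
  have h20 : 0 < 2 * h by rewrite mulr_gt0.
  have /truncn_itv/andP[] : 0 <= psi / (2 * h) by rewrite divr_ge0// ltW.
  rewrite -/j ler_pdivlMr// ltr_pdivrMr// => psi_ge psi_lt.
  have d : `|psi - 2 * j%:R * h| <= 2 * h.
    by rewrite ger0_norm; move: psi_ge psi_lt; rewrite -natr1; lra.
  apply: le_trans (edist_le_add _ _) _ => /=.
  rewrite -opprD normrN; have := cos_lip psi (2 * j%:R * h); have := sin_lip psi (2 * j%:R * h); lra.
have hn : h != 0 by rewrite gt_eqF.
have sn : sin h != 0 by rewrite gt_eqF.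
have pn : pi != 0 :> R by rewrite gt_eqF.
have mE : m%:R = pi / (2 * h) :> R by apply: (mulIf hn); rewrite mh; field; rewrite ?hn.
have SE : S / m%:R = 2 / pi * (h / sin h).
  rewrite mE /S; move: hn sn pn; move: (pi : R) (sin h) (h) => P y x x0 y0 P0.
  by field; rewrite x0 y0 P0.
have q1 : 1 <= h / sin h by rewrite ler_pdivlMr// mul1r.
have q2 : h / sin h < 1 + eta.
  rewrite ltr_pdivrMr//; have : 1 < (1 + eta) * (1 - h ^+ 2 / 2).
    have : h ^+ 2 <= h * (1 / 50) by rewrite expr2 ler_pM2l// ltW.
    have : h ^+ 2 * eta <= 1 * eta by rewrite ler_pM2r// expr_le1 ?ltW//; lra.
    have : h * eta <= 1 / 50 * eta by rewrite ler_pM2r// ltW.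
    have : h ^+ 2 * eta <= (h * (1 / 50)) * eta by rewrite ler_pM2r// expr2 ler_pM2l// ltW.
    lra.
  move=> q; apply: (@lt_le_trans _ _ ((1 + eta) * (h * (1 - h ^+ 2 / 2)))); last first.
    by rewrite ler_pM2l// addr_gt0.
  by rewrite mulrCA ltr_pMr.
have tp : 0 < 2 / pi :> R by rewrite divr_gt0.
have tp1 : 2 / pi <= 1 :> R by rewrite ler_pdivrMr// mul1r.
split; [by rewrite mulr_gt0|lra| |].
  by rewrite SE ler_peMr// ltW.
rewrite SE; apply: (@lt_le_trans _ _ (2 / pi * (1 + eta))).
  by rewrite ltr_pM2l.
by rewrite mulrDr mulr1 lerD2l ler_piMl// ltW.
Qed.

End Quadrature.

(** * Almost straight pieces of convex boundaries *)

Section Flat.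
Context {R : realType}.
Local Notation pt := (R * R)%type.
Local Notation mu := (@lebesgue_measure R).
Implicit Types (p q z u nu n : pt) (A B K : set pt) (eps : R).

Definition flat eps nu B :=
  forall p q, B p -> B q -> `|dot (p.1 - q.1, p.2 - q.2) nu| <= eps * edist p q.

Lemma sub_flat eps nu A B : A `<=` B -> flat eps nu B -> flat eps nu A.
Proof. by move=> AB fB p q /AB Bp /AB Bq; exact: fB. Qed.

Lemma flat_closure eps nu B : 0 <= eps -> flat eps nu B -> flat eps nu (closure B).
Proof.
move=> eps0 fB p q /closureE_edist cp /closureE_edist cq.
apply/ler_addgt0Pr => e e0.
pose c := 2 * edist (0, 0) nu + 2 * eps.
have c0 : 0 <= c by rewrite addr_ge0// mulr_ge0// edist_ge0.
pose f := e / (c + 1).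
have f0 : 0 < f by rewrite divr_gt0// ltr_wpDl.
have fe : f * c <= e by rewrite /f mulrAC ler_pdivrMr ?ltr_wpDl//; nra.
have [p' Bp' pp'] := cp f f0; have [q' Bq' qq'] := cq f f0.
have d1 := fB _ _ Bp' Bq'.
have d2 := dot_norm_le p p' nu; have d3 := dot_norm_le q' q nu.
have t1 := edist_triangle p' p q'; have t2 := edist_triangle p q q'.
rewrite (edistC p' p) in t1; rewrite (edistC q' q) in d3.
have nu0 := edist_ge0 (0, 0) nu.
have m1 : edist p p' * edist (0, 0) nu <= f * edist (0, 0) nu by rewrite ler_wpM2r// ltW.
have m2 : edist q q' * edist (0, 0) nu <= f * edist (0, 0) nu by rewrite ler_wpM2r// ltW.
have m3 : eps * edist p' q' <= eps * (edist p q + f + f).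
  by rewrite ler_wpM2l//; lra.
have -> : dot (p.1 - q.1, p.2 - q.2) nu = dot (p.1 - p'.1, p.2 - p'.2) nu +
    dot (p'.1 - q'.1, p'.2 - q'.2) nu + dot (q'.1 - q.1, q'.2 - q.2) nu.
  by rewrite /dot/=; ring.
apply: le_trans (ler_normD _ _) _; apply: le_trans (lerD (ler_normD _ _) (lexx _)) _.
rewrite /c in fe; nra.
Qed.

Definition normal_at K n q := K q /\ forall z, K z -> dot n (z.1 - q.1, z.2 - q.2) <= 0.

Definition normal_piece K eps nu : set pt :=
  [set q | exists2 n, edist n nu <= eps & normal_at K n q].

(** The supporting half-plane at [p] bounds the chord from one side and the one at [q] from the
    other; replacing the true normals by [nu] costs [eps] times the length of the chord. *)
Lemma flat_normal_piece K eps nu : flat eps nu (normal_piece K eps nu).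
Proof.
have half p q : normal_piece K eps nu p -> K q -> dot (q.1 - p.1, q.2 - p.2) nu <= eps * edist p q.
  move=> [n nnu [Kp np]] Kq.
  have h := dot_le nu n (q.1 - p.1, q.2 - p.2).
  have e : edist (0, 0) (q.1 - p.1, q.2 - p.2) = edist p q.
    by rewrite /edist/= !sub0r !opprB.
  rewrite e (edistC nu) in h; have := np _ Kq; have : edist n nu * edist p q <= eps * edist p q.
    by rewrite ler_wpM2r// edist_ge0.
  by move: h; rewrite /dot/=; lra.
move=> p q Np Nq; have [_ _ [Kp _]] := Np; have [_ _ [Kq _]] := Nq.
have h1 := half p q Np Kq; have h2 := half q p Nq Kp.
rewrite edistC in h2; rewrite ler_norml h2 andbT.
by move: h1; rewrite /dot/=; lra.
Qed.

Lemma nearest_point K p : compact K -> K !=set0 ->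
  exists2 q, K q & forall z, K z -> edist p q <= edist p z.
Proof.
move=> cK K0.
have [q Kq qmin] := compact_EVT_min K0 cK
  (continuous_subspaceT (@edist_continuous R p)).
by exists q => [|z Kz]; [exact/set_mem|apply: qmin; exact/mem_set].
Qed.

(** If [z - q] made an acute angle with [p - q], moving from [q] towards [z] by a small proportion
    [t] would bring the point nearer to [p]. *)
Lemma nearest_normal K p q : convex2 K -> K q ->
  (forall z, K z -> edist p q <= edist p z) -> normal_at K (p.1 - q.1, p.2 - q.2) q.
Proof.
move=> cK Kq qmin; split => // z Kz; rewrite leNgt; apply/negP => D0.
pose D := dot (p.1 - q.1, p.2 - q.2) (z.1 - q.1, z.2 - q.2).
pose Z := (z.1 - q.1) ^+ 2 + (z.2 - q.2) ^+ 2.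
have Z0 : 0 <= Z by rewrite addr_ge0// sqr_ge0.
pose t := Num.min 1 (D / (Z + 1)).
have Z10 : 0 < Z + 1 by rewrite ltr_wpDl.
have t0 : 0 < t by rewrite lt_min ltr01 divr_gt0.
have t1 : t <= 1 by rewrite ge_min lexx.
have tD : t * (Z + 1) <= D by rewrite -ler_pdivlMr// ge_min lexx orbT.
have /qmin : K ((1 - t) * q.1 + t * z.1, (1 - t) * q.2 + t * z.2).
  by apply: cK => //; rewrite t1 ltW.
rewrite edist_le_sqr ?edist_ge0// sqr_edist/= -subr_ge0.
set X := (X in 0 <= X -> _).
have -> : X = t * (t * Z - 2 * D) by rewrite /X /Z /D /dot/=; ring.
rewrite pmulr_rge0//; rewrite -/D in D0; nra.
Qed.

(** A boundary point is a limit of points [p'] outside [K], and the point [q] of [K] nearest to [p']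
    has the normal [p' - q], which the net approximates once normalised. Taking closures avoids the
    construction of a supporting line at the boundary point itself. *)
Lemma boundary_normal_pieces K eps J (nu : nat -> pt) : compact K -> convex2 K ->
  (forall n, edist (0, 0) n = 1 -> exists2 j, (j < J)%N & edist n (nu j) <= eps) ->
  K `\` interior K `<=` \bigcup_(j in `I_J) closure (normal_piece K eps (nu j)).
Proof.
move=> cK vK net.
have cU : closed (\bigcup_(j in `I_J) closure (normal_piece K eps (nu j))).
  by apply: closed_bigcup => // j _; exact: closed_closure.
move=> p [Kp nip]; apply: (closed_edist _).1 cU _ _ => e e0.
have [p' nKp' pp'] : exists2 p', ~ K p' & edist p p' < e / 2.
  apply: contrapT => h; apply: nip; apply/nbhs_edist.
  exists (e / 2); first by rewrite divr_gt0.
  by move=> q pq; apply: contrapT => nKq; apply: h; exists q.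
have [q Kq qmin] : exists2 q, K q & forall z, K z -> edist p' q <= edist p' z.
  by apply: nearest_point => //; exists p.
have [_ nq] := nearest_normal vK Kq qmin.
have d0 : 0 < edist p' q.
  rewrite lt_neqAle edist_ge0 andbT eq_sym; apply/eqP => /edist_eq0 e1.
  by apply: nKp'; rewrite e1.
pose d := (edist p' q)^-1; have di0 : 0 < d by rewrite invr_gt0.
pose n := (d * (p'.1 - q.1), d * (p'.2 - q.2)).
have n1 : edist (0, 0) n = 1.
  rewrite /edist/n/= !sub0r !sqrrN !exprMn -mulrDr -sqr_edist.
  by rewrite -exprMn mulVf ?gt_eqF// expr1n sqrtr1.
have [j jJ jn] := net _ n1; exists q.
  exists j => //; apply: subset_closure; exists n => //; split => // z Kz.
  have -> : dot n (z.1 - q.1, z.2 - q.2) = d * dot (p'.1 - q.1, p'.2 - q.2) (z.1 - q.1, z.2 - q.2).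
    by rewrite /dot/=; ring.
  by rewrite pmulr_rle0// nq.
have := edist_triangle p p' q; have := qmin _ Kp; rewrite (edistC p' p); lra.
Qed.

(** The chord has a component [a] along [nu], small by flatness, and a component [b] along the
    rotated normal; its width across [u] is [|a * e + b * c|] with [c = dot u nu]. The factor [u.1]
    turns a difference of intercepts into that width. *)
Lemma flat_proj u nu eps p q B : edist (0, 0) u = 1 -> edist (0, 0) nu = 1 -> 0 < u.1 ->
  flat eps nu B -> B p -> B q ->
  u.1 * `|proj (u.2 / u.1) p - proj (u.2 / u.1) q| <= (`|dot u nu| + eps) * edist p q /\
  (`|dot u nu| - 2 * eps) * edist p q <= u.1 * `|proj (u.2 / u.1) p - proj (u.2 / u.1) q|.
Proof.
move=> u1 nu1 u0 fB Bp Bq.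
have eu : u.1 ^+ 2 + u.2 ^+ 2 = 1.
  by have := sqr_edist (0, 0) u; rewrite u1 expr1n/= !sub0r !sqrrN => <-.
have en : nu.1 ^+ 2 + nu.2 ^+ 2 = 1.
  by have := sqr_edist (0, 0) nu; rewrite nu1 expr1n/= !sub0r !sqrrN => <-.
pose a := dot (p.1 - q.1, p.2 - q.2) nu.
pose b := dot (p.1 - q.1, p.2 - q.2) (- nu.2, nu.1).
pose c := dot u nu; pose e := dot (- u.2, u.1) nu.
have -> : u.1 * `|proj (u.2 / u.1) p - proj (u.2 / u.1) q| = `|a * e + b * c|.
  rewrite -{1}(gtr0_norm u0) -normrM; congr `|_|.
  have -> : u.1 * (proj (u.2 / u.1) p - proj (u.2 / u.1) q) =
      (p.2 - q.2) * u.1 - (p.1 - q.1) * u.2.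
    by rewrite /proj; field; rewrite gt_eqF.
  rewrite /a /b /c /e /dot/=.
  rewrite [LHS](_ : _ = ((p.2 - q.2) * u.1 - (p.1 - q.1) * u.2) * (nu.1 ^+ 2 + nu.2 ^+ 2)); last first.
    by rewrite en mulr1.
  by ring.
have N2 : edist p q ^+ 2 = a ^+ 2 + b ^+ 2.
  rewrite sqr_edist -[LHS]mulr1 -en /a /b /dot/=; ring.
have N0 := edist_ge0 p q; set N := edist p q in N2 N0 *.
have aN : `|a| <= eps * N by exact: fB.
have ce : c ^+ 2 + e ^+ 2 = 1.
  rewrite -[RHS]mulr1 -{1}eu -en /c /e /dot/=; ring.
have c1 : `|c| <= 1.
  rewrite -ler_sqr ?nnegrE// real_normK ?num_real// expr1n -ce lerDl sqr_ge0//.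
have e1 : `|e| <= 1.
  rewrite -ler_sqr ?nnegrE// real_normK ?num_real// expr1n -ce lerDr sqr_ge0//.
have bN : `|b| <= N.
  by rewrite -ler_sqr ?nnegrE// real_normK ?num_real// N2 lerDr sqr_ge0.
have Nab : N <= `|a| + `|b|.
  rewrite -ler_sqr ?nnegrE ?addr_ge0// N2 -(real_normK (num_real a)) -(real_normK (num_real b)).
  have := normr_ge0 a; have := normr_ge0 b; nra.
have a0 := normr_ge0 a; have b0 := normr_ge0 b; have c0 := normr_ge0 c; have e0 := normr_ge0 e.
have ae : `|a * e| <= `|a| by rewrite normrM ler_piMr.
have bc1 : `|b * c| <= `|c| * N by rewrite normrM mulrC ler_wpM2l.
have bc2 : `|c| * (N - `|a|) <= `|b * c| by rewrite normrM mulrC ler_wpM2r//; lra.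
have ca : `|c| * `|a| <= `|a| by rewrite ler_piMl.
split.
  by apply: le_trans (ler_normD _ _) _; rewrite -/c; lra.
have h : `|b * c| - `|a * e| <= `|a * e + b * c| by rewrite [a * e + _]addrC lerB_normD.
change ((`|c| - 2 * eps) * N <= `|a * e + b * c|); lra.
Qed.

Lemma proj_continuous (s : R) : continuous (proj s : pt -> R).
Proof.
move=> p; apply: cvgB; first exact: cvg_snd.
by apply: cvgM; [exact: cvg_cst|exact: cvg_fst].
Qed.

Lemma measurable_proj_compact (s : R) A : compact A -> measurable (proj s @` A).
Proof.
move=> cA; apply: compact_measurable.
by apply: continuous_compact => //; apply: continuous_subspaceT; exact: proj_continuous.
Qed.

Lemma hausdorff1_flat_le u nu eps B (M : R) :
  edist (0, 0) u = 1 -> edist (0, 0) nu = 1 -> 0 < u.1 ->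
  2 * eps < `|dot u nu| -> flat eps nu B ->
  (forall p, B p -> `|p.1| <= M /\ `|p.2| <= M) ->
  measurable (proj (u.2 / u.1) @` B) ->
  ((`|dot u nu| - 2 * eps)%:E * hausdorff1 B <= u.1%:E * mu (proj (u.2 / u.1) @` B))%E.
Proof.
move=> u1 nu1 u0 eu fB BM mB.
have d0 : 0 < `|dot u nu| - 2 * eps by rewrite subr_gt0.
rewrite -lee_pdivlMl// muleA -EFinM mulrC.
apply: (hausdorff1_le_proj (M := M)) => //; first by rewrite divr_gt0.
move=> p q Bp Bq; have [_] := flat_proj u1 nu1 u0 fB Bp Bq.
move=> h; rewrite mulrAC ler_pdivlMr// mulrC; exact: h.
Qed.

Lemma proj_dist_le (s M : R) p q : `|p.1| <= M -> `|p.2| <= M ->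
  `|q.1| <= M -> `|q.2| <= M -> `|proj s p - proj s q| <= 2 * (1 + `|s|) * M.
Proof.
move=> p1 p2 q1 q2.
have -> : proj s p - proj s q = p.2 + (- q.2) + (- s * p.1 + s * q.1) by rewrite /proj; ring.
apply: le_trans (ler_normD _ _) _; apply: le_trans (lerD (ler_normD _ _) (ler_normD _ _)) _.
rewrite !normrM !normrN.
have : `|s| * `|p.1| <= `|s| * M by rewrite ler_wpM2l.
have : `|s| * `|q.1| <= `|s| * M by rewrite ler_wpM2l.
lra.
Qed.

(** The numbers [|dot (u k) (nu j)|] have mean [sigma > 1 / 2], so some direction is transversal to
    the whole piece of normal [nu j], whose length is then controlled by that of its projection, at
    most a multiple of [M]. What matters is the linear growth in [M] with [c] independent of [K]. *)
Lemma hausdorff1_boundary : exists2 c : R, 0 < c & forall K (M : R), 0 <= M ->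
  compact K -> convex2 K -> (forall p, K p -> `|p.1| <= M /\ `|p.2| <= M) ->
  (hausdorff1 (K `\` interior K) <= (c * M)%:E)%E.
Proof.
have e100 : 0 < 1 / 100 :> R by rewrite divr_gt0.
have [m [J [u [nu [sigma [eps [m0 hu hnu net [eps0 epslt sigma_ge _]]]]]]]] := quadrature e100.
have sg : 1 / 2 < sigma.
  apply: lt_le_trans sigma_ge; rewrite ltr_pdivrMr// mulrAC.
  by rewrite ltr_pdivlMr ?pi_gt0//; have := pihalf_lt2 R; lra.
have /choice[C hC] j : exists C : R, 0 <= C /\ ((j < J)%N -> forall B (M : R), 0 <= M -> compact B ->
    flat eps (nu j) B -> (forall p, B p -> `|p.1| <= M /\ `|p.2| <= M) ->
    (hausdorff1 B <= (C * M)%:E)%E).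
  have [jJ|_] := ltnP j J; last by exists 0.
  have [nu1 sumj] := hnu _ jJ.
  have [k uk] : exists k : 'I_m, 1 / 2 < `|dot (u k) (nu j)|.
    apply: contrapT => h.
    have : \sum_(k < m) `|dot (u k) (nu j)| <= \sum_(k < m) (1 / 2 : R).
      apply: ler_sum => k _; rewrite leNgt; apply/negP => hk; apply: h.
      by exists k.
    rewrite sumj sumr_const card_ord -[leRHS]mulr_natl ler_pM2l ?ltr0n//.
    by rewrite leNgt sg.
  have [uk1 uk0] := hu _ (ltn_ord k).
  pose d := `|dot (u k) (nu j)| - 2 * eps.
  have d0 : 0 < d by rewrite /d; lra.
  pose s := (u k).2 / (u k).1.
  exists (d^-1 * ((u k).1 * (2 * (1 + `|s|)))); split.
    by rewrite !mulr_ge0// ?invr_ge0 ?ltW//; exact: addr_ge0.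
  move=> _ B M M0 cB fB BM.
  have mB : measurable (proj s @` B) by exact: measurable_proj_compact.
  have := hausdorff1_flat_le uk1 nu1 uk0 _ fB BM mB.
  have -> : 2 * eps < `|dot (u k) (nu j)| by lra.
  move=> /(_ isT); rewrite -/d -lee_pdivlMl// => /le_trans; apply.
  rewrite -mulrA EFinM lee_pmul2l ?lte_fin ?invr_gt0// -[leRHS](_ : (u k).1%:E * (2 * (1 + `|s|) * M)%:E = _)%E; last first.
    by rewrite -EFinM mulrA.
  rewrite lee_pmul2l ?lte_fin//.
  apply: mu_le_dist => //; first by rewrite !mulr_ge0//; exact: addr_ge0.
  move=> _ _ [p Bp <-] [q Bq <-].
  by have [p1 p2] := BM _ Bp; have [q1 q2] := BM _ Bq; exact: proj_dist_le.
pose c := \sum_(j < J) C j.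
have c0 : 0 <= c by apply: sumr_ge0 => j _; case: (hC j).
exists (c + 1); first by rewrite ltr_wpDl.
move=> K M M0 cK vK KM.
have cov := boundary_normal_pieces cK vK net.
apply: le_trans (hausdorff1S cov) _; apply: le_trans (hausdorff1_bigU _ _) _.
apply: (@le_trans _ _ (\sum_(j < J) (C j * M)%:E)%E); last first.
  by rewrite sumEFin lee_fin -mulr_suml -/c ler_wpM2r// lerDl.
apply: lee_sum => j _; have [_ /(_ (ltn_ord j))] := hC j; apply => //.
- apply: (@subclosed_compact _ _ K) => //; first exact: closed_closure.
  apply: closure_minimal; first exact: compact_closed_pt.
  by move=> p [n _ []].
- by apply: flat_closure (ltW eps0) _; exact: flat_normal_piece.
- move=> p /(closure_minimal (compact_closed_pt cK)) h; apply: KM; apply: h.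
  by move=> q [n _ []].
Qed.

End Flat.

(** * Measurability *)

Section Graph.
Context {R : realType}.
Local Notation pt := (R * R)%type.
Implicit Types (p q z : pt) (A B E F K : set pt).

Definition cbox (q : rat * rat) (e : R) : set pt :=
  `[ratr q.1 - e, ratr q.1 + e]%classic `*` `[ratr q.2 - e, ratr q.2 + e]%classic.
Definition obox (q : rat * rat) (e : R) : set pt :=
  `]ratr q.1 - e, ratr q.1 + e[%classic `*` `]ratr q.2 - e, ratr q.2 + e[%classic.

Lemma exists_obox p (e : R) : 0 < e -> exists q : rat * rat, obox q e p.
Proof.
move=> e0.
have [q1 + +] : exists2 q : rat, p.1 - e < ratr q & ratr q < p.1 + e.
  have /rat_in_itvoo[q] : p.1 - e < p.1 + e by lra.
  by rewrite in_itv/= => /andP[? ?]; exists q.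
have [q2 + +] : exists2 q : rat, p.2 - e < ratr q & ratr q < p.2 + e.
  have /rat_in_itvoo[q] : p.2 - e < p.2 + e by lra.
  by rewrite in_itv/= => /andP[? ?]; exists q.
move=> h1 h2 h3 h4; exists (q1, q2); split; rewrite /= in_itv/=; lra.
Qed.

(** As [Z w] is closed, it contains [t] iff at every scale [t] lies in an open box of rational
    centre whose closure is hit by [Z w]. This writes the graph with countably many measurable
    rectangles. *)
Lemma measurable_graph d (T : measurableType d) (Z : T -> set pt) :
  (forall w, closed (Z w)) ->
  (forall K, compact K -> measurable (Z @^-1` hit K)) ->
  measurable [set wt : T * (R * R) | Z wt.1 wt.2].
Proof.
move=> cZ mZ.
pose e n : R := n.+1%:R^-1.
have e0 n : 0 < e n by rewrite invr_gt0 ltr0n.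
rewrite [X in measurable X](_ : _ =
  \bigcap_n \bigcup_(q : rat * rat) ((Z @^-1` hit (cbox q (e n))) `*` obox q (e n))).
  apply: bigcapT_measurable => n; apply: countable_bigcupT_measurable => // q.
  apply: measurableX; last by apply: measurableX; exact: measurable_itv.
  by apply: mZ; apply: compact_setX; exact: segment_compact.
apply/seteqP; split => [[w t] /= Zt n _|[w t] /= h].
  have [q qt] := exists_obox t (e0 n); exists q => //; split => //=.
  exists t; split => //; case: qt; rewrite /= !in_itv/= => ? ?.
  by split; rewrite /= in_itv/=; lra.
apply: (closed_edist _).1 (cZ w) _ _ => r r0.
have [n _ nr] : exists2 n : nat, True & 4 * e n < r.
  exists (Num.truncn (4 / r)) => //.
  by rewrite /e ltr_pdivrMr ?ltr0n// mulrC -ltr_pdivrMr//; exact: truncnS_gt.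
have [q _ [/= [z [Zz [z1 z2]]] [t1 t2]]] := h n I.
exists z => //; apply: le_lt_trans (edist_le_add _ _) _.
move: z1 z2 t1 t2; rewrite /= !in_itv/= => *.
have : `|t.1 - z.1| <= 2 * e n by rewrite ler_norml; lra.
have : `|t.2 - z.2| <= 2 * e n by rewrite ler_norml; lra.
by move: nr; lra.
Qed.

(** A section of the graph of a constant random set. *)
Lemma closed_measurable2 A : closed A -> measurable A.
Proof.
move=> cA; have mA K : compact K -> measurable ((fun _ : R => A) @^-1` hit K).
  move=> _; have [h|h] := pselect (hit K A).
    by rewrite (_ : _ @^-1` _ = setT)//; apply/seteqP; split.
  by rewrite (_ : _ @^-1` _ = set0)//; apply/seteqP; split.
have /(measurable_xsection (0 : R)) := measurable_graph (fun=> cA) mA.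
by congr measurable; apply/seteqP; split => t; rewrite /xsection/= inE.
Qed.

(** Compact sets increasing to the difference of a compact [E] and a closed [F]; the distance kept
    from [F] is what provides the separation of pieces. *)
Definition exhaust E F (n : nat) : set pt :=
  [set p | E p /\ forall q, F q -> n.+1%:R^-1 <= edist p q].

Lemma compact_exhaust E F n : compact E -> compact (exhaust E F n).
Proof.
move=> cE; apply: (@subclosed_compact _ _ E) => //; last by move=> p [].
apply/closed_edist => p h; split.
  apply: (closed_edist _).1 (compact_closed_pt cE) _ _ => e /h[q [Eq _] pq].
  by exists q.
move=> q Fq; apply/ler_addgt0Pr => e /h[p' [_ /(_ _ Fq) p'q] pp'].
apply: le_trans p'q _; have := edist_triangle p' p q; rewrite (edistC p' p); move: pp'; lra.
Qed.

Lemma exhaust_nd E F : nondecreasing_seq (exhaust E F).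
Proof.
move=> m n mn; apply/subsetPset => p [Ep h]; split => // q /h; apply: le_trans.
by rewrite lef_pV2 ?posrE ?ltr0n// ler_nat ltnS.
Qed.

Lemma bigcup_exhaust E F : closed F -> \bigcup_n exhaust E F n = E `\` F.
Proof.
move=> cF; apply/seteqP; split => [p [n _ [Ep h]]|p [Ep nFp]].
  split => // /h; rewrite edistxx leNgt invr_gt0 ltr0n//.
have [e e0 he] : exists2 e : R, 0 < e & forall q, F q -> e <= edist p q.
  apply: contrapT => nh; apply: nFp; apply: (closed_edist _).1 cF _ _ => e e0.
  apply: contrapT => nq; apply: nh; exists e => // q Fq.
  by rewrite leNgt; apply/negP => pq; apply: nq; exists q.
exists (Num.truncn e^-1) => //; split => // q /he; apply: le_trans.
by rewrite -[leRHS]invrK lef_pV2 ?posrE ?invr_gt0 ?ltr0n// ltW// truncnS_gt.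
Qed.

Lemma compact_hitset (s rho : R) B : 0 <= rho -> compact B -> compact (hitset s rho B).
Proof.
move=> rho0 cB.
have -> : hitset s rho B = (fun px : pt * R => (proj s px.1, px.1.1 - px.2)) @` (B `*` `[0, rho]).
  apply/seteqP; split => [[c x] [x' /= xx' Bx']|_ [[p y] [/= Bp + <-]]].
    exists ((x', c + s * x'), x' - x); last by rewrite /proj/=; congr (_, _); ring.
    by split => //; rewrite /= in_itv/=; lra.
  rewrite in_itv/= => y0; exists p.1 => /=; first lra.
  by rewrite /proj subrK -surjective_pairing.
apply: continuous_compact; last by apply: compact_setX => //; exact: segment_compact.
apply: continuous_subspaceT => z.
have c1 : {for z, continuous (fst : pt * R -> pt)} by exact: cvg_fst.
have c2 : {for z, continuous (snd : pt * R -> R)} by exact: cvg_snd.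
have c3 : {for z.1, continuous (fst : pt -> R)} by exact: cvg_fst.
have c4 : {for z, continuous (fun px : pt * R => proj s px.1)}.
  exact: (cvg_comp _ _ c1 (@proj_continuous _ s z.1)).
have c5 : {for z, continuous (fun px : pt * R => px.1.1)}.
  exact: (cvg_comp _ _ c1 c3).
have c6 : {for z, continuous (fun px : pt * R => px.1.1 - px.2)}.
  exact: (@cvgB _ R^o _ _ _ _ _ _ _ c5 c2).
exact: (cvg_pair c4 c6).
Qed.

Lemma measurable_hitset (s rho : R) B : 0 <= rho -> compact B -> measurable (hitset s rho B).
Proof.
by move=> ? ?; apply: closed_measurable2; apply: compact_closed_pt; exact: compact_hitset.
Qed.

Lemma measurable_proj_diff (s : R) E F : compact E -> closed F ->
  measurable (proj s @` (E `\` F)).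
Proof.
move=> cE cF; rewrite -bigcup_exhaust// image_bigcup.
by apply: bigcupT_measurable => n; apply: measurable_proj_compact; exact: compact_exhaust.
Qed.

End Graph.

(** * Length and projections *)

Section Pieces.
Context {R : realType}.
Local Notation pt := (R * R)%type.
Local Notation mu := (@lebesgue_measure R).
Local Notation mu2 := (lebesgue_measure \x lebesgue_measure)%E.
Implicit Types (p q z : pt) (B E F K G : set pt).
Implicit Types (A : nat -> set pt) (u nu : nat -> pt).

Definition prev A F j := F `|` \bigcup_(l in `I_j) A l.
(** Each point is given to the first [A j] that contains it, so that the overlaps of the cover are
    not counted twice. *)
Definition piece A E F j := (E `&` A j) `\` prev A F j.

Lemma closed_prev A F j : closed F -> (forall l, closed (A l)) -> closed (prev A F j).
Proof. by move=> cF cA; apply: closedU => //; apply: closed_bigcup. Qed.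

Lemma compact_piece_base A E j : compact E -> closed (A j) -> compact (E `&` A j).
Proof. by move=> cE cA; exact: compact_closedI. Qed.

Lemma sub_bigcup_piece A E F J : E `\` F `<=` \bigcup_(j in `I_J) A j ->
  E `\` F `<=` \bigcup_(j in `I_J) piece A E F j.
Proof.
move=> cov p [Ep nFp]; have [j0 /= j0J Aj0] := cov p (conj Ep nFp).
have ex : exists j, `[< A j p >] by exists j0; exact/asboolP.
case: (ex_minnP ex) => j /asboolP Aj jmin.
have jJ : (j < J)%N by apply: leq_ltn_trans j0J; apply: jmin; exact/asboolP.
exists j => //; split => // -[//|[l /= lj Al]].
by move: lj; rewrite ltnNge jmin//; exact/asboolP.
Qed.

(** The lengths of the pieces must add up here, which subadditivity does not give: the piece [j] is
    exhausted by compact sets [B j n] at distance [1 / n.+1] from the earlier pieces. The area that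
    hits [B j n] in direction [k] is at most [r * (|dot (u k) (nu j)| + eps)] times its length, and
    the sum over [k] yields the same factor for every [j]. *)
Lemma hit_sum_le m J u nu (sigma eps r : R) G A (M : nat -> set (R * R)) :
  0 < eps -> 0 < r ->
  (forall k, (k < m)%N -> edist (0, 0) (u k) = 1 /\ 0 < (u k).1) ->
  (forall j, (j < J)%N -> edist (0, 0) (nu j) = 1 /\
     \sum_(k < m) `|dot (u k) (nu j)| = m%:R * sigma) ->
  compact G -> (forall j, closed (A j)) ->
  (forall j, (j < J)%N -> flat eps (nu j) (A j)) ->
  G `<=` \bigcup_(j in `I_J) A j ->
  (forall k, (k < m)%N -> measurable (M k)) ->
  (forall k, (k < m)%N -> M k `<=` hitset ((u k).2 / (u k).1) (r * (u k).1) G) ->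
  (\sum_(k < m) mu2 (M k) <= (r * (m%:R * (sigma + eps)))%:E * hausdorff1 G)%E.
Proof.
move=> eps0 r0 hu hnu cG cA fA GA mM MG.
pose B j n := exhaust (G `&` A j) (prev A set0 j) n.
have cB j n : compact (B j n) by apply: compact_exhaust; exact: compact_piece_base.
have clp j : closed (prev A set0 j) by apply: closed_prev => //; exact: closed0.
have sumB n : (\sum_(j < J) hausdorff1 (B j n) <= hausdorff1 G)%E.
  apply: le_trans (hausdorff1S (_ : \bigcup_(j in `I_J) B j n `<=` G)); last first.
    by move=> p [j _ [[]]].
  apply: (@hausdorff1_sum_sep _ n.+1%:R^-1); first by rewrite invr_gt0 ltr0n.
  move=> i j p q /andP[ij _] [[_ Ap] _] [_ +]; rewrite edistC; apply.
  by right; exists i.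
pose S k j n := hitset ((u k).2 / (u k).1) (r * (u k).1) (B j n).
have mS k j n : (k < m)%N -> measurable (S k j n).
  by move=> /hu[_ uk0]; apply: measurable_hitset => //; rewrite mulr_ge0// ltW.
have muS k j n : (k < m)%N -> (j < J)%N ->
    (mu2 (S k j n) <= (r * (`|dot (u k) (nu j)| + eps))%:E * hausdorff1 (B j n))%E.
  move=> km jJ; have [uk1 uk0] := hu _ km; have [nuj1 _] := hnu _ jJ.
  pose K := (`|dot (u k) (nu j)| + eps) / (u k).1.
  have -> : r * (`|dot (u k) (nu j)| + eps) = K * (r * (u k).1).
    by rewrite /K; field; rewrite gt_eqF.
  apply: (mu2_hitset_le _ _ _ (mS k j n km) (@subset_refl _ _)).
  - by rewrite divr_gt0// ltr_wpDl.
  - by rewrite mulr_gt0.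
  move=> p q [[_ Ap] _] [[_ Aq] _].
  have [+ _] := flat_proj uk1 nuj1 uk0 (fA _ jJ) Ap Aq.
  by rewrite mulrC -ler_pdivlMr// mulrAC.
pose Mn k n := M k `&` \big[setU/set0]_(j < J) S k j n.
have mMn k n : (k < m)%N -> measurable (Mn k n).
  move=> km; apply: measurableI; first exact: mM.
  by apply: bigsetU_measurable => j _; exact: mS.
have bnd n : (\sum_(k < m) mu2 (Mn k n) <= (r * (m%:R * (sigma + eps)))%:E * hausdorff1 G)%E.
  apply: (@le_trans _ _ (\sum_(k < m) \sum_(j < J)
      ((r * (`|dot (u k) (nu j)| + eps))%:E * hausdorff1 (B j n)))%E).
    apply: lee_sum => k _; apply: (@le_trans _ _ (mu2 (\big[setU/set0]_(j < J) S k j n))).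
      apply: le_measure; rewrite ?inE; first exact: mMn.
        by apply: bigsetU_measurable => j _; exact: mS.
      exact: subIsetr.
    apply: (le_trans (@Boole_inequality _ _ _ mu2 (fun j => S k j n) J _)).
      by move=> j _; exact: mS.
    by apply: lee_sum => j _; exact: muS.
  rewrite exchange_big/=.
  have -> : (\sum_(j < J) \sum_(k < m)
      ((r * (`|dot (u k) (nu j)| + eps))%:E * hausdorff1 (B j n)) =
      \sum_(j < J) (r * (m%:R * (sigma + eps)))%:E * hausdorff1 (B j n))%E.
    apply: eq_bigr => j _; have [_ sj] := hnu _ (ltn_ord j).
    rewrite -ge0_sume_distrl; last first.
      by move=> k _; rewrite lee_fin mulr_ge0 ?ltW// ltr_wpDl.
    rewrite sumEFin -mulr_sumr big_split/= sj sumr_const card_ord; congr (_%:E * _)%E.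
    by rewrite -[eps *+ m]mulr_natl -mulrDr.
  have [J0|J0] := posnP J.
    rewrite J0 big_ord0 in sumB *; rewrite (_ : G = set0) ?hausdorff1_set0 ?mule0//.
    by apply/seteqP; split=> // p /GA[j]; rewrite /= J0.
  have sg0 : 0 <= r * (m%:R * (sigma + eps)).
    have [_ sj] := hnu _ J0; rewrite mulrDr -sj.
    apply: mulr_ge0; first exact: ltW.
    apply: addr_ge0; first exact: sumr_ge0.
    by apply: mulr_ge0 => //; exact: ltW.
  rewrite -ge0_sume_distrr; last by move=> j _; exact: hausdorff1_ge0.
  by rewrite lee_wpmul2l ?lee_fin.
(* Every point of [M k] hits some [B j n], so the truncated sets increase to [M k] and the bound
   passes to the limit. *)
have cvgM k : (k < m)%N -> mu2 (Mn k n) @[n --> \oo] --> mu2 (M k).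
  move=> km; have ME : \bigcup_n Mn k n = M k.
    apply/seteqP; split => [cx [n _ []]//|cx Mcx].
    have [x' xx' Gx'] := MG k km _ Mcx.
    have [j jJ [GAj nF]] : (\bigcup_(j in `I_J) piece A G set0 j) (x', cx.1 + (u k).2 / (u k).1 * x').
      by apply: sub_bigcup_piece; rewrite setD0.
    have [n _ Bn] : (\bigcup_n B j n) (x', cx.1 + (u k).2 / (u k).1 * x').
      by rewrite /B bigcup_exhaust.
    exists n => //; split => //; rewrite -(bigcup_mkord J (fun j => S k j n)); exists j => //.
    by exists x'.
  rewrite -[in X in _ --> X]ME; apply: nondecreasing_cvg_mu.
  - by move=> n; exact: mMn.
  - by apply: bigcupT_measurable => n; exact: mMn.
  - move=> n1 n2 n12; apply/subsetPset => cx [Mcx]; rewrite -(bigcup_mkord J (fun j => S k j n1)) => -[j jJ [x' xx' Bx']].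
    split => //; rewrite -(bigcup_mkord J (fun j => S k j n2)); exists j => //; exists x' => //.
    by have /subsetPset := @exhaust_nd _ (G `&` A j) (prev A set0 j) _ _ n12; apply.
have C : (\sum_(k < m) mu2 (Mn k n))%E @[n --> \oo] --> (\sum_(k < m) mu2 (M k))%E.
  apply: cvg_nnesum => [k _|k _]; last exact: cvgM.
  by apply: nearW => n; exact: measure_ge0.
rewrite -(cvg_lim _ C)//; apply: lime_le; first by apply/cvg_ex; eexists; exact: C.
exact: nearW.
Qed.

(** A piece is a Lipschitz graph over its projection along [u k] unless [u k] is nearly tangent to
    it; a nearly tangent direction contributes at least 0, and discarding it only increases the sum
    of the factors. Subadditivity of length is enough for this inequality. *)
Lemma proj_sum_ge m J u nu (sigma eps : R) E F A : 0 < eps -> 2 * eps <= sigma ->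
  (forall k, (k < m)%N -> edist (0, 0) (u k) = 1 /\ 0 < (u k).1) ->
  (forall j, (j < J)%N -> edist (0, 0) (nu j) = 1 /\
     \sum_(k < m) `|dot (u k) (nu j)| = m%:R * sigma) ->
  compact E -> closed F -> (forall j, closed (A j)) ->
  (forall j, (j < J)%N -> flat eps (nu j) (A j)) ->
  E `\` F `<=` \bigcup_(j in `I_J) A j ->
  ((m%:R * (sigma - 2 * eps))%:E * hausdorff1 (E `\` F) <=
   \sum_(k < m) (u k).1%:E * \sum_(j < J) mu (proj ((u k).2 / (u k).1) @` piece A E F j))%E.
Proof.
move=> eps0 es hu hnu cE cF cA fA cov.
have c0 : 0 <= m%:R * (sigma - 2 * eps) by rewrite mulr_ge0// subr_ge0.
apply: (@le_trans _ _ ((m%:R * (sigma - 2 * eps))%:E * \sum_(j < J) hausdorff1 (piece A E F j))%E).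
  rewrite lee_wpmul2l ?lee_fin//; apply: le_trans (hausdorff1_bigU _ _).
  exact/hausdorff1S/sub_bigcup_piece.
rewrite ge0_sume_distrr; last by move=> *; exact: hausdorff1_ge0.
have [M M0 EM] := compact_edist_bounded cE.
rewrite [leRHS](_ : _ = \sum_(j < J) \sum_(k < m)
    ((u k).1%:E * mu (proj ((u k).2 / (u k).1) @` piece A E F j)))%E; last first.
  rewrite exchange_big/=; apply: eq_bigr => k _; rewrite ge0_sume_distrr//.
apply: lee_sum => j _; have [nu1 sj] := hnu _ (ltn_ord j).
apply: (@le_trans _ _ (\sum_(k < m) (Num.max 0 (`|dot (u k) (nu j)| - 2 * eps))%:E * hausdorff1 (piece A E F j))%E).
  rewrite -ge0_sume_distrl; last by move=> k _; rewrite lee_fin le_max lexx.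
  rewrite sumEFin lee_wpmul2r ?hausdorff1_ge0// lee_fin.
  have <- : \sum_(k < m) (`|dot (u k) (nu j)| - 2 * eps) = m%:R * (sigma - 2 * eps).
    by rewrite sumrB sj sumr_const card_ord -[2 * eps *+ m]mulr_natl -mulrBr.
  by apply: ler_sum => k _; rewrite le_max lexx orbT.
apply: lee_sum => k _; have [uk1 uk0] := hu _ (ltn_ord k).
have [h|h] := leP (`|dot (u k) (nu j)| - 2 * eps) 0.
  by rewrite mul0e mule_ge0// lee_fin ltW.
apply: (hausdorff1_flat_le (M := M)) => //.
- by rewrite -subr_gt0.
- by apply: sub_flat (fA _ (ltn_ord j)) => p [[]].
- by move=> p [[/EM]].
apply: measurable_proj_diff; first exact: compact_piece_base.
exact: closed_prev.
Qed.

Lemma boundary_flat_cover (eps : R) J nu N (K : nat -> set pt) : 0 <= eps ->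
  (forall n, edist (0, 0) n = 1 -> exists2 j, (j < J)%N & edist n (nu j) <= eps) ->
  (forall i, (i < N)%N -> compact (K i) /\ convex2 (K i)) ->
  exists A, [/\ (forall t, closed (A t)),
    (forall t, (t < N * J)%N -> flat eps (nu (t %% J)%N) (A t)) &
    forall i, (i < N)%N -> K i `\` interior (K i) `<=` \bigcup_(t in `I_(N * J)) A t].
Proof.
move=> eps0 net hK.
(* The pair of a set [i] and a normal [j] is coded as [t = i * J + j]. *)
exists (fun t => closure (normal_piece (K (t %/ J)%N) eps (nu (t %% J)%N))).
split=> [t|t _|i iN p].
- exact: closed_closure.
- by apply: flat_closure => //; exact: flat_normal_piece.
have [cK vK] := hK i iN.
move=> /(boundary_normal_pieces cK vK net)[j /= jJ pj].
exists (i * J + j)%N; rewrite /= ?divnMDl ?modnMDl ?divn_small ?modn_small ?addn0//; last first.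
  by apply: leq_ltn_trans jJ.
apply: (@leq_trans (i.+1 * J)); first by rewrite mulSn addnC ltn_add2r.
by rewrite leq_mul2r iN orbT.
Qed.

End Pieces.

(** * Sign changes along lines *)

Section Lines.
Context {R : realType}.
Local Notation pt := (R * R)%type.
Implicit Types (p q z : pt) (K Z U : set pt) (s c x y t : R).

Definition line s c x : pt := (x, c + s * x).

Lemma proj_line s c x : proj s (line s c x) = c.
Proof. by rewrite /proj /line/= addrK. Qed.

Lemma line_proj s p : line s (proj s p) p.1 = p.
Proof. by rewrite /line /proj subrK -surjective_pairing. Qed.

Lemma proj_conv s t p q :
  proj s ((1 - t) * p.1 + t * q.1, (1 - t) * p.2 + t * q.2) =
  (1 - t) * proj s p + t * proj s q.
Proof. by rewrite /proj/=; ring. Qed.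

(** Convexity will exclude the middle one of three exceptional parallel lines, hence this criterion
    for their finiteness. *)
Lemma finite_no3 (X : set R) :
  (forall a b c, a < b < c -> X a -> X b -> X c -> False) -> finite_set X.
Proof.
move=> h; have [->|/set0P[a Xa]] := eqVneq X set0; first exact: finite_set0.
have [Xs|/existsNP[b /not_implyP[Xb /eqP ba]]] := pselect (forall b, X b -> b = a).
  by apply: (sub_finite_set (B := [set a])) => // b /Xs ->.
apply: (sub_finite_set (B := [set a; b])); last by apply: finite_set2.
move=> c Xc; have [->|ca] := eqVneq c a; first by left.
have [->|cb] := eqVneq c b; first by right.
exfalso; move: ba ca cb; case: (ltgtP b a) => // ba _; case: (ltgtP c a) => // ca _;
  case: (ltgtP c b) => // cb _; try lra.
- by apply: (h c b a); rewrite ?cb.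
- by apply: (h b c a); rewrite ?cb ?ca.
- by apply: (h b a c); rewrite ?ba ?ca.
- by apply: (h c a b); rewrite ?ba ?ca.
- by apply: (h a c b); rewrite ?cb ?ca.
- by apply: (h a b c); rewrite ?ba ?cb.
Qed.

Lemma interior_conv K z q t : convex2 K -> interior K z -> K q -> 0 <= t < 1 ->
  interior K ((1 - t) * z.1 + t * q.1, (1 - t) * z.2 + t * q.2).
Proof.
move=> vK /nbhs_edist[e e0 ze] Kq /andP[t0 t1].
apply/nbhs_edist; exists ((1 - t) * e); first by rewrite mulr_gt0// subr_gt0.
move=> w; have t10 : 0 < 1 - t by rewrite subr_gt0.
set p := (_, _) => pw.
pose z' : pt := (z.1 + (w.1 - p.1) / (1 - t), z.2 + (w.2 - p.2) / (1 - t)).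
have Kz' : K z'.
  apply: ze; rewrite -(ltr_pM2l t10); apply: le_lt_trans pw.
  have e1 : 0 <= edist p w / (1 - t) by rewrite divr_ge0 ?edist_ge0 ?ltW.
  rewrite -ler_pdivlMl// mulrC edist_le_sqr// expr_div_n sqr_edist/=.
  rewrite le_eqVlt; apply/orP; left; apply/eqP; field; rewrite gt_eqF//.
have -> : w = ((1 - t) * z'.1 + t * q.1, (1 - t) * z'.2 + t * q.2).
  rewrite [LHS]surjective_pairing /z' /p/=; congr (_, _); field; rewrite gt_eqF//.
by apply: vK => //; rewrite t0 ltW.
Qed.

Definition tangent_set s K : set R :=
  [set c | (exists2 p, K p & proj s p = c) /\ ~ exists2 z, interior K z & proj s z = c].

(** A line strictly between two lines that meet [K] meets its interior: join an interior point to
    the point of [K] on the other side. *)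
Lemma finite_tangent s K : convex2 K -> interior K !=set0 -> finite_set (tangent_set s K).
Proof.
move=> vK [z iz]; apply: finite_no3 => a b c /andP[ab bc] [[p1 K1 e1] _] [_ n2] [[p3 K3 e3] _].
apply: n2.
have [zb|zb|zb] := ltgtP (proj s z) b; last by exists z.
- pose t := (b - proj s z) / (c - proj s z).
  have d0 : 0 < c - proj s z by lra.
  exists ((1 - t) * z.1 + t * p3.1, (1 - t) * z.2 + t * p3.2).
    apply: interior_conv => //; apply/andP; split; first by apply: divr_ge0; lra.
    by rewrite /t ltr_pdivrMr//; lra.
  by rewrite proj_conv e3 /t; field; rewrite gt_eqF.
- pose t := (proj s z - b) / (proj s z - a).
  have d0 : 0 < proj s z - a by lra.
  exists ((1 - t) * z.1 + t * p1.1, (1 - t) * z.2 + t * p1.2).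
    apply: interior_conv => //; apply/andP; split; first by apply: divr_ge0; lra.
    by rewrite /t ltr_pdivrMr//; lra.
  by rewrite proj_conv e1 /t; field; rewrite gt_eqF.
Qed.

Lemma convex3 K p q z (a b c : R) : convex2 K -> K p -> K q -> K z ->
  0 <= a -> 0 <= b -> 0 <= c < 1 -> a + b + c = 1 ->
  K (a * p.1 + b * q.1 + c * z.1, a * p.2 + b * q.2 + c * z.2).
Proof.
move=> vK Kp Kq Kz a0 b0 /andP[c0 c1] abc.
have c10 : 0 < 1 - c by rewrite subr_gt0.
pose t := b / (1 - c).
have Kw : K ((1 - t) * p.1 + t * q.1, (1 - t) * p.2 + t * q.2).
  apply: vK => //; apply/andP; split; first by apply: divr_ge0; lra.
  by rewrite /t ler_pdivrMr//; lra.
have aE : a = (1 - c) * (1 - t).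
  rewrite (_ : a = 1 - b - c); last by lra.
  by rewrite /t; field; rewrite gt_eqF.
have bE : b = (1 - c) * t by rewrite /t; field; rewrite gt_eqF.
have := vK _ _ Kw Kz c; rewrite c0 ltW// => /(_ isT)/=.
congr K; congr (_, _); rewrite [in RHS]aE [in RHS]bE; ring.
Qed.

Lemma line_triangle K s c1 c3 x1 x3 t x' p : convex2 K ->
  K (line s c1 x1) -> K (line s c3 x3) -> 0 < t < 1 -> c1 < c3 ->
  let c2 := (1 - t) * c1 + t * c3 in let x2 := (1 - t) * x1 + t * x3 in
  K (line s c2 x') -> x' != x2 ->
  `|proj s p - c2| <= (c3 - c1) * (t * (1 - t) / 2) ->
  0 <= (p.1 - x2 - (proj s p - c2) / (c3 - c1) * (x3 - x1)) / (x' - x2) <= 1 / 2 ->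
  K p.
Proof.
move=> vK K1 K3 /andP[t0 t1] c13 c2 x2 K2 x'x2 ha.
set a := proj s p - c2 in ha *; set l := (_ / (x' - x2)) => /andP[l0 l1].
have D0 : 0 < c3 - c1 by rewrite subr_gt0.
have g0 : x' - x2 != 0 by rewrite subr_eq0.
have hb : `|a / (c3 - c1)| <= t * (1 - t) / 2.
  by rewrite normrM normfV (gtr0_norm D0) ler_pdivrMr// mulrC.
set b := a / (c3 - c1) in hb l l0 l1 *.
have tt : t * (1 - t) <= t /\ t * (1 - t) <= 1 - t by split; nra.
move: hb; rewrite ler_norml => /andP[b1 b2].
have Kc := @convex3 K _ _ _ ((1 - l) * (1 - t) - b) ((1 - l) * t + b) l vK K1 K3 K2.
have w1 : 0 <= (1 - l) * (1 - t) - b by nra.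
have w2 : 0 <= (1 - l) * t + b by nra.
have l01 : 0 <= l < 1 by rewrite l0/=; lra.
have sum1 : (1 - l) * (1 - t) - b + ((1 - l) * t + b) + l = 1 by ring.
have := Kc w1 w2 l01 sum1.
have bE : b * (c3 - c1) = a by rewrite /b divfK// gt_eqF.
have lE : l * (x' - x2) = p.1 - x2 - b * (x3 - x1) by rewrite /l divfK.
congr K; rewrite [RHS]surjective_pairing /line/=; congr (_, _).
  apply/eqP; rewrite -subr_eq0; apply/eqP.
  transitivity (l * (x' - x2) - (p.1 - x2 - b * (x3 - x1))); last by rewrite lE subrr.
  by rewrite /x2; ring.
have p2 : p.2 = c2 + a + s * p.1 by rewrite /a /proj; ring.
rewrite p2 -bE; apply/eqP; rewrite -subr_eq0; apply/eqP.
transitivity (s * (l * (x' - x2) - (p.1 - x2 - b * (x3 - x1)))); last by rewrite lE subrr mulr0.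
by rewrite /x2 /c2; ring.
Qed.

(** Lines on which [K1] stops exactly where [K2] starts, at a frontier point of the union: there the
    line meets the frontier without a change of side. *)
Definition touch_set s K1 K2 : set R :=
  [set c | exists x, [/\ K1 (line s c x), K2 (line s c x),
     (exists2 x', x' < x & K1 (line s c x')) /\ (forall y, x < y -> ~ K1 (line s c y)),
     (exists2 x', x < x' & K2 (line s c x')) /\ (forall y, y < x -> ~ K2 (line s c y)) &
     ~ interior (K1 `|` K2) (line s c x)]].

(** The contact points on the outer lines lie in both sets, hence so does the point where their
    segment crosses the middle line, which can only be the contact point [x2]. The triangles from
    this segment to [xl] in [K1] and to [xr] in [K2] fill a neighbourhood of [x2], which is then
    interior to the union. *)
Lemma finite_touch s K1 K2 : convex2 K1 -> convex2 K2 -> finite_set (touch_set s K1 K2).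
Proof.
move=> v1 v2; apply: finite_no3 => c1 c2 c3 /andP[c12 c23].
move=> [x1 [K11 K21 _ _ _]] [x2 [_ _ [[xl xlx2 Kxl] nl] [[xr xrx2 Kxr] nr] ni]] [x3 [K13 K23 _ _ _]].
have D0 : 0 < c3 - c1 by lra.
pose t := (c2 - c1) / (c3 - c1).
have t0 : 0 < t by rewrite divr_gt0// subr_gt0.
have t1 : t < 1 by rewrite ltr_pdivrMr//; lra.
have c2E : c2 = (1 - t) * c1 + t * c3 by rewrite /t; field; rewrite gt_eqF.
have lineE : ((1 - t) * (line s c1 x1).1 + t * (line s c3 x3).1,
    (1 - t) * (line s c1 x1).2 + t * (line s c3 x3).2) = line s c2 ((1 - t) * x1 + t * x3).
  by rewrite /line/= c2E; congr (_, _); ring.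
have t01 : 0 <= t <= 1 by rewrite !ltW.
have x2E : x2 = (1 - t) * x1 + t * x3.
  have := v1 _ _ K11 K13 t t01; rewrite lineE => h1.
  have := v2 _ _ K21 K23 t t01; rewrite lineE => h2.
  have [h|h|//] := ltgtP x2 ((1 - t) * x1 + t * x3).
    by have := nl _ h h1.
  by have := nr _ h h2.
apply: ni; apply/nbhs_edist.
pose g := Num.min (x2 - xl) (xr - x2).
have g0 : 0 < g by rewrite lt_min; lra.
pose d := (c3 - c1) * (t * (1 - t) / 2).
have d0 : 0 < d.
  by apply: mulr_gt0 => //; apply: divr_gt0 => //; apply: mulr_gt0 => //; rewrite subr_gt0.
pose B := 1 + (1 + `|s|) / (c3 - c1) * `|x3 - x1|.
have s0 : 0 < 1 + `|s| by rewrite ltr_pwDl.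
have B0 : 0 < B.
  by apply: ltr_pwDl => //; apply: mulr_ge0 => //; apply: divr_ge0; exact: ltW.
pose e := Num.min (d / (1 + `|s|)) (g / 2 / B).
have e0 : 0 < e by rewrite lt_min; apply/andP; split; do ?apply: divr_gt0.
exists e => // p pe.
have p1 : `|p.1 - x2| <= e.
  by have := edist_fst (line s c2 x2) p; rewrite distrC/= => /le_trans; apply; exact: ltW.
have p2 : `|p.2 - (c2 + s * x2)| <= e.
  by have := edist_snd (line s c2 x2) p; rewrite distrC/= => /le_trans; apply; exact: ltW.
have ha : `|proj s p - c2| <= (1 + `|s|) * e.
  have -> : proj s p - c2 = (p.2 - (c2 + s * x2)) - s * (p.1 - x2) by rewrite /proj; ring.
  apply: le_trans (ler_normB _ _) _; rewrite normrM.
  have : `|s| * `|p.1 - x2| <= `|s| * e by rewrite ler_wpM2l.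
  lra.
have ed : (1 + `|s|) * e <= d by rewrite mulrC -ler_pdivlMr// ge_min lexx.
have eg : e * B <= g / 2 by rewrite -ler_pdivlMr// ge_min lexx orbT.
pose b := p.1 - x2 - (proj s p - c2) / (c3 - c1) * (x3 - x1).
have hb : `|b| <= g / 2.
  apply: le_trans eg; rewrite /b; apply: le_trans (ler_normB _ _) _.
  have -> : e * B = e + (1 + `|s|) * e / (c3 - c1) * `|x3 - x1| by rewrite /B; ring.
  apply: lerD => //; rewrite normrM normrM normfV (gtr0_norm D0).
  by apply: ler_wpM2r => //; apply: ler_wpM2r => //; rewrite invr_ge0 ltW.
have gl : g <= x2 - xl by rewrite ge_min lexx.
have gr : g <= xr - x2 by rewrite ge_min lexx orbT.
move: hb; rewrite ler_norml => /andP[hb1 hb2].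
have t01' : 0 < t < 1 by rewrite t0 t1.
have c13 : c1 < c3 by lra.
have ha' := le_trans ha ed.
have [b0|b0] := leP b 0.
  have xx : 0 < x2 - xl by lra.
  left; have := @line_triangle K1 s c1 c3 x1 x3 t xl p v1 K11 K13 t01' c13.
  rewrite /= -c2E -x2E; apply => //; first by rewrite lt_eqF.
  change (0 <= b / (xl - x2) <= 1 / 2).
  clearbody b g; rewrite -mulrNN -invrN opprB; apply/andP; split.
    by apply: divr_ge0; lra.
  by rewrite ler_pdivrMr//; lra.
have xx : 0 < xr - x2 by lra.
right; have := @line_triangle K2 s c1 c3 x1 x3 t xr p v2 K21 K23 t01' c13.
rewrite /= -c2E -x2E; apply => //; first by rewrite gt_eqF.
change (0 <= b / (xr - x2) <= 1 / 2).
clearbody b g; apply/andP; split; first by apply: divr_ge0; lra.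
by rewrite ler_pdivrMr//; lra.
Qed.

End Lines.

(** * Change of membership at frontier points of non-exceptional lines *)

Section SignChange.
Context {R : realType}.
Local Notation pt := (R * R)%type.
Local Notation mu := (@lebesgue_measure R).
Local Notation mu2 := (lebesgue_measure \x lebesgue_measure)%E.
Implicit Types (p q z : pt) (Z U W : set pt) (K : nat -> set pt) (s c x y t : R).

Lemma zinP Z p : reflect (Z p) (zin Z p).
Proof. exact: asboolP. Qed.

Lemma edist_line s c x y : edist (line s c x) (line s c y) <= (1 + `|s|) * `|x - y|.
Proof.
apply: le_trans (edist_le_add _ _) _; rewrite /line/=.
have -> : c + s * x - (c + s * y) = s * (x - y) by ring.
by rewrite normrM mulrDl mul1r.
Qed.

Lemma open_line U s c x : open U -> U (line s c x) ->
  exists2 d : R, 0 < d & forall y, `|x - y| < d -> U (line s c y).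
Proof.
move=> oU Ux; have /nbhs_edist[e e0 eU] : nbhs (line s c x) U by exact: open_nbhs_nbhs.
have s0 : 0 < 1 + `|s| by rewrite ltr_pwDl.
exists (e / (1 + `|s|)); first by rewrite divr_gt0.
by move=> y xy; apply: eU; apply: le_lt_trans (edist_line _ _ _ _) _; rewrite mulrC -ltr_pdivlMr.
Qed.

Lemma uniform_right N x (e : R) (Q : nat -> R -> Prop) :
  (forall i, (i < N)%N -> exists2 d, 0 < d & forall y, 0 < e * (y - x) < d -> Q i y) ->
  exists2 d, 0 < d & forall i y, (i < N)%N -> 0 < e * (y - x) < d -> Q i y.
Proof.
elim: N => [|N ih] h; first by exists 1.
have [d1 d10 h1] := ih (fun i iN => h i (ltnW iN)).
have [d2 d20 h2] := h N (ltnSn N).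
exists (Num.min d1 d2); first by rewrite lt_min d10.
move=> i y; rewrite ltnS leq_eqVlt => /orP[/eqP ->|iN] /andP[y0]; rewrite lt_min => /andP[y1 y2].
  by apply: h2; rewrite y0.
by apply: h1 => //; rewrite y0.
Qed.

Section Crossing.
Context (N : nat) (K : nat -> set pt) (Z U : set pt) (s : R).
Context (cK : forall i, (i < N)%N -> compact (K i)).
Context (vK : forall i, (i < N)%N -> convex2 (K i)).
Context (iK : forall i, (i < N)%N -> interior (K i) !=set0).
Context (KZ : forall i, (i < N)%N -> K i `<=` Z).
Context (oU : open U).
Context (ZK : Z `&` U `<=` \bigcup_(i in `I_N) K i).

Definition exceptional_lines : set R :=
  \bigcup_(i in `I_N) tangent_set s (K i) `|`
  \bigcup_(i in `I_N) \bigcup_(j in `I_N) touch_set s (K i) (K j).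

Lemma finite_exceptional_lines : finite_set exceptional_lines.
Proof.
rewrite finite_setU; split; apply: bigcup_finite => // i iN.
  by apply: finite_tangent; [exact: vK|exact: iK].
by apply: bigcup_finite => // j jN; apply: finite_touch; exact: vK.
Qed.

(** For [e = 1] the set comes from the left and ends at [x]; [e = -1] is the mirror image, so that
    one argument serves both. *)
Definition on_side (e : R) c x i :=
  (exists2 x', 0 < e * (x - x') & K i (line s c x')) /\
  (forall y, 0 < e * (y - x) -> ~ K i (line s c y)).

Lemma line_conv c x y t :
  ((1 - t) * (line s c x).1 + t * (line s c y).1, (1 - t) * (line s c x).2 + t * (line s c y).2) =
  line s c ((1 - t) * x + t * y).
Proof. by rewrite /line/=; congr (_, _); ring. Qed.

Lemma convex_line i c x y (z : R) : (i < N)%N -> K i (line s c x) -> K i (line s c y) ->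
  x <= z <= y \/ y <= z <= x -> K i (line s c z).
Proof.
move=> iN; wlog xy : x y / x <= y.
  move=> h Kx Ky xzy; have [xy|/ltW yx] := leP x y; first exact: h xzy.
  by apply: (h y x) => //; case: xzy; [right|left].
move=> Kx Ky xzy; have {}xzy : x <= z <= y by case: xzy => [//|]; lra.
have [xy0|xy0] := eqVneq x y; first by have -> : z = x by lra.
have d0 : 0 < y - x by rewrite subr_gt0 lt_neqAle xy0.
pose t := (z - x) / (y - x).
have -> : z = (1 - t) * x + t * y by rewrite /t; field; rewrite gt_eqF.
rewrite -line_conv; apply: vK => //; apply/andP; split; first by apply: divr_ge0; lra.
by rewrite /t ler_pdivrMr//; lra.
Qed.

Lemma interior_line i c x y (z : R) : (i < N)%N -> interior (K i) (line s c x) -> K i (line s c y) ->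
  x < z < y \/ y < z < x -> interior (K i) (line s c z).
Proof.
move=> iN Kx Ky xzy.
have d0 : y - x != 0 by apply/eqP; case: xzy; lra.
pose t := (z - x) / (y - x).
have -> : z = (1 - t) * x + t * y by rewrite /t; field.
rewrite -line_conv; apply: interior_conv => //; first exact: vK.
case: xzy => xzy; last rewrite /t -mulrNN -invrN !opprB; apply/andP; split; rewrite ?ltr_pdivrMr//; try lra.
- by apply: divr_ge0; lra.
- by apply: divr_ge0; lra.
Qed.

(** The line is not tangent to [K i], so it carries an interior point of [K i]; if [K i] continued
    beyond [x] as seen from there, [x] would be interior. *)
Lemma on_one_side c x i : ~ exceptional_lines c -> (i < N)%N -> K i (line s c x) ->
  ~ interior Z (line s c x) -> on_side 1 c x i \/ on_side (-1) c x i.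
Proof.
move=> nc iN Kx nZ.
have nKx : ~ interior (K i) (line s c x).
  by move=> h; apply: nZ; apply: (interiorS (KZ iN)).
have [z iz ez] : exists2 z, interior (K i) z & proj s z = c.
  apply: contrapT => nz; apply: nc; left; exists i => //; split => //.
  by exists (line s c x) => //; rewrite proj_line.
move: iz; rewrite -(line_proj s z) ez; move: z.1 => y iy {z ez}.
have Ky := interior_subset iy.
have [yx|xy|yx] := ltgtP y x; last by move: nKx; rewrite -yx.
  left; split; first by exists y => //; lra.
  by move=> w xw Kw; apply: nKx; apply: (interior_line iN iy Kw); left; lra.
right; split; first by exists y => //; lra.
by move=> w xw Kw; apply: nKx; apply: (interior_line iN iy Kw); right; lra.
Qed.

Lemma sides_agree c x i j : ~ exceptional_lines c -> (i < N)%N -> (j < N)%N ->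
  K i (line s c x) -> K j (line s c x) ->
  ~ interior Z (line s c x) -> on_side 1 c x i -> on_side (-1) c x j -> False.
Proof.
move=> nc iN jN Ki Kj nZ [[x1 h1 K1] n1] [[x2 h2 K2] n2]; apply: nc; right.
exists i => //; exists j => //; exists x; split => //.
- split; first by exists x1 => //; lra.
  by move=> y xy; apply: n1; lra.
- split; first by exists x2 => //; lra.
  by move=> y xy; apply: n2; lra.
- move=> h; apply: nZ; move: h; apply: interiorS => p [] /KZ; exact.
Qed.

(** The sets through [x] all stop there, and the finitely many closed sets that avoid [x] avoid a
    neighbourhood of it, so nothing of [Z] is left just beyond [x]. *)
Lemma side_crossing (e : R) c x : e = 1 \/ e = -1 -> U (line s c x) -> Z (line s c x) ->
  (forall i, (i < N)%N -> K i (line s c x) -> on_side e c x i) ->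
  exists2 d, 0 < d & forall y, (0 < e * (x - y) < d -> Z (line s c y)) /\
                              (0 < e * (y - x) < d -> ~ Z (line s c y)).
Proof.
move=> e1 Ux Zx side.
have [i0 iN0 Ki0] := ZK (conj Zx Ux).
have [[x' xx' Kx'] _] := side i0 iN0 Ki0.
have [dU dU0 hU] := open_line oU Ux.
have [d d0 hd] : exists2 d, 0 < d & forall i y, (i < N)%N -> 0 < e * (y - x) < d -> ~ K i (line s c y).
  apply: uniform_right => i iN.
  have [Ki|nKi] := pselect (K i (line s c x)).
    exists 1 => // y /andP[y0 _]; have [_] := side i iN Ki; exact.
  have oKi : open (~` K i) by apply: closed_openC; apply: compact_closed_pt; exact: cK.
  have [d d0 hd] := open_line oKi nKi; exists d => // y yd; apply: hd.
  rewrite distrC; case: e1 yd => ->; rewrite ?mul1r ?mulN1r => /andP[y0 yd].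
    by rewrite gtr0_norm.
  by rewrite ltr0_norm//; lra.
exists (Num.min (Num.min d dU) (e * (x - x'))).
  by rewrite !lt_min d0 dU0.
move=> y; rewrite !lt_min; split => [/andP[y0 /andP[_ yx']]|/andP[y0 /andP[/andP[yd ydU] _]] Zy].
  apply: (KZ iN0); apply: (convex_line iN0 Ki0 Kx').
  by case: e1 y0 yx' => ->; rewrite ?mul1r ?mulN1r => *; [right|left]; lra.
have Uy : U (line s c y).
  apply: hU; rewrite distrC; case: e1 y0 ydU => ->; rewrite ?mul1r ?mulN1r => *.
    by rewrite gtr0_norm.
  by rewrite ltr0_norm//; lra.
have [i iN Ki] := ZK (conj Zy Uy).
by apply: (hd i y iN) Ki; rewrite y0 yd.
Qed.

Lemma sign_change c x : ~ exceptional_lines c ->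
  Z (line s c x) -> ~ interior Z (line s c x) -> U (line s c x) ->
  exists2 d, 0 < d & exists b, forall y,
    (x - d < y < x -> zin Z (line s c y) = b) /\
    (x < y < x + d -> zin Z (line s c y) = ~~ b).
Proof.
move=> nc Zx nZ Ux.
have one i : (i < N)%N -> K i (line s c x) -> on_side 1 c x i \/ on_side (-1) c x i.
  by move=> iN Kx; exact: on_one_side.
have [i0 iN0 Ki0] := ZK (conj Zx Ux).
have [l|r] := one i0 iN0 Ki0.
  have [d d0 h] : exists2 d, 0 < d & forall y, (0 < 1 * (x - y) < d -> Z (line s c y)) /\
                              (0 < 1 * (y - x) < d -> ~ Z (line s c y)).
    apply: side_crossing => //; first by left.
    move=> i iN Ki; have [//|ri] := one i iN Ki.
    by case: (sides_agree nc iN0 iN Ki0 Ki nZ l ri).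
  exists d => //; exists true => y; have [h1 h2] := h y; split => hy.
    by apply/asboolP; apply: h1; lra.
  by apply/asboolPn; apply: h2; lra.
have [d d0 h] : exists2 d, 0 < d & forall y, (0 < -1 * (x - y) < d -> Z (line s c y)) /\
                            (0 < -1 * (y - x) < d -> ~ Z (line s c y)).
  apply: side_crossing => //; first by right.
  move=> i iN Ki; have [li|//] := one i iN Ki.
  by case: (sides_agree nc iN iN0 Ki Ki0 nZ li r).
exists d => //; exists false => y; have [h1 h2] := h y; split => hy.
  by apply/asboolPn; apply: h2; lra.
by apply/asboolP; apply: h1; lra.
Qed.

End Crossing.

(** For small [rho] the intervals to the left of distinct points are disjoint; the induction takes
    the last one out of [S rho]. *)
Lemma crossing_measure J (x : nat -> R) (sel : nat -> bool) (S : R -> set R) :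
  (forall rho, measurable (S rho)) ->
  (forall j, (j < J)%N -> sel j ->
     exists2 d, 0 < d & forall rho, 0 < rho < d -> `]x j - rho, x j[ `<=` S rho) ->
  (forall i j, (i < j < J)%N -> sel i -> sel j -> x i != x j) ->
  exists2 d, 0 < d & forall rho, 0 < rho < d ->
    ((\sum_(j < J) (sel j)%:R * rho)%:E <= mu (S rho))%E.
Proof.
elim: J S => [|J ih] S mS hS hx.
  by exists 1 => // rho _; rewrite big_ord0.
have [sJ|nsJ] := boolP (sel J); last first.
  have [d d0 hd] := ih S mS (fun j jJ => hS j (ltnW jJ))
    (fun i j ij => hx i j (introT andP (conj (andP ij).1 (ltnW (andP ij).2)))).
  exists d => // rho /hd; rewrite big_ord_recr/= (negbTE nsJ) mul0r addr0//.
pose I rho := `]x J - rho, x J[%classic.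
have mI rho : measurable (I rho) by exact: measurable_itv.
have [d1 d10 h1] : exists2 d, 0 < d & forall rho, 0 < rho < d ->
    ((\sum_(j < J) (sel j)%:R * rho)%:E <= mu (S rho `\` I rho))%E.
  apply: ih => [rho|j jJ sj|i j /andP[ij jJ]]; first exact: measurableD.
    have [d d0 hd] := hS j (ltnW jJ) sj.
    have nx : 0 < `|x j - x J| by rewrite normr_gt0 subr_eq0 hx// jJ ltnSn.
    exists (Num.min d `|x j - x J|); first by rewrite lt_min d0.
    move=> rho; rewrite lt_min => /andP[rho0 /andP[rd rx]] y yI; split.
      by apply: hd => //; rewrite rho0.
    move: yI; rewrite /I/= !in_itv/= => yI /=.
    by move: rx; have [?|?] := leP 0 (x j - x J); [rewrite ger0_norm//|rewrite ltr0_norm//]; lra.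
  by apply: hx; rewrite ij ltnW.
have [d2 d20 h2] := hS J (ltnSn J) sJ.
exists (Num.min d1 d2); first by rewrite lt_min d10.
move=> rho; rewrite lt_min => /andP[rho0 /andP[r1 r2]].
rewrite big_ord_recr/= sJ mul1r EFinD.
have -> : mu (S rho) = (mu (S rho `\` I rho) + mu (I rho))%E.
  have IS : I rho `<=` S rho by apply: h2; rewrite rho0.
  have SI : S rho = (S rho `\` I rho) `|` I rho by rewrite setUC setDUK.
  rewrite [in LHS]SI measureU; [by []|exact: (measurableD (mS rho) (mI rho))|exact: (mI rho)|].
  by apply/seteqP; split => // w [[]].
apply: leeD; first by apply: h1; rewrite rho0.
rewrite /I lebesgue_measure_itv/= lte_fin ifT; last by lra.
by rewrite -EFinB lee_fin; lra.
Qed.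

Definition cross_set s rho W Z : set (R * R) :=
  [set cx | W (line s cx.1 cx.2) /\ zin Z (line s cx.1 cx.2) <> zin Z (line s cx.1 (cx.2 + rho))].

Lemma measurable_line s rho : measurable_fun setT (fun cx : R * R => line s cx.1 (cx.2 + rho)).
Proof.
have m2 : measurable_fun setT (fun cx : R * R => cx.2 + rho).
  by apply: measurable_funD; [exact: measurable_snd|exact: measurable_cst].
apply: measurable_fun_pair; first exact: m2.
apply: measurable_funD; first exact: measurable_fst.
by apply: measurable_funM; [exact: measurable_cst|exact: m2].
Qed.

Lemma measurable_cross_set s rho W Z : closed W -> closed Z -> measurable (cross_set s rho W Z).
Proof.
move=> cW cZ.
have mA A r : closed A -> measurable [set cx : R * R | A (line s cx.1 (cx.2 + r))].
  move=> cA; rewrite -[X in measurable X]setTI; exact: (measurable_line s r measurableT (closed_measurable2 cA)).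
have mA0 A : closed A -> measurable [set cx : R * R | A (line s cx.1 cx.2)].
  move=> /(mA _ 0); congr measurable; apply/seteqP.
  by split => cx /=; rewrite addr0.
rewrite (_ : cross_set s rho W Z = [set cx | W (line s cx.1 cx.2)] `&`
   (([set cx | Z (line s cx.1 cx.2)] `\` [set cx | Z (line s cx.1 (cx.2 + rho))]) `|`
    ([set cx | Z (line s cx.1 (cx.2 + rho))] `\` [set cx | Z (line s cx.1 cx.2)]))).
  have hW := mA0 W cW; have h0 := mA0 Z cZ; have h1 := mA Z rho cZ.
  exact: (measurableI _ _ hW (measurableU _ _ (measurableD h0 h1) (measurableD h1 h0))).
apply/seteqP; split => cx /=; rewrite /zin.
  move=> [Wc H]; split => //.
  have [h1|h1] := pselect (Z (line s cx.1 cx.2)); [left|right]; split => //.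
    by move=> h2; apply: H; rewrite /zin (asboolT h1) (asboolT h2).
  by apply: contrapT => h2; apply: H; rewrite /zin (asboolF h1) (asboolF h2).
move=> [Wc hh]; split => // e; case: hh => -[h1 h2]; apply: h2.
  by apply/zinP; rewrite -e; exact/zinP.
by apply/zinP; rewrite e; exact/zinP.
Qed.

End SignChange.

(** * Boundary length and sign changes *)

Section Deterministic.
Context {R : realType}.
Local Notation pt := (R * R)%type.
Local Notation mu := (@lebesgue_measure R).
Local Notation mu2 := (lebesgue_measure \x lebesgue_measure)%E.
Implicit Types (p q z : pt) (Z U W E F : set pt) (K A : nat -> set pt) (s c x y t : R).

Lemma limn_einf_ge (u : nat -> \bar R) (a : \bar R) :
  (\forall n \near \oo, (a <= u n)%E) -> (a <= limn_einf u)%E.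
Proof.
move=> [N _ h]; rewrite limn_einf_lim.
apply: lime_ge; first exact: is_cvg_einfs.
exists N => // n /= Nn; apply: le_ereal_inf_tmp => _ [k /= nk <-].
by apply: h; exact: leq_trans nk.
Qed.

Lemma measurable_fun_limn_einf d (T : measurableType d) (f : nat -> T -> \bar R) :
  (forall n, measurable_fun setT (f n)) ->
  measurable_fun setT (fun x : T => limn_einf (f ^~ x)).
Proof.
move=> mf; pose g n (x : T) := (- f n x)%E.
have mg n : measurable_fun setT (g n) by apply: measurableT_comp => //; exact: oppe_measurable.
have h := measurable_fun_limn_esup mg.
by apply: measurableT_comp h; exact: oppe_measurable.
Qed.

Lemma closed_frontier Z : closed Z -> closed (Z `\` interior Z).
Proof.
by move=> cZ; rewrite setDE; apply: closedI => //; apply: open_closedC; exact: open_interior.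
Qed.

(** The pieces are disjoint, so a non-exceptional line meeting [q] of them has [q] distinct sign
    changes, and its section of the cross set has length at least [q * rho] once [rho] is small. How
    small depends on the line, so the integration over intercepts goes through Fatou's lemma. *)
Lemma liminf_cross N K Z W s A J (rho : nat -> R) (a : R) : 0 < a ->
  (forall i, (i < N)%N -> [/\ compact (K i), convex2 (K i), interior (K i) !=set0 & K i `<=` Z]) ->
  Z `&` interior W `<=` \bigcup_(i in `I_N) K i ->
  closed Z -> compact W -> (forall j, closed (A j)) ->
  (forall n, 0 < rho n) -> rho n @[n --> \oo] --> 0 ->
  forall E F, E = (Z `\` interior Z) `&` W -> F = ~` interior W ->
  (a%:E * \sum_(j < J) mu (proj s @` piece A E F j) <=
   limn_einf (fun n => (a / rho n)%:E * mu2 (cross_set s (rho n) W Z)))%E.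
Proof.
move=> a0 hK ZK cZ cW cA rho0 rhocvg E F defE defF.
have cE : compact E.
  by rewrite defE setIC; apply: compact_closedI => //; exact: closed_frontier.
have cF : closed F by rewrite defF; apply: open_closedC; exact: open_interior.
have clW : closed W by exact: compact_closed_pt.
pose M n := cross_set s (rho n) W Z.
have mM n : measurable (M n) by exact: measurable_cross_set.
have ar n : 0 < a / rho n by rewrite divr_gt0.
pose f n c := ((a / rho n)%:E * mu (xsection (M n) c))%E.
have mxs n : measurable_fun setT (fun c => mu (xsection (M n) c)).
  exact: (measurable_fun_xsection lebesgue_measure (mM n)).
have mf n : measurable_fun setT (f n).
  by apply: emeasurable_funM => //; exact: measurable_cst.
have f0 n c : (0 <= f n c)%E by apply: mule_ge0 => //; rewrite lee_fin ltW.
have intf n : (\int[mu]_c f n c = (a / rho n)%:E * mu2 (M n))%E.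
  by rewrite ge0_integralZl_EFin; [by []|exact: measurableT|by move=> *; exact: measure_ge0|exact: mxs|exact: ltW].
have mP j : measurable (proj s @` piece A E F j).
  by apply: measurable_proj_diff; [exact: compact_piece_base|exact: closed_prev].
pose g c := (a%:E * \sum_(j < J) (\1_(proj s @` piece A E F j) c)%:E : \bar R)%E.
have mg : measurable_fun setT (fun c => \sum_(j < J) (\1_(proj s @` piece A E F j) c)%:E : \bar R)%E.
  by apply: emeasurable_sum => j; apply/measurable_EFinP.
have intg : (\int[mu]_c g c = a%:E * \sum_(j < J) mu (proj s @` piece A E F j))%E.
  rewrite ge0_integralZl_EFin//; last 2 first.
  - by move=> c _; apply: sume_ge0 => j _; rewrite lee_fin.
  - exact: ltW.
  congr (_ * _)%E; rewrite ge0_integral_sum.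
  - by apply: eq_bigr => j _; rewrite integral_indic; [rewrite setIT|exact: measurableT|exact: mP].
  - exact: measurableT.
  - by move=> j; apply/measurable_EFinP; apply: measurable_indic; exact: mP.
  - by move=> j c _; rewrite lee_fin.
rewrite -intg -[leRHS](_ : limn_einf (fun n => \int[mu]_c f n c)%E = _); last first.
  by congr limn_einf; apply/funext => n; exact: intf.
apply: le_trans (fatou mu measurableT mf (fun n c _ => f0 n c)).
apply: ae_ge0_le_integral => //.
- move=> c _; apply: mule_ge0; first by rewrite lee_fin ltW.
  by apply: sume_ge0 => j _; rewrite lee_fin.
- by apply: emeasurable_funM => //; exact: measurable_cst.
- by move=> c _; apply: limn_einf_ge; exact: nearW.
- exact: measurable_fun_limn_einf.
pose X := exceptional_lines N K s.
have finX : finite_set X.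
  by apply: finite_exceptional_lines => i iN; have [] := hK i iN.
exists X; split; first by apply: countable_measurable => //; exact: finite_set_countable.
  by apply: countable_lebesgue_measure0; exact: finite_set_countable.
move=> c /= nle; apply: contrapT => nX; apply: nle => _.
pose sel j : bool := c \in proj s @` piece A E F j.
have /choice[x hx] j : exists y : R, sel j -> piece A E F j (line s c y).
  have [/set_mem[p hp <-]|ns] := boolP (sel j); last by exists 0.
  by exists p.1; rewrite line_proj.
pose S r := xsection (cross_set s r W Z) c.
have mS r : measurable (S r) by apply: measurable_xsection; exact: measurable_cross_set.
have [d d0 hd] : exists2 d, 0 < d & forall r, 0 < r < d ->
    ((\sum_(j < J) (sel j)%:R * r)%:E <= mu (S r))%E.
  apply: (@crossing_measure _ J x) => // [j jJ sj|i j /andP[ij jJ] si sj].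
    have := hx _ sj; rewrite /piece {1}defE => -[[[[Zx nZx] Wx] _] nprev].
    have Ux : interior W (line s c (x j)).
      by apply: contrapT => h; apply: nprev; left; rewrite defF.
    have [d1 d10 [b hb]] : exists2 d, 0 < d & exists b, forall y,
        (x j - d < y < x j -> zin Z (line s c y) = b) /\
        (x j < y < x j + d -> zin Z (line s c y) = ~~ b).
      by apply: (@sign_change _ N K Z (interior W)) => //;
        [move=> i /hK[]..|exact: open_interior].
    have [d2 d20 hW] := open_line (@open_interior _ W) Ux.
    exists (Num.min d1 d2); first by rewrite lt_min d10.
    move=> r; rewrite lt_min => /andP[r0 /andP[rd1 rd2]] y; rewrite /= in_itv/= => yx.
    rewrite /S /xsection/= inE; split => /=.
      by apply: interior_subset; apply: hW; rewrite gtr0_norm; lra.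
    have -> : zin Z (line s c y) = b by have [h _] := hb y; apply: h; lra.
    have -> : zin Z (line s c (y + r)) = ~~ b by have [_ h] := hb (y + r); apply: h; lra.
    by case: (b).
  apply/eqP => e; have [[_ Ai] _] := hx _ si; have [_] := hx _ sj; apply.
  by right; exists i => //; rewrite -e.
apply: limn_einf_ge.
have : \forall n \near \oo, rho n < d.
  have /cvgrPdist_lt/(_ d d0) := rhocvg; apply: filterS => n.
  by rewrite sub0r normrN gtr0_norm.
apply: filterS => n rd; rewrite /f /g sumEFin -EFinM.
apply: (@le_trans _ _ ((a / rho n)%:E * (\sum_(j < J) (sel j)%:R * rho n)%:E)%E).
  rewrite -EFinM lee_fin -mulr_suml mulrCA divfK ?gt_eqF// mulrC.
  by rewrite ler_pM2r//; apply: ler_sum => j _; rewrite indicE /sel.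
rewrite lee_pmul2l ?lte_fin//; apply: hd; by rewrite rho0.
Qed.

(** A finite Baire argument: the closed sets are removed from the open set one at a time until one
    of them contains what is left. *)
Lemma thin_interior N K (P : pred nat) (O : set pt) : open O -> O !=set0 ->
  (forall i, closed (K i)) ->
  O `<=` \bigcup_(i in [set i | (i < N)%N /\ P i]) K i ->
  exists2 i, (i < N)%N /\ P i & interior (K i) !=set0.
Proof.
elim: N O => [|N ih] O oO [p Op] cK OK; first by have [i []] := OK _ Op.
have [OKN|nOKN] := pselect (O `<=` K N /\ P N).
  case: OKN => OKN PN; exists N => //; exists p.
  by apply: (interiorS OKN); exact: open_nbhs_nbhs.
have [/asboolP PN|/asboolP PN] := boolP `[< P N >]; last first.
  have [|i [iN Pi] ?] := ih O oO (ex_intro _ p Op) cK.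
    move=> q /OK[i [/= + Pi] Ki]; rewrite ltnS leq_eqVlt => /orP[/eqP iN|iN].
      by move: Pi; rewrite iN.
    by exists i.
  by exists i => //; split => //; exact: ltnW.
have [q Oq nKq] : exists2 q, O q & ~ K N q.
  apply: contrapT => h; apply: nOKN; split => // q Oq; apply: contrapT => nK.
  by apply: h; exists q.
have [| |i [iN Pi] ?] := ih (O `\` K N) _ (ex_intro _ q (conj Oq nKq)) cK.
- by apply: openI => //; exact: closed_openC.
- move=> w [/OK[i [/= + Pi] Ki] nKw]; rewrite ltnS leq_eqVlt => /orP[/eqP iN|iN].
    by move: Ki; rewrite iN.
  by exists i.
by exists i => //; split => //; exact: ltnW.
Qed.

Lemma locally_finite_bound K W : finite_set [set i | K i `&` W !=set0] ->
  exists N, forall i p, K i p -> W p -> (i < N)%N.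
Proof.
move=> /finite_seqP[l hl]; exists (\max_(i <- l) i).+1 => i p Ki Wp.
have il : [set` l] i by rewrite -hl; exists p.
by rewrite ltnS (@leq_bigmax_seq _ l xpredT id).
Qed.

Definition inner_part s rho W : set pt := W `&` [set p | W (p.1 + rho, p.2 + s * rho)].

Lemma closed_inner_part s rho W : closed W -> closed (inner_part s rho W).
Proof.
move=> cW; apply: closedI => //; apply/closed_edist => p h /=.
apply: (closed_edist _).1 cW _ _ => e /h[q Wq pq]; exists (q.1 + rho, q.2 + s * rho) => //.
move: pq; rewrite /edist/=.
have -> : p.1 + rho - (q.1 + rho) = p.1 - q.1 by ring.
by have -> : p.2 + s * rho - (q.2 + s * rho) = p.2 - q.2 by ring.
Qed.

(** [z] is the supremum of the points of [A] between [a] and [b]. *)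
Lemma closed_boundary_point (A : set R) a b : closed A -> a < b -> A a -> ~ A b ->
  exists2 z : R, a <= z <= b & A z /\ forall e, 0 < e -> exists2 y, `|z - y| < e & ~ A y.
Proof.
move=> cA ab Aa nAb; pose S := [set y | A y /\ a <= y <= b].
have hS : has_sup S by split; [exists a; rewrite /S/= lexx ltW|exists b => y [_ /andP[]]].
have Sa : S a by rewrite /S/= lexx ltW.
have Sb : sup S <= b by apply: sup_le_ub; [exists a|move=> y [_ /andP[]]].
have aS : a <= sup S by apply: sup_upper_bound.
have ASup : A (sup S).
  apply: contrapT => nA; have oA : open (~` A) by exact: closed_openC.
  have /nbhs_ballP[e /= e0 he] : nbhs (sup S) (~` A) by exact: open_nbhs_nbhs.
  have [y Sy ys] := sup_adherent e0 hS.
  have : (~` A) y.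
    apply: he; rewrite /ball/= ger0_norm; last by rewrite subr_ge0; apply: sup_upper_bound.
    by lra.
  by apply; case: Sy.
exists (sup S); first by rewrite aS.
split => // e e0; have [eb|be] := ltP (sup S + e / 2) b.
  exists (sup S + e / 2); first by rewrite opprD addrA subrr sub0r normrN gtr0_norm; lra.
  move=> Ay; have : S (sup S + e / 2) by split => //; lra.
  by move/(sup_upper_bound hS); lra.
exists b => //; rewrite distrC ger0_norm; lra.
Qed.

(** A change of membership forces a frontier point of [Z] on the segment between the two points;
    [inner_part] has both ends in [W], and convexity puts the segment there. *)
Lemma cross_set_hitset s rho W Z : 0 < rho -> closed Z -> convex2 W ->
  cross_set s rho (inner_part s rho W) Z `<=` hitset s rho ((Z `\` interior Z) `&` W).
Proof.
move=> rho0 cZ vW [c x] [/= [W1 W2] zz].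
have cA : closed [set y | Z (line s c y)].
  move=> y hy; apply: (closed_edist _).1 cZ _ _ => e e0.
  have s0 : 0 < 1 + `|s| by rewrite ltr_pwDl.
  have [y' [Zy' yy']] : ([set y | Z (line s c y)] `&` ball y (e / (1 + `|s|))) !=set0.
    by apply: hy; apply: nbhsx_ballx; rewrite divr_gt0.
  exists (line s c y') => //; apply: le_lt_trans (edist_line _ _ _ _) _.
  by rewrite mulrC -ltr_pdivlMr.
have finish (z : R) : x <= z <= x + rho -> Z (line s c z) ->
    (forall e, 0 < e -> exists2 y, `|z - y| < e & ~ Z (line s c y)) ->
    hitset s rho ((Z `\` interior Z) `&` W) (c, x).
  move=> xz Zz hz; exists z => //; split.
    split => // /(open_line (@open_interior _ Z))[e e0 he].
    have [y zy] := hz e e0; apply; apply: interior_subset; exact: he.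
  have t01 : 0 <= (z - x) / rho <= 1.
    by apply/andP; split; [apply: divr_ge0; lra|rewrite ler_pdivrMr//; lra].
  have := vW _ _ W1 W2 _ t01; congr W; rewrite /line/=; congr (_, _); field; rewrite gt_eqF//.
have [Zx|nZx] := pselect (Z (line s c x)).
  have nZ' : ~ Z (line s c (x + rho)).
    by move=> h; apply: zz; rewrite /zin (asboolT Zx) (asboolT h).
  have xr : x < x + rho by lra.
  have [z xz [Zz hz]] := closed_boundary_point cA xr Zx nZ'.
  exact: (finish z).
have Z' : Z (line s c (x + rho)).
  by apply: contrapT => h; apply: zz; rewrite /zin (asboolF nZx) (asboolF h).
(* The line is reversed, since the supremum argument wants the end that belongs to [Z] on the
   left. *)
have cB : closed [set y | Z (line s c (- y))].
  move=> y hy; apply: cA => B /nbhs_ballP[e /= e0 eB].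
  have [y' [Zy' yy']] : ([set y | Z (line s c (- y))] `&` ball y e) !=set0.
    by apply: hy; exact: nbhsx_ballx.
  exists (- y'); split => //; apply: eB; move: yy'; rewrite /ball/=.
  by rewrite -opprD normrN.
have xr : - (x + rho) < - x by lra.
have [||z xz [Zz hz]] := @closed_boundary_point _ (- (x + rho)) (- x) cB xr; rewrite /= ?opprK//.
apply: (finish (- z)) => //; first lra.
move=> e /hz[y yz nZy]; exists (- y) => //.
by rewrite -opprD normrN.
Qed.

Section Pointwise.
Context (m J : nat) (u nu : nat -> pt) (sigma eps : R).
Context (hu : forall k, (k < m)%N -> edist (0, 0) (u k) = 1 /\ 0 < (u k).1).
Context (hnu : forall j, (j < J)%N -> edist (0, 0) (nu j) = 1 /\
                      \sum_(k < m) `|dot (u k) (nu j)| = m%:R * sigma).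
Context (net : forall n, edist (0, 0) n = 1 -> exists2 j, (j < J)%N & edist n (nu j) <= eps).
Context (eps0 : 0 < eps).

Let hnu' N j : (j < N * J)%N -> edist (0, 0) (nu (j %% J)%N) = 1 /\
                      \sum_(k < m) `|dot (u k) (nu (j %% J)%N)| = m%:R * sigma.
Proof.
by move=> jNJ; apply: hnu; rewrite ltn_mod; case: J jNJ; rewrite ?muln0.
Qed.

Lemma boundary_length_le Z W : 2 * eps <= sigma ->
  closed Z -> locally_polyconvex Z -> topologically_regular Z -> compact W ->
  ((m%:R * (sigma - 2 * eps))%:E * hausdorff1 ((Z `\` interior Z) `&` interior W) <=
   \sum_(k < m) limn_einf (fun n => (n.+1%:R)%:E *
     mu2 (cross_set ((u k).2 / (u k).1) (n.+1%:R^-1 * (u k).1) W Z)))%E.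
Proof.
move=> es cZ [K [hK [ZE fK]]] regZ cW.
have [N hN] := locally_finite_bound (fK W cW).
(* Every line through a set without interior is tangent to it, so such sets must go. By regularity
   of [Z] the others still cover it inside the interior of [W]. *)
pose fat i : bool := `[< interior (K i) !=set0 >].
pose l := [seq i <- iota 0 N | fat i].
pose K' (t : nat) := K (nth 0%N l t).
have nthl (t : nat) : (t < size l)%N -> fat (nth 0%N l t).
  by move=> /(mem_nth 0%N); rewrite mem_filter => /andP[].
have cK i : closed (K i) by apply: compact_closed_pt; have [] := hK i.
have KZ i : K i `<=` Z by move=> p Kp; rewrite ZE; exists i.
have ZK : Z `&` interior W `<=` \bigcup_(t in `I_(size l)) K' (t : nat).
  have cU : closed (\bigcup_(t in `I_(size l)) K' (t : nat)) by apply: closed_bigcup => // i _; exact: cK.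
  move=> p [Zp Wp]; apply: contrapT => np.
  have oV : open (interior W `\` \bigcup_(t in `I_(size l)) K' (t : nat)).
    by apply: openI; [exact: open_interior|exact: closed_openC].
  have [q [iZq Vq]] : (interior Z `&` (interior W `\` \bigcup_(t in `I_(size l)) K' (t : nat))) !=set0.
    by move: Zp; rewrite {1}regZ; apply; apply: open_nbhs_nbhs.
  have [||||i [iN nfat] fi] := @thin_interior N K (fun i => ~~ fat i)
    (interior Z `&` (interior W `\` \bigcup_(t in `I_(size l)) K' (t : nat))).
  - by apply: openI => //; exact: open_interior.
  - by exists q.
  - exact: cK.
  - move=> w [iZw [iWw nw]]; have Zw := interior_subset iZw.
    rewrite ZE in Zw; have [i _ Ki] := Zw.
    have iN : (i < N)%N by apply: hN Ki (interior_subset iWw).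
    exists i => //; split => //; apply/negP => fi; apply: nw.
    have il : i \in l by rewrite mem_filter fi mem_iota.
    by exists (index i l); rewrite /= ?index_mem// /K' nth_index.
  by move: nfat; rewrite /fat (asboolT fi).
have hK' (t : nat) : (t < size l)%N -> [/\ compact (K' t), convex2 (K' t), interior (K' t) !=set0 & K' t `<=` Z].
  move=> tl; have [? ?] := hK (nth 0%N l t); split => //; last exact: KZ.
  exact/asboolP/nthl.
have [A [cA fA AK]] := boundary_flat_cover (K := K') (ltW eps0) net (N := size l)
   (fun (t : nat) tl => let: And4 a b _ _ := hK' t tl in conj a b).
set E := (Z `\` interior Z) `&` W; pose F := ~` interior W.
have EF : E `\` F = (Z `\` interior Z) `&` interior W.
  apply/seteqP; split => [p [[Zp Wp] nF]|p [Zp iWp]].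
    by split => //; apply: contrapT.
  by split; [split => //; exact: interior_subset|exact].
have cE : compact E.
  by rewrite /E setIC; apply: compact_closedI => //; exact: closed_frontier.
have cF : closed F by apply: open_closedC; exact: open_interior.
have cov : E `\` F `<=` \bigcup_(j in `I_(size l * J)) A j.
  rewrite EF => p [[Zp nZp] iWp]; have [t tl Kt] := ZK _ (conj Zp iWp).
  apply: (AK t tl); split => // iKt; apply: nZp.
  by apply: (interiorS _ iKt); have [] := hK' t tl.
rewrite -EF; apply: le_trans (proj_sum_ge eps0 es hu (@hnu' (size l)) cE cF cA fA cov) _.
apply: lee_sum => k _; have [uk1 uk0] := hu (ltn_ord k).
(* The step in abscissa carries the factor [(u k).1], so that its Euclidean length is
   [n.+1%:R^-1]. *)
have r0 n : 0 < n.+1%:R^-1 * (u k).1 by rewrite mulr_gt0// invr_gt0 ltr0n.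
have rcvg : n.+1%:R^-1 * (u k).1 @[n --> \oo] --> 0.
  by rewrite -(mul0r (u k).1); apply: cvgMl; exact: cvg_harmonic.
have := @liminf_cross (size l) K' Z W ((u k).2 / (u k).1) A (size l * J)%N
  (fun n => n.+1%:R^-1 * (u k).1) _ uk0 hK' ZK cZ cW cA r0 rcvg E F erefl erefl.
move=> h; rewrite [leRHS](_ : _ = limn_einf (fun n => ((u k).1 / (n.+1%:R^-1 * (u k).1))%:E *
    mu2 (cross_set ((u k).2 / (u k).1) (n.+1%:R^-1 * (u k).1) W Z)))%E; first exact: h.
congr limn_einf; apply/funext => n; congr (_%:E * _)%E.
by rewrite invfM invrK mulrCA divff ?mulr1// gt_eqF.
Qed.

Lemma boundary_length_ge Z W (r : R) : 0 < r ->
  closed Z -> locally_polyconvex Z -> compact W -> convex2 W ->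
  (\sum_(k < m) mu2 (cross_set ((u k).2 / (u k).1) (r * (u k).1)
     (inner_part ((u k).2 / (u k).1) (r * (u k).1) W) Z) <=
   (r * (m%:R * (sigma + eps)))%:E * hausdorff1 ((Z `\` interior Z) `&` W))%E.
Proof.
move=> r0 cZ [K [hK [ZE fK]]] cW vW.
have [N hN] := locally_finite_bound (fK W cW).
have clW := compact_closed_pt cW.
have [A [cA fA AK]] := boundary_flat_cover (ltW eps0) net (N := N) (fun i _ => hK i).
have KZ i : K i `<=` Z by move=> p Kp; rewrite ZE; exists i.
have cG : compact ((Z `\` interior Z) `&` W).
  by rewrite setIC; apply: compact_closedI => //; exact: closed_frontier.
have GA : (Z `\` interior Z) `&` W `<=` \bigcup_(j in `I_(N * J)) A j.
  move=> p [[Zp nZp] Wp]; move: (Zp); rewrite ZE => -[i _ Ki].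
  apply: (AK i (hN _ _ Ki Wp)); split => // iK; apply: nZp.
  exact: (interiorS (KZ i)).
have h := hit_sum_le eps0 r0 hu (@hnu' N) cG cA fA GA.
apply: (h (fun k => cross_set ((u k).2 / (u k).1) (r * (u k).1)
   (inner_part ((u k).2 / (u k).1) (r * (u k).1) W) Z)) => k km; have [_ uk0] := hu km.
  by apply: measurable_cross_set => //; exact: closed_inner_part.
by apply: cross_set_hitset => //; exact: mulr_gt0.
Qed.

End Pointwise.

End Deterministic.

(** * Corners in a strip of cells *)

Section Strip.
Context {R : realType}.
Implicit Types (f g : nat -> bool) (n x : nat).

Definition cell f g x := config_class (f x) (f x.+1) (g x) (g x.+1).

Definition corner_excess f g x : R := (cell f g x == 2)%:R - (cell f g x == 5)%:R.

Definition changes f n : nat := \sum_(x < n) (f x != f x.+1).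

Lemma changes_ge f n : ((f 0 != f n) <= changes f n)%N.
Proof.
rewrite /changes; elim: n => [|n ih]; first by rewrite eqxx.
rewrite big_ord_recr/=; case: (f 0) (f n) (f n.+1) ih => [] [] [] //= ih.
all: by rewrite ?addn0 ?addn1.
Qed.

Lemma changes_small f n : (changes f n <= 1)%N -> changes f n = (f 0 != f n).
Proof.
rewrite /changes; elim: n => [|n ih]; first by rewrite big_ord0 eqxx.
rewrite big_ord_recr/= => h; have {}ih := ih (leq_trans (leq_addr _ _) h).
move: h; rewrite ih.
by case: (f 0) (f n) (f n.+1) => [] [] [].
Qed.

Lemma changes_large f n : (1 < changes f n)%N -> ((f 0 != f n) < changes f n)%N.
Proof. by move=> h; apply: leq_ltn_trans h; case: (_ != _). Qed.

Lemma changesS f n : (changes f n.+1 <= 1)%N -> (changes f n <= 1)%N /\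
  (f 0 != f n -> f n.+1 = f n).
Proof.
rewrite /changes big_ord_recr/= -/(changes f n) => h.
have h1 : (changes f n <= 1)%N by apply: leq_trans (leq_addr _ _) h.
split => //; move: h; rewrite changes_small//.
by case: (f 0) (f n) (f n.+1) => [] [] [].
Qed.

Lemma corner_excess_le f g x :
  `|corner_excess f g x| <= ((f x != f x.+1) + (g x != g x.+1))%N%:R.
Proof.
rewrite /corner_excess /cell.
by case: (f x) (f x.+1) (g x) (g x.+1) => [] [] [] []; rewrite /= ?subr0 ?subrr ?normr0 ?sub0r ?normrN ?normr1 ?ler0n ?ler1n.
Qed.

Lemma corner_excess_le1 f g x : `|corner_excess f g x| <= 1.
Proof.
rewrite /corner_excess /cell.
by case: (f x) (f x.+1) (g x) (g x.+1) => [] [] [] []; rewrite /= ?subr0 ?subrr ?normr0 ?sub0r ?normrN ?normr1.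
Qed.

(** When each side is a single step, the corner of one kind made by the first change is cancelled by
    the corner of the other kind made by the second, so the sum depends only on the values at the
    ends. *)
Lemma sum_corner_excess_monotone f g n : (changes f n <= 1)%N -> (changes g n <= 1)%N ->
  f 0 = g 0 ->
  \sum_(x < n) corner_excess f g x = if f n == g n then 0 else if f 0 then -1 else 1.
Proof.
move=> + + fg; elim: n => [|n ih] hf hg; first by rewrite big_ord0 fg eqxx.
have [hf1 hf2] := changesS hf; have [hg1 hg2] := changesS hg.
rewrite big_ord_recr/= ih// /corner_excess /cell; move: hf2 hg2; rewrite -fg.
by case: (f 0) (f n) (f n.+1) (g n) (g n.+1) => [] [] [] [] []/= hf2 hg2;
  first [by move: (hf2 isT) | by move: (hg2 isT) |
         by rewrite ?subrr ?subr0 ?sub0r ?addr0 ?add0r ?addNr ?subrr].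
Qed.

(** A side that changes more than once has [changes f n - (f 0 != f n)] at least 1, and [n] times
    this beats the trivial bound [n]. Otherwise equal starts give the telescoped sum, and different
    starts at most two nonzero terms. The expectation of this difference is twice the subadditivity
    defect of gamma along the side. *)
Lemma sum_corner_excess_le f g n : `|\sum_(x < n) corner_excess f g x| <=
  n%:R * ((changes f n)%:R - (f 0 != f n)%:R) + n%:R * ((changes g n)%:R - (g 0 != g n)%:R) +
  2 * ((f 0 != g 0)%:R + (f n != g n)%:R).
Proof.
have c0 (h : nat -> bool) : 0 <= (changes h n)%:R - (h 0 != h n)%:R :> R.
  by rewrite subr_ge0 ler_nat changes_ge.
have n0 := ler0n R n.
have b0 (b : bool) : 0 <= b%:R :> R by [].
have [hf|hf] := ltnP 1 (changes f n).
  apply: (@le_trans _ _ (n%:R * 1)).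
    rewrite mulr1; apply: le_trans (ler_norm_sum _ _ _) _.
    rewrite -[n in leRHS]card_ord -sumr_const.
    by apply: ler_sum => x _; exact: corner_excess_le1.
  have : 1 <= (changes f n)%:R - (f 0 != f n)%:R :> R.
    by rewrite lerBrDr addrC natr1 ler_nat changes_large.
  move=> h; rewrite -addrA; apply: ler_wpDr; last by rewrite ler_wpM2l.
  by apply: addr_ge0; apply: mulr_ge0 => //; exact: addr_ge0.
have [hg|hg] := ltnP 1 (changes g n).
  apply: (@le_trans _ _ (n%:R * 1)).
    rewrite mulr1; apply: le_trans (ler_norm_sum _ _ _) _.
    rewrite -[n in leRHS]card_ord -sumr_const.
    by apply: ler_sum => x _; exact: corner_excess_le1.
  have : 1 <= (changes g n)%:R - (g 0 != g n)%:R :> R.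
    by rewrite lerBrDr addrC natr1 ler_nat changes_large.
  move=> h; rewrite addrAC; apply: ler_wpDl; last by rewrite ler_wpM2l.
  by apply: addr_ge0; apply: mulr_ge0 => //; exact: addr_ge0.
apply: (@le_trans _ _ (2 * ((f 0 != g 0)%:R + (f n != g n)%:R))); last first.
  by apply: ler_wpDl => //; apply: addr_ge0; exact: mulr_ge0.
have [fg0|fg0] := eqVneq (f 0) (g 0); last first.
  apply: (@le_trans _ _ 2); last first.
    by rewrite -[leLHS]mulr1 ler_pM2l// lerDl.
  apply: le_trans (ler_norm_sum _ _ _) _.
  apply: (@le_trans _ _ (\sum_(x < n) ((f x != f x.+1) + (g x != g x.+1))%N%:R)).
    by apply: ler_sum => x _; exact: corner_excess_le.
  rewrite -natr_sum big_split/= -/(changes f n) -/(changes g n) ler_nat.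
  by rewrite -[2%N]/(1 + 1)%N leq_add.
rewrite sum_corner_excess_monotone//.
case: (eqVneq (f n) (g n)) => _ /=; first by rewrite normr0 addr0 mulr0.
by case: (f 0); rewrite ?normrN normr1 add0r mulr1 ler1n.
Qed.

End Strip.

(** * Subadditive functions near the origin *)

Section Fekete.
Context {R : realType}.
Implicit Types (g : R -> R) (r s C : R).

(** Fekete's argument at 0: take [s] with [g s / s] close to the supremum and divide [s] by a small
    [r]. The remainder is below [r], so [g s <= s * (g r / r) + C * r], and [g r / r] is nearly as
    large as [g s / s]. *)
Lemma subadditive_cvg0 g C : (forall r, 0 <= r -> 0 <= g r <= C * r) ->
  (forall r s, 0 <= r -> 0 <= s -> g (r + s) <= g r + g s) ->
  exists kappa, [/\ 0 <= kappa, (forall r, 0 < r -> g r <= kappa * r) &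
     g r / r @[r --> 0^'+] --> kappa].
Proof.
move=> gC gD.
pose S := [set g r / r | r in [set r | 0 < r]].
have S0 : S !=set0 by exists (g 1 / 1), 1 => //=; exact: ltr01.
have Sub : has_sup S.
  split => //; exists C => _ [r /= r0 <-]; rewrite ler_pdivrMr//.
  by have /andP[] := gC r (ltW r0).
have Sle r : 0 < r -> g r / r <= sup S by move=> r0; apply: sup_upper_bound => //; exists r.
have k0 : 0 <= sup S.
  apply: le_trans (Sle 1 ltr01); rewrite divr1; by have /andP[] := gC 1 ler01.
exists (sup S); split => // [r r0|]; first by rewrite -ler_pdivrMr// Sle.
have gnat n r : 0 <= r -> g (n%:R * r) <= n%:R * g r.
  move=> r0; elim: n => [|n ih]; first by rewrite !mul0r; have := gC 0 (lexx 0); lra.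
  rewrite -natr1 !mulrDl !mul1r; apply: le_trans (gD _ _ _ _) _ => //; first exact: mulr_ge0.
  by rewrite lerD2r.
apply/cvgrPdist_lt => e e0.
have [_ [s /= s0 <-] hs] := sup_adherent (divr_gt0 e0 (ltr0n R 2) : 0 < e / 2) Sub.
have C0 : 0 <= C by have := gC 1 ler01; lra.
(* The second bound makes the remainder term [C * r] at most [s * (e / 2)]. *)
pose d := Num.min s (s * e / (2 * (C + 1))).
have C10 : 0 < 2 * (C + 1) by rewrite mulr_gt0// ltr_wpDl.
have d0 : 0 < d by rewrite lt_min s0 divr_gt0// mulr_gt0.
near=> r.
have r0 : 0 < r by near: r; exact: nbhs_right_gt.
have rd : r < d by near: r; exact: nbhs_right_lt.
rewrite ger0_norm ?subr_ge0 ?Sle//.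
pose n := Num.truncn (s / r).
have /andP[n1 n2] : n%:R <= s / r < n.+1%:R by apply: truncn_itv; rewrite divr_ge0// ltW.
rewrite ler_pdivlMr// in n1; rewrite ltr_pdivrMr// -natr1 mulrDl mul1r in n2.
have t0 : 0 <= s - n%:R * r by rewrite subr_ge0.
have := gD (n%:R * r) (s - n%:R * r) (mulr_ge0 (ler0n _ _) (ltW r0)) t0.
rewrite addrC subrK => h1.
have h2 := gnat n r (ltW r0); have /andP[_ h3] := gC _ t0.
have /andP[gr0 _] := gC r (ltW r0).
have h4 : g s <= s * (g r / r) + C * r.
  have : n%:R * g r <= s * (g r / r) by rewrite mulrA ler_pdivlMr// mulrAC ler_wpM2r.
  have : C * (s - n%:R * r) <= C * r by rewrite ler_wpM2l//; lra.
  lra.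
have h5 : C * r <= s * (e / 2).
  have : r * (2 * (C + 1)) <= s * e.
    rewrite -ler_pdivlMr//; apply/ltW; apply: lt_le_trans rd _.
    by rewrite ge_min lexx orbT.
  by nra.
have h6 : g s / s <= g r / r + e / 2.
  by rewrite ler_pdivrMr//; lra.
lra.
Unshelve. all: by end_near. Qed.

End Fekete.

(** * Configuration probabilities *)

Section Expectation.
Context {R : realType} d (T : measurableType d) (P : probability T R).
Implicit Types (f g : T -> R).

Definition Ex f : R := Rintegral P setT f.
Definition ibl f := P.-integrable setT (EFin \o f).

Lemma ExD f g : ibl f -> ibl g -> Ex (fun w => f w + g w) = Ex f + Ex g.
Proof. by move=> ? ?; exact: RintegralD. Qed.

Lemma ExB f g : ibl f -> ibl g -> Ex (fun w => f w - g w) = Ex f - Ex g.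
Proof. by move=> ? ?; exact: RintegralB. Qed.

Lemma ExZ f (c : R) : ibl f -> Ex (fun w => c * f w) = c * Ex f.
Proof. by move=> ?; exact: RintegralZl. Qed.

Lemma Ex_le f g : ibl f -> ibl g -> (forall w, f w <= g w) -> Ex f <= Ex g.
Proof. by move=> ? ? fg; apply: le_Rintegral. Qed.

Lemma eq_Ex f g : f =1 g -> Ex f = Ex g.
Proof. by move=> /funext ->. Qed.

Lemma iblD f g : ibl f -> ibl g -> ibl (fun w => f w + g w).
Proof. by move=> hf hg; have := integrableD measurableT hf hg. Qed.

Lemma iblZ f (c : R) : ibl f -> ibl (fun w => c * f w).
Proof. by move=> hf; have := integrableZl measurableT c hf. Qed.

Lemma iblB f g : ibl f -> ibl g -> ibl (fun w => f w - g w).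
Proof.
move=> hf hg; have := iblD hf (iblZ (-1) hg).
by rewrite (_ : (fun _ => _) = (fun w => f w - g w))//; apply/funext => w; rewrite mulN1r.
Qed.

Lemma ibl0 : ibl (fun=> 0).
Proof. exact: integrable0. Qed.

Lemma ibl_sum n (h : nat -> T -> R) : (forall i, ibl (h i)) -> ibl (fun w => \sum_(i < n) h i w).
Proof.
move=> hi; elim: n => [|n ih].
  rewrite (_ : (fun _ => _) = (fun=> 0)); first exact: ibl0.
  by apply/funext => w; rewrite big_ord0.
rewrite (_ : (fun _ => _) = (fun w => \sum_(i < n) h i w + h n w)); first exact: iblD.
by apply/funext => w; rewrite big_ord_recr.
Qed.

Lemma Ex_sum n (h : nat -> T -> R) : (forall i, ibl (h i)) ->
  Ex (fun w => \sum_(i < n) h i w) = \sum_(i < n) Ex (h i).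
Proof.
move=> hi; elim: n => [|n ih].
  rewrite big_ord0 (@eq_Ex _ (fun=> 0)); last by move=> w; rewrite big_ord0.
  by rewrite /Ex Rintegral_cst// mul0r.
rewrite big_ord_recr/= -ih -ExD//; last exact: ibl_sum.
by apply: eq_Ex => w; rewrite big_ord_recr.
Qed.

Section FiniteValued.
Context (B : finType) (X : T -> B).
Context (mX : forall b, measurable (X @^-1` [set b])).

Lemma ibl_indic (A : set T) : measurable A -> ibl (\1_A).
Proof.
move=> mA; apply: measurable_bounded_integrable => //.
- by rewrite (le_lt_trans (probability_le1 P measurableT))// ltry.
- exists 1; split; first exact: num_real.
  move=> x x1 w _ /=; rewrite indicE; case: (_ \in _); rewrite ?normr1 ?normr0 ltW//.
  exact: lt_trans x1.
Qed.

Lemma Ex_indic (A : set T) : measurable A -> Ex (\1_A) = fine (P A).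
Proof. by move=> mA; rewrite /Ex /Rintegral integral_indic// setIT. Qed.

(** The family is indexed by [nat], as in [Ex_sum], and extended by 0 beyond the enumeration of
    [B]. *)
Let term (phi : B -> R) (i : nat) (w : T) : R :=
  if insub i is Some j then
    phi (enum_val (j : 'I_#|B|)) * \1_(X @^-1` [set enum_val j]) w else 0.

Let termE (phi : B -> R) : (fun w => phi (X w)) = (fun w => \sum_(i < #|B|) term phi i w).
Proof.
apply/funext => w.
transitivity (\sum_(b : B) phi b * \1_(X @^-1` [set b]) w).
  rewrite (bigD1 (X w))//= big1 ?addr0 => [|b bX].
    by rewrite indicE mem_set ?mulr1.
  by rewrite indicE memNset ?mulr0//= => e; rewrite e eqxx in bX.
rewrite (reindex (@enum_val B B))/=; last by apply: onW_bij; exact: enum_val_bij.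
by apply: eq_bigr => i _; rewrite /term valK.
Qed.

Let ibl_term phi i : ibl (term phi i).
Proof.
rewrite /ibl /term; case: insubP => [j _ _|_]; last exact: ibl0.
by apply: (@iblZ _ (phi (enum_val j))); apply: ibl_indic.
Qed.

Lemma ibl_finite (phi : B -> R) : ibl (fun w => phi (X w)).
Proof. by rewrite termE; apply: (@ibl_sum _ (term phi)); exact: ibl_term. Qed.

Lemma Ex_finite (phi : B -> R) :
  Ex (fun w => phi (X w)) = \sum_(b : B) phi b * fine (P (X @^-1` [set b])).
Proof.
rewrite termE (@Ex_sum _ (term phi)); last exact: ibl_term.
rewrite [RHS](reindex (@enum_val B B))/=; last by apply: onW_bij; exact: enum_val_bij.
apply: eq_bigr => i _; rewrite -Ex_indic// -ExZ; last exact: ibl_indic.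
by apply: eq_Ex => w; rewrite /term valK.
Qed.

End FiniteValued.

End Expectation.

(** * Configurations on four points and the invariance of their law *)

Section FourPoints.
Context {R : realType}.
Local Notation pt := (R * R)%type.
Context d (T : measurableType d) (P : probability T R) (Z : T -> set pt).
Context (rZ : random_closed_set Z) (sZ : stationary P Z) (iZ : isotropic P Z).
Implicit Types (p q t : pt) (w : T) (a r : R).

Definition config (F : set pt) p0 p1 p2 p3 : bool * bool * bool * bool :=
  (zin F p0, zin F p1, zin F p2, zin F p3).

Lemma setI_pair4 (F : T -> set pt) p0 p1 p2 p3 b0 b1 b2 b3 :
  (fun w => config (F w) p0 p1 p2 p3) @^-1` [set (b0, b1, b2, b3)] =
  [set w | zin (F w) p0 = b0] `&` [set w | zin (F w) p1 = b1] `&`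
  [set w | zin (F w) p2 = b2] `&` [set w | zin (F w) p3 = b3].
Proof.
by apply/seteqP; split => w /=; [move=> [-> -> -> ->]|move=> [[[<- <-] <-] <-]].
Qed.

Lemma zin_hit F p b : [set w | zin (F w) p = b] =
  if b then F @^-1` hit [set p] else ~` (F @^-1` hit [set p : pt]) :> set T.
Proof.
have h w : hit [set p] (F w) <-> F w p.
  by split => [[q [Fq <-]]//|Fp]; exists p.
case: b; apply/seteqP; split => w /=.
- by move=> /zinP/h.
- by move=> /h/zinP.
- by move=> e /h/zinP; rewrite e.
- by move=> nh; apply/zinP => /h.
Qed.

Lemma measurable_config p0 p1 p2 p3 b :
  measurable ((fun w => config (Z w) p0 p1 p2 p3) @^-1` [set b]).
Proof.
have m1 p c : measurable [set w | zin (Z w) p = c].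
  have mh : measurable (Z @^-1` hit [set p]) by apply: rZ.2; exact: compact_set1.
  by rewrite zin_hit; case: c => //; exact: measurableC.
by case: b => -[[b0 b1] b2] b3; rewrite setI_pair4; do 3 apply: measurableI => //.
Qed.

Lemma fell_config p0 p1 p2 p3 b : fell [set F : set pt | config F p0 p1 p2 p3 = b].
Proof.
pose G := [set hit K | K in [set K : set pt | compact K]].
have -> : fell = @measurable _ (g_sigma_algebraType G) by [].
have m1 p c : @measurable _ (g_sigma_algebraType G) [set F | zin F p = c].
  have mh : @measurable _ (g_sigma_algebraType G) (hit [set p]).
    by apply: sub_sigma_algebra; exists [set p] => //; exact: compact_set1.
  have h (F : set pt) : hit [set p] F <-> F p.
    by split => [[q [Fq <-]]//|Fp]; exists p.
  case: c.
    rewrite (_ : [set F | _] = hit [set p])//.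
    by apply/seteqP; split => F /=; [move/zinP/h|move/h/zinP].
  rewrite (_ : [set F | _] = ~` hit [set p]); first exact: measurableC.
  by apply/seteqP; split => F /=; [move=> e /h/zinP; rewrite e|move=> nh; apply/zinP => /h].
case: b => -[[b0 b1] b2] b3.
rewrite (_ : [set F | _] = [set F | zin F p0 = b0] `&` [set F | zin F p1 = b1] `&`
  [set F | zin F p2 = b2] `&` [set F | zin F p3 = b3]).
  by do 3 apply: measurableI => //.
by apply/seteqP; split => F /=; [move=> [-> -> -> ->]|move=> [[[<- <-] <-] <-]].
Qed.

Definition Q (phi : bool * bool * bool * bool -> R) p0 p1 p2 p3 : R :=
  Ex P (fun w => phi (config (Z w) p0 p1 p2 p3)).

Lemma ibl_config phi p0 p1 p2 p3 : ibl P (fun w => phi (config (Z w) p0 p1 p2 p3)).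
Proof. by apply: ibl_finite => b; exact: measurable_config. Qed.

(** Each of the sixteen configurations is an event of the Fell sigma-algebra, so the law of the set
    determines the expectation. *)
Lemma Q_same_law (Z' : T -> set pt) phi p0 p1 p2 p3 q0 q1 q2 q3 :
  same_law P Z Z' ->
  (forall w, config (Z' w) p0 p1 p2 p3 = config (Z w) q0 q1 q2 q3) ->
  Q phi p0 p1 p2 p3 = Q phi q0 q1 q2 q3.
Proof.
move=> law e; rewrite /Q (Ex_finite P (measurable_config p0 p1 p2 p3)).
rewrite (Ex_finite P (measurable_config q0 q1 q2 q3)); apply: eq_bigr => b _.
congr (_ * fine _); have := law _ (fell_config p0 p1 p2 p3 b).
by move=> ->; congr (P _); apply/seteqP; split => w /=; rewrite e.
Qed.

Definition padd p t : pt := (p.1 + t.1, p.2 + t.2).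

Lemma zin_translate t F p : zin (translate t F) (padd p t) = zin F p.
Proof.
apply/idP/idP => /zinP => [[q Fq [e1 e2]]|Fp]; apply/zinP; last by exists p.
by have -> : p = q by case: p q e1 e2 {Fq} => ? ? [? ?] /= /addIr -> /addIr ->.
Qed.

Lemma Q_translate phi t p0 p1 p2 p3 :
  Q phi (padd p0 t) (padd p1 t) (padd p2 t) (padd p3 t) = Q phi p0 p1 p2 p3.
Proof.
apply: (Q_same_law phi (sZ t)) => w.
by rewrite /config !zin_translate.
Qed.

Definition rot a p : pt := (cos a * p.1 - sin a * p.2, sin a * p.1 + cos a * p.2).

Lemma rotK a p : rot (- a) (rot a p) = p.
Proof.
rewrite /rot/= cosN sinN; have := cos2Dsin2 a; case: p => x y /= cs.
congr (_, _); [rewrite -[RHS](mulr1) -cs|rewrite -[RHS](mulr1) -cs]; ring.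
Qed.

Lemma zin_rotate a F p : zin (rotate a F) (rot a p) = zin F p.
Proof.
apply/idP/idP => /zinP => [[q Fq e]|Fp]; apply/zinP; last by exists p.
have {}e : rot a q = rot a p by exact: e.
by rewrite -(rotK a p) -e rotK.
Qed.

Lemma Q_rotate phi a p0 p1 p2 p3 :
  Q phi (rot a p0) (rot a p1) (rot a p2) (rot a p3) = Q phi p0 p1 p2 p3.
Proof.
apply: (Q_same_law phi (iZ a)) => w.
by rewrite /config !zin_rotate.
Qed.

(* Only the first two points matter; the other two fill the configuration. *)
Definition in_out (b : bool * bool * bool * bool) : R :=
  (b.1.1.1 && ~~ b.1.1.2)%:R.
Definition gamma r : R := Q in_out (0, 0) (r, 0) (0, 0) (0, 0).

(** A rotation followed by a translation carries [(0, 0)] and [(r, 0)] to [p] and [q]; the angle is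
    [- psi] because of the sign in [unit_angle]. *)
Lemma Q_in_out p q q0 q1 : Q in_out p q q0 q1 = gamma (edist p q).
Proof.
have -> : Q in_out p q q0 q1 = Q in_out p q p p by [].
pose r := edist p q.
have [a e] : exists a, (q.1 - p.1, q.2 - p.2) = rot a (r, 0).
  have [r0|r0] := eqVneq r 0.
    exists 0; rewrite (edist_eq0 r0) r0 /rot/= !subrr !mulr0 subr0 addr0//.
  have n1 : edist (0, 0) ((q.1 - p.1) / r, (q.2 - p.2) / r) = 1.
    rewrite /edist/= !sub0r !sqrrN !expr_div_n -mulrDl.
    have -> : (q.1 - p.1) ^+ 2 + (q.2 - p.2) ^+ 2 = r ^+ 2.
      by rewrite sqr_edist; ring.
    by rewrite divff ?sqrtr1// expf_neq0.
  have [psi _ [e1 e2]] := unit_angle n1; exists (- psi).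
  rewrite /rot/= cosN sinN !mulr0 subr0 addr0 -e1 -e2.
  by rewrite !mulrVK ?unitfE// ?divfK.
have h1 : Q in_out p q p p = Q in_out (padd (rot a (0, 0)) p) (padd (rot a (r, 0)) p)
    (padd (rot a (0, 0)) p) (padd (rot a (0, 0)) p).
  have -> : padd (rot a (0, 0)) p = p.
    by rewrite /padd /rot/= !mulr0 subr0 addr0 !add0r -surjective_pairing.
  by rewrite -e /padd/= !subrK -surjective_pairing.
by rewrite h1 Q_translate Q_rotate.
Qed.

End FourPoints.

Lemma cvg_at0_eq (R : realType) (f g : R -> R) (l : R) :
  (\forall r \near 0^'+, g r = f r) -> g r @[r --> 0^'+] --> l -> f r @[r --> 0^'+] --> l.
Proof.
move=> fg /cvgrPdist_lt h; apply/cvgrPdist_lt => e e0; near=> r.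
have <- : g r = f r by near: r.
by near: r; exact: h.
Unshelve. all: by end_near. Qed.

(** * Asymptotics of the estimator *)

Section Asymptotics.
Context {R : realType}.
Local Notation pt := (R * R)%type.
Context d (T : measurableType d) (P : probability T R) (Z : T -> set pt).
Context (rZ : random_closed_set Z) (sZ : stationary P Z) (iZ : isotropic P Z).
Implicit Types (p q t : pt) (w : T) (a r : R).

Local Notation gamma := (gamma P Z).
Local Notation Ex := (Ex P).
Local Notation z w p := (zin (Z w) p).

Definition io p q w : R := (z w p && ~~ z w q)%:R.
Definition neq p q w : R := (z w p != z w q)%:R.

Lemma ibl_io p q : ibl P (io p q).
Proof. exact: (ibl_config P rZ in_out p q p p). Qed.

Lemma Ex_io p q : Ex (io p q) = gamma (edist p q).
Proof. exact: (Q_in_out rZ sZ iZ p q p p). Qed.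

Lemma neqE p q : neq p q = (fun w => io p q w + io q p w).
Proof.
by apply/funext => w; rewrite /neq /io; case: (z w p) (z w q) => [] []; rewrite /= ?addr0 ?add0r.
Qed.

Lemma ibl_neq p q : ibl P (neq p q).
Proof. by rewrite neqE; apply: iblD; exact: ibl_io. Qed.

Lemma Ex_neq p q : Ex (neq p q) = 2 * gamma (edist p q).
Proof.
by rewrite neqE ExD ?Ex_io ?(edistC q p); [rewrite mulr_natl mulr2n|exact: ibl_io..].
Qed.

Lemma edist_h (x x' y : R) : edist (x, y) (x', y) = `|x - x'|.
Proof. by rewrite /edist/= subrr expr0n/= addr0 sqrtr_sqr. Qed.

Lemma edist_v (x y y' : R) : edist (x, y) (x, y') = `|y - y'|.
Proof. by rewrite /edist/= subrr expr0n/= add0r sqrtr_sqr. Qed.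

Lemma edist_d (x y x' y' : R) : (x - x') ^+ 2 = (y - y') ^+ 2 ->
  edist (x, y) (x', y') = Num.sqrt 2 * `|x - x'|.
Proof.
by move=> e; rewrite /edist/= -e -mulr2n -[in LHS]mulr_natl sqrtrM ?ler0n// sqrtr_sqr.
Qed.

Lemma gammaE r : 0 <= r -> gamma r = Ex (io (0, 0) (r, 0)).
Proof. by move=> r0; rewrite Ex_io edist_h sub0r normrN ger0_norm. Qed.

Lemma gamma_ge0 r : 0 <= gamma r.
Proof. by apply: Rintegral_ge0 => w _. Qed.

Lemma gamma_subadd r s : 0 <= r -> 0 <= s -> gamma (r + s) <= gamma r + gamma s.
Proof.
move=> r0 s0; rewrite gammaE ?addr_ge0// gammaE//.
have -> : gamma s = Ex (io (r, 0) (r + s, 0)).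
  by rewrite Ex_io edist_h opprD addrA subrr sub0r normrN ger0_norm.
rewrite -ExD; [|exact: ibl_io..].
apply: Ex_le => [||w]; [exact: ibl_io|by apply: iblD; exact: ibl_io|].
rewrite /io; case: (z w (0, 0)) (z w (r, 0)) (z w (r + s, 0)) => [] [] [];
  by rewrite /= ?addr0 ?add0r ?lexx ?ler01.
Qed.

Definition cls (b : bool * bool * bool * bool) : nat :=
  config_class b.1.1.1 b.1.1.2 b.1.2 b.2.

Definition eta (j : nat) p0 p1 p2 p3 w : R := (cls (config (Z w) p0 p1 p2 p3) == j)%:R.

Lemma ibl_eta j p0 p1 p2 p3 : ibl P (eta j p0 p1 p2 p3).
Proof. exact: (ibl_config P rZ (fun b => (cls b == j)%:R)). Qed.

Lemma eta_probE a j : eta_prob P Z a j = Ex (eta j (0, 0) (a, 0) (0, a) (a, a)).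
Proof.
rewrite /eta_prob; pose A := [set w | cls (config (Z w) (0, 0) (a, 0) (0, a) (a, a)) = j].
have mA : measurable A.
  have -> : A = \bigcup_(b in [set b | cls b = j])
      ((fun w => config (Z w) (0, 0) (a, 0) (0, a) (a, a)) @^-1` [set b]).
    apply/seteqP; split => [w e|w [b eb ew]]; last by rewrite /A/= ew.
    by exists (config (Z w) (0, 0) (a, 0) (0, a) (a, a)).
  apply: fin_bigcup_measurable; first exact: finite_finset.
  by move=> b _; apply: measurable_config.
rewrite -[LHS](Ex_indic P mA); apply: eq_Ex => w.
by rewrite indicE /eta; congr ((nat_of_bool _)%:R); apply/idP/idP => [/set_mem ->|/eqP e]; [exact: eqxx|exact/mem_set].
Qed.

Lemma eta_prob_translate a j t : eta_prob P Z a j =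
  Ex (eta j t (padd (a, 0) t) (padd (0, a) t) (padd (a, a) t)).
Proof.
rewrite eta_probE.
have := Q_translate rZ sZ (fun b => (cls b == j)%:R) t (0, 0) (a, 0) (0, a) (a, a).
by rewrite /Q => <-; rewrite /padd/= !add0r -surjective_pairing.
Qed.

Lemma eta_prob_ge0 a j : 0 <= eta_prob P Z a j.
Proof. by rewrite eta_probE; apply: Rintegral_ge0. Qed.

Let p j a := eta_prob P Z a j.

(** Two of the four sides change membership in classes 2, 3 and 5, all four in class 4; each side
    changes with probability [2 * gamma a]. *)
Lemma side_identity a : 0 <= a -> p 2 a + p 3 a + 2 * p 4 a + p 5 a = 4 * gamma a.
Proof.
move=> a0.
have ie j : ibl P (eta j (0, 0) (a, 0) (0, a) (a, a)) by exact: ibl_eta.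
have h : Ex (fun w => ((neq (0, 0) (a, 0) w + neq (0, a) (a, a) w) + neq (0, 0) (0, a) w) + neq (a, 0) (a, a) w) =
    Ex (fun w => 2 * (((eta 2 (0, 0) (a, 0) (0, a) (a, a) w + eta 3 (0, 0) (a, 0) (0, a) (a, a) w) +
      2 * eta 4 (0, 0) (a, 0) (0, a) (a, a) w) + eta 5 (0, 0) (a, 0) (0, a) (a, a) w)).
  apply: eq_Ex => w; rewrite /neq /eta /cls /config/=.
  by case: (z w (0, 0)) (z w (a, 0)) (z w (0, a)) (z w (a, a)) => [] [] [] []; rewrite /config_class/=; ring.
move: h; rewrite !ExD ?ExZ ?ExD ?ExZ//; do ?[exact: ibl_neq|apply: iblD|apply: iblZ|exact: ie].
rewrite !Ex_neq !edist_h !edist_v -!eta_probE !sub0r !normrN (ger0_norm a0); rewrite /p; lra.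
Qed.

(** One of the two diagonals changes in classes 2 and 5, both in class 3, none in class 4. *)
Lemma diag_identity a : 0 <= a -> p 2 a + 2 * p 3 a + p 5 a = 4 * gamma (Num.sqrt 2 * a).
Proof.
move=> a0.
have ie j : ibl P (eta j (0, 0) (a, 0) (0, a) (a, a)) by exact: ibl_eta.
have h : Ex (fun w => neq (0, 0) (a, a) w + neq (a, 0) (0, a) w) =
    Ex (fun w => (eta 2 (0, 0) (a, 0) (0, a) (a, a) w + 2 * eta 3 (0, 0) (a, 0) (0, a) (a, a) w) +
      eta 5 (0, 0) (a, 0) (0, a) (a, a) w).
  apply: eq_Ex => w; rewrite /neq /eta /cls /config/=.
  by case: (z w (0, 0)) (z w (a, 0)) (z w (0, a)) (z w (a, a)) => [] [] [] []; rewrite /config_class/=; ring.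
move: h; rewrite !ExD ?ExZ//; do ?[exact: ibl_neq|apply: iblD|apply: iblZ|exact: ie].
rewrite !Ex_neq -!eta_probE !edist_d; [|by rewrite ?sub0r ?subr0 ?sqrrN..].
by rewrite sub0r subr0 normrN (ger0_norm a0) /p; lra.
Qed.

(** The changes on the two halves of a diagonal exceed the change between its ends by 0 or 2, whence
    the factor [1 / 2] in the pointwise bound. *)
Lemma eta4_le a : 0 <= a ->
  p 4 a <= 2 * (2 * gamma (Num.sqrt 2 / 2 * a) - gamma (Num.sqrt 2 * a)).
Proof.
move=> a0; pose c : pt := (a / 2, a / 2).
have a2 : 0 <= a / 2 by rewrite divr_ge0.
have h : Ex (eta 4 (0, 0) (a, 0) (0, a) (a, a)) <=
   Ex (fun w => (1 / 2) * (((neq (0, 0) c w + neq c (a, a) w) - neq (0, 0) (a, a) w) +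
     ((neq (a, 0) c w + neq c (0, a) w) - neq (a, 0) (0, a) w))).
  apply: Ex_le => [||w]; first exact: ibl_eta.
    by do ?[exact: ibl_neq|apply: iblB|apply: iblD|apply: iblZ].
  rewrite /neq /eta /cls /config/=.
  case: (z w (0, 0)) (z w (a, 0)) (z w (0, a)) (z w (a, a)) (z w c) => [] [] [] [] [];
    rewrite /config_class/=; lra.
rewrite /p eta_probE; apply: le_trans h _.
rewrite ExZ; last by do ?[exact: ibl_neq|apply: iblB|apply: iblD].
rewrite ExD; [|by do ?[exact: ibl_neq|apply: iblB|apply: iblD]..].
rewrite !ExB ?ExD; do ?[exact: ibl_neq|apply: iblB|apply: iblD|apply: iblZ].
have e1 : a / 2 - a = - (a / 2) by lra.
have e2 : a - a / 2 = a / 2 by lra.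
rewrite !Ex_neq !edist_d; [|by rewrite /= ?sub0r ?subr0 ?e1 ?e2 ?sqrrN..].
rewrite /= !sub0r !subr0 e1 e2 !normrN (ger0_norm a0) (ger0_norm a2).
have -> : Num.sqrt 2 * (a / 2) = Num.sqrt 2 / 2 * a :> R by ring.
lra.
Qed.

(** All the cells of the strip have the same law, so the sum of the excesses has expectation
    [n * (p 2 a - p 5 a)]. The term [8 * gamma a] comes from the two short ends of the strip and
    does not grow with [n]. *)
Lemma eta25_le a n : 0 <= a ->
  n%:R * `|p 2 a - p 5 a| <= 2 * n%:R * (2 * (n%:R * gamma a - gamma (n%:R * a))) + 8 * gamma a.
Proof.
move=> a0.
pose F (x : nat) : pt := (x%:R * a, 0); pose G (x : nat) : pt := (x%:R * a, a).
pose f w x := z w (F x); pose g w x := z w (G x).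
have dF x : edist (F x) (F x.+1) = a.
  by rewrite edist_h -natr1 mulrDl mul1r opprD addrA subrr sub0r normrN ger0_norm.
have dG x : edist (G x) (G x.+1) = a.
  by rewrite edist_h -natr1 mulrDl mul1r opprD addrA subrr sub0r normrN ger0_norm.
have cE x w : corner_excess (R := R) (f w) (g w) x =
    eta 2 (F x) (F x.+1) (G x) (G x.+1) w - eta 5 (F x) (F x.+1) (G x) (G x.+1) w by [].
have iD x : ibl P (fun w => corner_excess (R := R) (f w) (g w) x).
  by apply: iblB; exact: ibl_eta.
have ExDx x : Ex (fun w => corner_excess (R := R) (f w) (g w) x) = p 2 a - p 5 a.
  rewrite (eq_Ex P (cE x)) ExB; [|exact: ibl_eta..].
  rewrite /p !(eta_prob_translate a _ (F x)) /padd/=.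
  have -> : (a + x%:R * a, 0 + 0) = F x.+1 by rewrite /F -natr1 mulrDl mul1r addr0 addrC.
  have -> : (0 + x%:R * a, a + 0) = G x by rewrite /G add0r addr0.
  by have -> : (a + x%:R * a, a + 0) = G x.+1 by rewrite /G -natr1 mulrDl mul1r addr0 addrC.
pose S w : R := \sum_(x < n) corner_excess (f w) (g w) x.
have iS : ibl P S by apply: (@ibl_sum _ _ _ P n (fun x w => corner_excess (f w) (g w) x)).
have ES : Ex S = n%:R * (p 2 a - p 5 a).
  rewrite /S (@Ex_sum _ _ _ P n (fun x w => corner_excess (f w) (g w) x))//.
  rewrite [RHS]mulr_natl -[in RHS](card_ord n) -sumr_const.
  by apply: eq_bigr => x _; exact: ExDx.
pose cF w : R := \sum_(x < n) neq (F x) (F x.+1) w.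
pose cG w : R := \sum_(x < n) neq (G x) (G x.+1) w.
have icF : ibl P cF by apply: (@ibl_sum _ _ _ P n (fun x w => neq (F x) (F x.+1) w)) => x; exact: ibl_neq.
have icG : ibl P cG by apply: (@ibl_sum _ _ _ P n (fun x w => neq (G x) (G x.+1) w)) => x; exact: ibl_neq.
have EcF : Ex cF = n%:R * (2 * gamma a).
  rewrite /cF (@Ex_sum _ _ _ P n (fun x w => neq (F x) (F x.+1) w)); last by move=> x; exact: ibl_neq.
  rewrite [RHS]mulr_natl -[in RHS](card_ord n) -sumr_const.
  by apply: eq_bigr => x _; rewrite Ex_neq dF.
have EcG : Ex cG = n%:R * (2 * gamma a).
  rewrite /cG (@Ex_sum _ _ _ P n (fun x w => neq (G x) (G x.+1) w)); last by move=> x; exact: ibl_neq.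
  rewrite [RHS]mulr_natl -[in RHS](card_ord n) -sumr_const.
  by apply: eq_bigr => x _; rewrite Ex_neq dG.
pose B w : R := (n%:R * (cF w - neq (F 0) (F n) w) + n%:R * (cG w - neq (G 0) (G n) w)) +
  2 * (neq (F 0) (G 0) w + neq (F n) (G n) w).
have SB w : `|S w| <= B w.
  have := @sum_corner_excess_le R (f w) (g w) n.
  by rewrite /B /cF /cG /neq /changes !natr_sum.
have iB : ibl P B by rewrite /B; do ?[exact: ibl_neq|exact: icF|exact: icG|apply: iblB|apply: iblD|apply: iblZ].
have EB : Ex B = 2 * n%:R * (2 * (n%:R * gamma a - gamma (n%:R * a))) + 8 * gamma a.
  rewrite /B ExD; [|by do ?[exact: ibl_neq|exact: icF|exact: icG|apply: iblB|apply: iblD|apply: iblZ]..].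
  rewrite ExD; [|by do ?[exact: ibl_neq|exact: icF|exact: icG|apply: iblB|apply: iblD|apply: iblZ]..].
  rewrite !ExZ; [|by do ?[exact: ibl_neq|exact: icF|exact: icG|apply: iblB|apply: iblD|apply: iblZ]..].
  rewrite !ExB; [|by do ?[exact: ibl_neq|exact: icF|exact: icG]..].
  rewrite ExD; [|exact: ibl_neq..].
  rewrite EcF EcG !Ex_neq !edist_h !edist_v !mul0r !sub0r !normrN (ger0_norm a0).
  rewrite ger0_norm ?mulr_ge0//; ring.
have -> : n%:R * `|p 2 a - p 5 a| = `|Ex S| by rewrite ES normrM ger0_norm.
rewrite -EB ler_norml; apply/andP; split.
  rewrite lerNl -mulN1r -ExZ//; apply: Ex_le => //; first exact: iblZ.
  by move=> w; rewrite mulN1r lerNl; have := SB w; rewrite ler_norml => /andP[].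
by apply: Ex_le => // w; have := SB w; rewrite ler_norml => /andP[].
Qed.

Context (kappa : R) (k0 : 0 <= kappa) (gk : gamma r / r @[r --> 0^'+] --> kappa).

Lemma gamma_scaled (c : R) : 0 < c -> gamma (c * a) / a @[a --> 0^'+] --> c * kappa.
Proof.
move=> c0.
have h : gamma (c * a) / (c * a) @[a --> 0^'+] --> kappa.
  apply/cvgrPdist_lt => e e0; move/cvgrPdist_lt : gk => /(_ e e0) [dl /= dl0 hd].
  near=> a.
  have a0 : 0 < a by near: a; exact: nbhs_right_gt.
  apply: hd; last by rewrite mulr_gt0.
  rewrite /ball/= sub0r normrN gtr0_norm ?mulr_gt0// mulrC -ltr_pdivlMr//.
  by near: a; apply: nbhs_right_lt; rewrite divr_gt0.
have h2 : c * (gamma (c * a) / (c * a)) @[a --> 0^'+] --> c * kappa.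
  exact: cvgMl_tmp.
apply: cvg_at0_eq h2; near=> a.
have a0 : a != 0 by rewrite gt_eqF//; near: a; exact: nbhs_right_gt.
by field; rewrite a0 gt_eqF.
Unshelve. all: by end_near. Qed.

Lemma eta4_cvg : p 4 a / a @[a --> 0^'+] --> 0.
Proof.
have s0 : 0 < Num.sqrt 2 :> R by rewrite sqrtr_gt0.
have h : 2 * (2 * (gamma (Num.sqrt 2 / 2 * a) / a) - gamma (Num.sqrt 2 * a) / a) @[a --> 0^'+] --> 0.
  have e : 0 = 2 * (2 * (Num.sqrt 2 / 2 * kappa) - Num.sqrt 2 * kappa) :> R by field.
  rewrite [X in _ --> X]e; apply: cvgMl_tmp; apply: cvgB; last exact: gamma_scaled.
  by apply: cvgMl_tmp; apply: gamma_scaled; rewrite divr_gt0.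
apply: (squeeze_cvgr _ (cvg_cst 0) h); near=> a.
have a0 : 0 < a by near: a; exact: nbhs_right_gt.
rewrite divr_ge0 ?(ltW a0)//=; last exact: eta_prob_ge0.
have := eta4_le (ltW a0); rewrite -(ler_pM2r (_ : 0 < a^-1)) ?invr_gt0// => /le_trans; apply.
by rewrite le_eqVlt; apply/orP; left; apply/eqP; ring.
Unshelve. all: by end_near. Qed.

Lemma eta25_cvg : (p 2 a - p 5 a) / a @[a --> 0^'+] --> 0.
Proof.
apply/cvgrPdist_lt => e e0.
(* [n] is fixed before [a] tends to 0, so that the ends of the strip contribute less than [e / 2] in
   the limit. *)
pose n := (Num.truncn (8 * kappa / (e / 2))).+1.
have n0 : 0 < n%:R :> R by rewrite ltr0n.
have hn : 8 * kappa / n%:R < e / 2.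
  rewrite ltr_pdivrMr// [ltRHS]mulrC -ltr_pdivrMr ?divr_gt0//; exact: truncnS_gt.
have h : 4 * (n%:R * (gamma a / a) - gamma (n%:R * a) / a) + 8 * (gamma a / a) / n%:R
    @[a --> 0^'+] --> 8 * kappa / n%:R.
  have e1 : 8 * kappa / n%:R = 4 * (n%:R * kappa - n%:R * kappa) + 8 * kappa / n%:R.
    by rewrite subrr mulr0 add0r.
  rewrite [X in _ --> X]e1; apply: cvgD.
    by apply: cvgMl_tmp; apply: cvgB; [exact: cvgMl_tmp|exact: gamma_scaled].
  by apply: cvgMr_tmp; exact: cvgMl_tmp.
move/cvgrPdist_lt : h => /(_ (e / 2)); rewrite divr_gt0// => /(_ isT) h.
near=> a.
have a0 : 0 < a by near: a; exact: nbhs_right_gt.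
rewrite sub0r normrN normrM normfV (gtr0_norm a0).
have : `|p 2 a - p 5 a| / a <= 4 * (n%:R * (gamma a / a) - gamma (n%:R * a) / a) + 8 * (gamma a / a) / n%:R.
  rewrite ler_pdivrMr// -(ler_pM2l n0); apply: le_trans (eta25_le n (ltW a0)) _.
  rewrite le_eqVlt; apply/orP; left; apply/eqP; field.
  by rewrite !gt_eqF.
have : `|8 * kappa / n%:R - (4 * (n%:R * (gamma a / a) - gamma (n%:R * a) / a) + 8 * (gamma a / a) / n%:R)| < e / 2.
  by near: a.
rewrite ltr_norml; lra.
Unshelve. all: by end_near. Qed.

Lemma Ehat_cvg (w2 w3 w4 w5 : R) :
  EhatV1 0 w2 w3 w4 w5 0 P Z a @[a --> 0^'+] --> c3 w2 w3 w5 * (kappa / 2).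
Proof.
have s0 : 0 < Num.sqrt 2 :> R by rewrite sqrtr_gt0.
(* The side and diagonal relations are solved for [p 3] and for [p 2 + p 5], with [p 4] as a
   parameter. *)
pose q3 a := 4 * (gamma (Num.sqrt 2 * a) / a) - 4 * (gamma a / a) + 2 * (p 4 a / a).
pose q25 a := 8 * (gamma a / a) - 4 * (gamma (Num.sqrt 2 * a) / a) - 4 * (p 4 a / a).
pose q a := (w2 + w5) / 2 * q25 a + (w2 - w5) / 2 * ((p 2 a - p 5 a) / a) + w3 * q3 a + w4 * (p 4 a / a).
have c4 := eta4_cvg; have c25 := eta25_cvg.
have c1 := gk; have c2 := gamma_scaled s0.
have hq : q a @[a --> 0^'+] --> (w2 + w5) / 2 * (8 * kappa - 4 * (Num.sqrt 2 * kappa) - 4 * 0) +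
    (w2 - w5) / 2 * 0 + w3 * (4 * (Num.sqrt 2 * kappa) - 4 * kappa + 2 * 0) + w4 * 0.
  apply: cvgD; last exact: cvgMl_tmp.
  apply: cvgD; last by apply: cvgMl_tmp; apply: cvgD; [apply: cvgB; exact: cvgMl_tmp|exact: cvgMl_tmp].
  apply: cvgD; last exact: cvgMl_tmp.
  by apply: cvgMl_tmp; apply: cvgB; [apply: cvgB; exact: cvgMl_tmp|exact: cvgMl_tmp].
have -> : c3 w2 w3 w5 * (kappa / 2) = (w2 + w5) / 2 * (8 * kappa - 4 * (Num.sqrt 2 * kappa) - 4 * 0) +
    (w2 - w5) / 2 * 0 + w3 * (4 * (Num.sqrt 2 * kappa) - 4 * kappa + 2 * 0) + w4 * 0.
  by rewrite /c3; field.
apply: cvg_at0_eq hq; near=> a.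
have a0 : 0 < a by near: a; exact: nbhs_right_gt.
have an : a != 0 by rewrite gt_eqF.
have e1 := side_identity (ltW a0); have e2 := diag_identity (ltW a0).
rewrite /q /q3 /q25 /EhatV1 -!/(p _ a).
have -> : gamma (Num.sqrt 2 * a) = (p 2 a + 2 * p 3 a + p 5 a) / 4 by rewrite e2; field.
have -> : gamma a = (p 2 a + p 3 a + 2 * p 4 a + p 5 a) / 4 by rewrite e1; field.
by rewrite -[in RHS]/(p _ a); field.
Unshelve. all: by end_near. Qed.

End Asymptotics.

(** * Expected number of sign changes *)

Section LowerIntegral.
Context d (T : measurableType d) {R : realType} (mu : {measure set T -> \bar R}).
Local Open Scope ereal_scope.
Implicit Types (f g : T -> \bar R) (N : set T).

(* The integral of a nonnegative function is the supremum over the simple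
   functions below it, so monotonicity needs no measurability. *)
Lemma ge0_le_integral_nomeas f g : (forall x, 0 <= f x) -> (forall x, f x <= g x) ->
  \int[mu]_x f x <= \int[mu]_x g x.
Proof.
move=> f0 fg; have g0 x : 0 <= g x := le_trans (f0 x) (fg x).
rewrite !ge0_integralTE//; apply: le_ereal_sup => _ [h hf <-].
by exists h => // x; exact: le_trans (hf x) (fg x).
Qed.

(** Measurability is asked of the smaller function only: [g] will be a boundary length or a power
    [2 ^ Nconv]. *)
Lemma ge0_ae_le_integral f g N : measurable N -> mu N = 0 ->
  (forall x, 0 <= f x) -> (forall x, 0 <= g x) ->
  measurable_fun setT f -> (forall x, ~ N x -> f x <= g x) ->
  \int[mu]_x f x <= \int[mu]_x g x.
Proof.
move=> mN N0 f0 g0 mf fg.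
rewrite (@ge0_negligible_integral _ _ _ mu setT N)// integral_mkcond.
apply: ge0_le_integral_nomeas => x; first by apply: erestrict_ge0 => y _.
rewrite patchE; case: ifPn => // /set_mem[_ nN]; exact: fg.
Qed.

(** The counterpart with a measurable upper function: it is raised to [+oo] on the null set, so that
    the comparison holds everywhere. *)
Lemma le_ae_ge0_integral f g N : measurable N -> mu N = 0 ->
  (forall x, 0 <= f x) -> (forall x, 0 <= g x) ->
  measurable_fun setT g -> (forall x, ~ N x -> f x <= g x) ->
  \int[mu]_x f x <= \int[mu]_x g x.
Proof.
move=> mN N0 f0 g0 mg fg.
pose h x := g x + +oo * (\1_N x)%:E.
have h0 x : 0 <= +oo * (\1_N x)%:E :> \bar R by rewrite mule_ge0// lee_fin.
have mh : measurable_fun setT h.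
  apply: emeasurable_funD => //; apply: measurable_funeM.
  by apply/measurable_EFinP; exact: measurable_indic.
apply: (@le_trans _ _ (\int[mu]_x h x)).
  apply: ge0_le_integral_nomeas => // x; rewrite /h.
  have [Nx|Nx] := pselect (N x).
    by rewrite indicE mem_set// mule1 addey ?leey// gt_eqF// (lt_le_trans _ (g0 x)).
  by rewrite indicE memNset// mule0 adde0; exact: fg.
rewrite le_eqVlt; apply/orP; left; apply/eqP; apply: ge0_ae_eq_integral => //.
  by move=> x _; rewrite adde_ge0.
exists N; split => // x /= /not_implyP[_]; apply: contra_notP => nN.
by rewrite /h indicE memNset// mule0 adde0.
Qed.

End LowerIntegral.

(** * Translation invariance and sigma-finiteness *)

Section Shift.
Context {R : realType}.
Local Notation mu := lebesgue_measure.
Local Notation mu2 := (mu \x mu)%E.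
Local Notation pt := (R * R)%type.

Lemma lebesgue_measure_shift (b : R) (A : set R) : measurable A ->
  mu [set x | A (x + b)] = mu A.
Proof.
move=> mA; have mb : measurable_fun setT (fun x : measurableTypeR R => x + b : measurableTypeR R).
  by apply: measurable_funD.
pose m' := pushforward mu (fun x : measurableTypeR R => x + b : measurableTypeR R).
transitivity (m' A) => //; apply/esym/lebesgue_measure_unique => //= _ [[x y]] _ <-.
rewrite /m' /pushforward/=.
rewrite (_ : _ @^-1` _ = `]x - b, y - b]%classic); last first.
  by apply/seteqP; split => z /=; rewrite !in_itv/= ltrBlDr lerBrDr.
by rewrite !lebesgue_measure_itv/= !lte_fin ltrD2r; case: ifP => // _; rewrite -!EFinD opprB addrA subrK.
Qed.

Local Notation plane := (measurableTypeR R * measurableTypeR R)%type.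

(** A name to which the sigma-finite structure is attached, so that the plane can be a factor in
    Tonelli's theorem against the probability space. *)
Definition plane_measure : set plane -> \bar R := mu2.

HB.instance Definition _ := Measure.on plane_measure.

Lemma plane_sigma_finite : sigma_finite setT plane_measure.
Proof.
have /sigma_finiteP[F [TF ndF Foo]] := sigma_finiteT (mu : {sigma_finite_measure set (measurableTypeR R) -> \bar R}).
exists (fun n => F n `*` F n).
  apply/seteqP; split => // -[x y] _.
  have [n _ Fx] : (\bigcup_i F i) x by rewrite -TF.
  have [m _ Fy] : (\bigcup_i F i) y by rewrite -TF.
  exists (maxn n m) => //; split.
    have /subsetPset := ndF n (maxn n m) (leq_maxl _ _); exact.
  have /subsetPset := ndF m (maxn n m) (leq_maxr _ _); exact.
move=> n; have [mF Fn] := Foo n; split; first exact: measurableX.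
by rewrite /plane_measure product_measure1E// lte_mul_pinfty// ge0_fin_numE.
Qed.

HB.instance Definition _ := @Measure_isSigmaFinite.Build _ _ _ plane_measure plane_sigma_finite.

End Shift.
Lemma product_measure_swap d1 d2 (T1 : measurableType d1) (T2 : measurableType d2) (R : realType)
    (m1 : {sigma_finite_measure set T1 -> \bar R})
    (m2 : {sigma_finite_measure set T2 -> \bar R}) (A : set (T1 * T2)) : measurable A ->
  (\int[m1]_x m2 (xsection A x) = \int[m2]_y m1 (ysection A y))%E.
Proof.
move=> mA; apply: (@product_measure_unique _ _ _ _ _ m1 m2 (m1 \x^ m2)%E) => //.
by move=> ? ? ? ?; exact: product_measure2E.
Qed.

(** * Expected area of the cross set *)

Section Crossings.
Context {R : realType}.
Local Notation mu := lebesgue_measure.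
Local Notation mu2 := (mu \x mu)%E.
Local Notation pt := (R * R)%type.

(** The map exchanges the coordinates and shears; sliced at a fixed abscissa [x], it is a
    translation by [s * x]. *)
Lemma shear_measure s (A : set pt) : measurable A ->
  (mu2 [set cx | A (line s cx.1 cx.2)] = mu2 A)%E.
Proof.
move=> mA; set S := [set cx | _].
have mS : measurable S.
  have := measurable_line s 0 measurableT mA; rewrite setTI.
  by congr measurable; apply/seteqP; split => cx /=; rewrite addr0.
rewrite /product_measure1 /= product_measure_swap//.
apply: eq_integral => x _; rewrite -(lebesgue_measure_shift (s * x) (measurable_xsection x mA)).
by congr mu; apply/seteqP; split => c /=; rewrite /xsection /ysection/= !inE.
Qed.

Context d (T : measurableType d) (P : probability T R) (Z : T -> set pt).
Context (rZ : random_closed_set Z) (sZ : stationary P Z) (iZ : isotropic P Z).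

Lemma measurable_neq p q : measurable [set w | zin (Z w) p <> zin (Z w) q].
Proof.
have m1 t c : measurable [set w | zin (Z w) t = c].
  have mh : measurable (Z @^-1` hit [set t]) by apply: rZ.2; exact: compact_set1.
  by rewrite zin_hit; case: c => //; exact: measurableC.
rewrite (_ : [set w | _] = ([set w | zin (Z w) p = true] `&` [set w | zin (Z w) q = false]) `|`
  ([set w | zin (Z w) p = false] `&` [set w | zin (Z w) q = true])).
  by apply: measurableU; apply: measurableI.
by apply/seteqP; split => w /=; case: (zin (Z w) p) (zin (Z w) q) => [] [];
  by [move=> /(_ erefl)|left|right|move=> [[]|[]]].
Qed.

Lemma P_neq p q : P [set w | zin (Z w) p <> zin (Z w) q] = (2 * gamma P Z (edist p q))%:E.
Proof.
set A := [set w | _].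
have mA : measurable A := measurable_neq p q.
rewrite -(Ex_neq rZ sZ iZ) -[P A]fineK ?fin_num_measure// -(Ex_indic P mA).
congr EFin; apply: eq_Ex => w; rewrite indicE /neq; congr ((nat_of_bool _)%:R).
by apply/idP/idP => [/set_mem /eqP//|/eqP h]; apply/mem_set.
Qed.

Lemma measurable_crossings s rho W : closed W ->
  measurable [set wc : T * pt | cross_set s rho W (Z wc.1) wc.2].
Proof.
move=> cW; have mG := measurable_graph rZ.1 rZ.2.
have mA r : measurable [set wc : T * pt | Z wc.1 (line s wc.2.1 (wc.2.2 + r))].
  have ml : measurable_fun setT (fun wc : T * pt => (wc.1, line s wc.2.1 (wc.2.2 + r))).
    apply/measurable_fun_pair => /=; first exact: measurable_fst.
    exact: (measurableT_comp (measurable_line s r) measurable_snd).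
  by have := ml measurableT _ mG; rewrite setTI.
have mW : measurable [set wc : T * pt | W (line s wc.2.1 wc.2.2)].
  have := measurableT_comp (measurable_line s 0) (@measurable_snd _ _ T _).
  move=> /(_ measurableT _ (closed_measurable2 cW)); rewrite setTI.
  by congr measurable; apply/seteqP; split => cx /=; rewrite addr0.
pose A r := [set wc : T * pt | Z wc.1 (line s wc.2.1 (wc.2.2 + r))].
rewrite (_ : [set _ | _] = [set wc : T * pt | W (line s wc.2.1 wc.2.2)] `&`
   ((A 0 `\` A rho) `|` (A rho `\` A 0))).
  by apply: measurableI => //; apply: measurableU; apply: measurableD; exact: mA.
apply/seteqP; split => -[w [c x]]; rewrite /A /cross_set/= addr0.
  move=> [Wc h]; split => //; have [h1|h1] := pselect (Z w (line s c x)); [left|right]; split => //.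
    by move=> h2; apply: h; rewrite /zin (asboolT h1) (asboolT h2).
  by apply: contrapT => h2; apply: h; rewrite /zin (asboolF h1) (asboolF h2).
move=> [Wc hh]; split => // e; case: hh => -[h1 h2]; apply: h2.
  by apply/zinP; rewrite -e; exact/zinP.
by apply/zinP; rewrite e; exact/zinP.
Qed.

Lemma measurable_mu2_cross s rho W : closed W ->
  measurable_fun setT (fun w => mu2 (cross_set s rho W (Z w))).
Proof.
move=> cW; have := measurable_fun_xsection plane_measure (measurable_crossings s rho cW).
congr (measurable_fun setT _); apply/funext => w /=; congr mu2.
by apply/seteqP; split => cx; rewrite /xsection/= inE.
Qed.

(** By Tonelli the pair [(c, x)] is fixed first: the two points compared are at distance
    [rho * sqrt (1 + s ^+ 2)] wherever they lie, so the probability is constant on [W]. *)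
Lemma expected_crossings s rho W : 0 <= rho -> closed W ->
  (\int[P]_w mu2 (cross_set s rho W (Z w)) =
     (2 * gamma P Z (rho * Num.sqrt (1 + s ^+ 2)))%:E * mu2 W)%E.
Proof.
move=> rho0 cW; have mS := measurable_crossings s rho cW.
have mW := closed_measurable2 cW.
set S := [set wc | _] in mS.
transitivity (\int[P]_w plane_measure (xsection S w))%E.
  apply: eq_integral => w _; congr mu2.
  by apply/seteqP; split => cx; rewrite /xsection/= inE.
rewrite product_measure_swap//.
set g := 2 * _; pose B := [set cx : pt | W (line s cx.1 cx.2)].
have g0 : 0 <= g by rewrite mulr_ge0//; exact: gamma_ge0.
have mB : measurable B.
  have := measurable_line s 0 measurableT mW; rewrite setTI.
  by congr measurable; apply/seteqP; split => cx /=; rewrite addr0.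
transitivity (\int[plane_measure]_cx (g%:E * (\1_B cx)%:E))%E.
  apply: eq_integral => -[c x] _; have [Bc|Bc] := pselect (B (c, x)).
    rewrite indicE mem_set// mule1 /g.
    have <- : edist (line s c x) (line s c (x + rho)) = rho * Num.sqrt (1 + s ^+ 2).
      rewrite /edist/= (_ : _ + _ = rho ^+ 2 * (1 + s ^+ 2)); last by ring.
      by rewrite sqrtrM ?sqr_ge0// sqrtr_sqr ger0_norm.
    rewrite -P_neq; congr (P _); apply/seteqP; split => w; rewrite /ysection/= inE.
      by move=> [].
    by [].
  rewrite indicE memNset// mule0 (_ : ysection _ _ = set0) ?measure0//.
  by apply/seteqP; split => w //; rewrite /ysection/= inE => -[].
rewrite ge0_integralZl_EFin//; last first.
  by apply/measurable_EFinP; exact: measurable_indic.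
rewrite integral_indic// setIT; congr (_ * _)%E; exact: shear_measure.
Qed.

End Crossings.

(** * Areas by slices *)

Section Slices.
Context {R : realType}.
Local Notation mu := lebesgue_measure.
Local Notation mu2 := (mu \x mu)%E.
Local Notation pt := (R * R)%type.

Lemma mu2_le_slices (L B : R) (M : set pt) : 0 <= L -> 0 <= B -> measurable M ->
  (forall c x, M (c, x) -> `|c| <= L) ->
  (forall c, mu (xsection M c) <= B%:E)%E -> (mu2 M <= (B * (2 * L))%:E)%E.
Proof.
move=> L0 B0 mM ML MB.
apply: (@le_trans _ _ (\int[mu]_c (B%:E * (\1_`[- L, L]%classic c)%:E))%E).
  apply: ge0_le_integral_nomeas => [c|c]; first exact: measure_ge0.
  rewrite /comp indicE; have [cL|cL] := boolP (c \in `[- L, L]%classic); first by rewrite mule1.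
  rewrite mule0 (_ : xsection _ _ = set0) ?measure0//; apply/seteqP; split => x //.
  rewrite /xsection/= inE => /ML; rewrite ler_norml => cL'.
  by move: cL; rewrite mem_setE in_itv/= cL'.
rewrite ge0_integralZl_EFin//; last by apply/measurable_EFinP; exact: measurable_indic.
have muL : mu (`[- L, L]%classic : set R) = (2 * L)%:E.
  rewrite lebesgue_measure_itv/= lte_fin; case: ifPn => h.
    by rewrite -EFinD opprK mulr_natl mulr2n.
  have -> : L = 0 by lra.
  by rewrite mulr0.
by have : (B%:E * mu (`[(- L)%R, L]%classic : set R) <= (B * (2 * L))%:E)%E;
  [rewrite muL EFinM|rewrite integral_indic// setIT].
Qed.

(** On each line the lost points are within [rho] of each other: if [W] has a point more than [rho]
    further on, convexity puts [x + rho] in [W] and [x] is not lost. *)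
Lemma mu2_inner_part (s rho : R) (W : set pt) (M : R) : 0 <= rho -> 0 <= M -> closed W -> convex2 W ->
  (forall p, W p -> `|p.1| <= M /\ `|p.2| <= M) ->
  (mu2 W <= mu2 (inner_part s rho W) + (rho * (2 * ((1 + `|s|) * M)))%:E)%E.
Proof.
move=> rho0 M0 cW vW WM; have mW := closed_measurable2 cW.
have mI := closed_measurable2 (closed_inner_part (s := s) (rho := rho) cW).
rewrite -(shear_measure s mW) -(shear_measure s mI).
set B := [set cx | W _]; set B' := [set cx | inner_part _ _ _ _].
have mline A : measurable A -> measurable [set cx : pt | A (line s cx.1 cx.2)].
  move=> mA; have := measurable_line s 0 measurableT mA; rewrite setTI.
  by congr measurable; apply/seteqP; split => cx /=; rewrite addr0.
have mB : measurable B by exact: mline.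
have mB' : measurable B' by exact: mline.
have mD : measurable (B `\` B') by exact: measurableD.
apply: (@le_trans _ _ (plane_measure (B' `|` (B `\` B')))).
  apply: (@le_measure _ _ _ plane_measure); rewrite ?inE//; first exact: measurableU.
  by move=> cx Bcx; have [?|?] := pselect (B' cx); [left|right].
have hU := measureU2 plane_measure mB' mD.
apply: le_trans hU _; apply: leeD => //.
have sM0 : 0 <= (1 + `|s|) * M by rewrite mulr_ge0// addr_ge0.
apply: mu2_le_slices => // [c x [/WM[/= x1 x2] _]|c].
  rewrite mulrDl mul1r; have -> : c = (c + s * x) - s * x by rewrite addrK.
  by apply: le_trans (ler_normB _ _) _; rewrite lerD// normrM ler_wpM2l.
apply: mu_le_dist => //; first exact: measurable_xsection.
suff h x y : xsection (B `\` B') c x -> xsection (B `\` B') c y -> y - x <= rho.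
  by move=> x y hx hy; rewrite ler_norml lerNl opprB !h.
rewrite /xsection/= !inE => -[Bx nB'x] [By _]; rewrite leNgt; apply/negP => xy.
apply: nB'x; split => //=.
have yx0 : 0 < y - x by exact: le_lt_trans xy.
have t01 : 0 <= rho / (y - x) <= 1.
  apply/andP; split; first by apply: divr_ge0 => //; exact: ltW.
  by rewrite ler_pdivrMr// mul1r; exact: ltW.
have := vW _ _ Bx By (rho / (y - x)) t01; rewrite line_conv /line/=.
have -> : (1 - rho / (y - x)) * x + rho / (y - x) * y = x + rho.
  by field; rewrite gt_eqF.
by congr W; congr (_, _); ring.
Qed.

Lemma mu_cover_le n (X : nat -> set R) (l : R) (S : set R) : 0 <= l -> measurable S ->
  (forall i x y, (i < n)%N -> X i x -> X i y -> `|x - y| <= l) ->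
  S `<=` \bigcup_(i in `I_n) X i -> (mu S <= (n%:R * l)%:E)%E.
Proof.
move=> l0 + Xl; elim: n Xl S => [|n ih] Xl S mS SX.
  rewrite (_ : S = set0) ?measure0 ?mul0r//.
  by apply/seteqP; split => // x /SX[].
have [a Xa] := dist_lt_in_itv (fun x y => Xl n x y (ltnSn n)).
have mI : measurable (`[a, a + l]%classic : set R) by exact: measurable_itv.
have mD : measurable (S `\` `[a, a + l]) by exact: measurableD.
apply: (@le_trans _ _ (mu ((S `\` `[a, a + l]) `|` `[a, a + l]%classic))).
  apply: le_measure; rewrite ?inE//; first exact: measurableU.
  by move=> x Sx; have [?|?] := pselect (`[a, a + l]%classic x); [right|left].
have hU := measureU2 (@lebesgue_measure R) mD mI.
apply: le_trans hU _; rewrite -natr1 mulrDl mul1r EFinD; apply: leeD.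
  apply: ih => // [i x y ni|x [/SX[i /= ni Xi] nx]]; first by apply: Xl; exact: ltnW.
  exists i => //=; move: ni; rewrite ltnS leq_eqVlt => /orP[/eqP ein|//].
  by case: nx; apply: Xa; rewrite -ein.
have hI : @Order.le _ _ (mu (`[a, a + l]%classic : set R)) l%:E.
  by rewrite lebesgue_measure_itv/= lte_fin ltrDl; case: ifP => // _; rewrite -EFinD addrAC subrr add0r.
exact: hI.
Qed.

Lemma convex_cball : convex2 (cball 1 : set pt).
Proof.
move=> p q; rewrite /cball/= !edist_le_sqr//= !sub0r !sqrrN => p1 q1 t /andP[t0 t1].
rewrite edist_le_sqr//= !sub0r !sqrrN.
have tt : 0 <= t * (1 - t) by rewrite mulr_ge0// subr_ge0.
have := mulr_ge0 tt (sqr_ge0 (p.1 - q.1)); have := mulr_ge0 tt (sqr_ge0 (p.2 - q.2)).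
have t1' : 0 <= 1 - t by rewrite subr_ge0.
have := ler_wpM2l t0 q1; have := ler_wpM2l t1' p1; lra.
Qed.

(** The unit disc is compact and convex, so finitely many of the convex sets cover [Z] there; the
    minimum exists and [Nconv] does not fall back on its default value. *)
Lemma Nconv_cover (Z : set pt) : locally_polyconvex Z ->
  union_of_n_convex (Z `&` cball 1) (Nconv (Z `&` cball 1)).
Proof.
move=> [K [hK [ZE fK]]].
have cB : compact (cball 1 : set pt).
  apply: (@closed_bounded_compact _ _ 1) => [|p].
    apply/closed_edist => p h; rewrite /cball/= leNgt; apply/negP => p1.
    have /h[q] : 0 < edist (0, 0) p - 1 by rewrite subr_gt0.
    by rewrite /cball/= => q1; have := edist_triangle (0, 0) q p; rewrite (edistC q p); lra.
  rewrite /cball/= => p1; split; apply: le_trans p1.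
    by have := edist_fst (0, 0) p; rewrite sub0r normrN.
  by have := edist_snd (0, 0) p; rewrite sub0r normrN.
have [N hN] := locally_finite_bound (fK _ cB).
have ex : exists n, `[< union_of_n_convex (Z `&` cball 1) n >].
  exists N; apply/asboolP; exists (fun i => K i `&` cball 1); split.
    move=> i p q [Kp Bp] [Kq Bq] t t01; split; [exact: (hK i).2|exact: convex_cball].
  apply/seteqP; split => p.
    by move=> [+ pB]; rewrite ZE => -[i _ Kp]; exists i => //; exact: hN Kp pB.
  by move=> [i _ [Kp pB]]; split => //; rewrite ZE; exists i.
have := @xgetPex nat 0%N [set n | union_of_n_convex (Z `&` cball 1) n /\
                    forall m, union_of_n_convex (Z `&` cball 1) m -> (n <= m)%N].
case; last by [].
case: (ex_minnP ex) => n /asboolP hn nm; exists n; split => // m hm.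
by apply: nm; apply/asboolP.
Qed.

End Slices.

(** * Linear bound for gamma *)

Section GammaBound.
Context {R : realType}.
Local Notation mu := lebesgue_measure.
Local Notation mu2 := (mu \x mu)%E.
Local Notation pt := (R * R)%type.

(** Small enough for the box and its horizontal shifts by at most [1 / 4] to stay in the unit disc,
    to which the moment condition refers. *)
Definition corner_box : set pt := `[0, 1 / 4]%classic `*` `[0, 1 / 4]%classic.

Lemma closed_corner_box : closed corner_box.
Proof. by apply: compact_closed_pt; apply: compact_setX; exact: segment_compact. Qed.

Lemma mu2_corner_box : mu2 corner_box = (1 / 16)%:E.
Proof.
pose I : set R := `[0, 1 / 4]%classic.
have mI : measurable I by exact: measurable_itv.
have eI : mu I = (1 / 4)%:E by rewrite lebesgue_measure_itv/= lte_fin divr_gt0// oppr0 adde0.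
transitivity (mu I * mu I)%E; first exact: product_measure1E.
by rewrite eI -EFinM; congr EFin; field.
Qed.

(** A line enters and leaves each of the [n] convex sets at most once, so the changes over a step
    [r] lie in [n + n] sets of diameter at most [r]. Intercepts satisfy [|c| <= 1 / 4], which gives
    [n * r] in all, and [n <= 2 ^ n]. *)
Lemma cross_box_le r (Z : set pt) : 0 < r -> r <= 1 / 4 -> closed Z -> locally_polyconvex Z ->
  (mu2 (cross_set 0 r corner_box Z) <= (r * (2 ^ Nconv (Z `&` cball 1))%N%:R)%:E)%E.
Proof.
move=> r0 r4 cZ pZ; have [K [vK KE]] := Nconv_cover pZ; set n := Nconv _ in KE *.
have mC := measurable_cross_set 0 r closed_corner_box cZ.
have ZK x y : 0 <= x <= 1 / 2 -> 0 <= y <= 1 / 4 ->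
    Z (x, y) -> exists2 i, (i < n)%N & K i (x, y).
  move=> /andP[x0 x1] /andP[y0 y1] Zp.
  have : (Z `&` cball 1) (x, y).
    split => //; rewrite /cball/= edist_le_sqr//= !sub0r !sqrrN expr1n; nra.
  by rewrite KE => -[i /= ni Ki]; exists i.
have KZ i p : (i < n)%N -> K i p -> Z p.
  by move=> ni Ki; have : (\bigcup_(i in `I_n) K i) p; [exists i|rewrite -KE => -[]].
have slice c : (mu (xsection (cross_set 0 r corner_box Z) c) <= ((n + n)%:R * r)%:E)%E.
  pose X i : set R := [set x | K i (x, c) /\ ~ K i (x + r, c)].
  pose Y i : set R := [set x | ~ K i (x, c) /\ K i (x + r, c)].
  have conv i x y z : x < y -> y < z -> K i (x, c) -> K i (z, c) -> K i (y, c).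
    move=> xy yz Kx Kz; have zx : 0 < z - x by lra.
    have := vK i _ _ Kx Kz ((y - x) / (z - x)) _.
    rewrite /= (_ : (1 - (y - x) / (z - x)) * x + (y - x) / (z - x) * z = y); last first.
      by field; rewrite gt_eqF.
    rewrite (_ : (1 - (y - x) / (z - x)) * c + (y - x) / (z - x) * c = c); last by ring.
    apply; rewrite divr_ge0/=; [|lra..].
    by rewrite ler_pdivrMr// mul1r; lra.
  have hX i x y : X i x -> X i y -> y - x <= r.
    move=> [Kx nKx] [Ky _]; rewrite leNgt; apply/negP => h; apply: nKx.
    by apply: (conv i x _ y) => //; lra.
  have hY i x y : Y i x -> Y i y -> y - x <= r.
    move=> [_ Kx] [nKy Ky]; rewrite leNgt; apply/negP => h; apply: nKy.
    by apply: (conv i (x + r) _ (y + r)) => //; lra.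
  (* The exits come first, then the entries with their index shifted by [n]. *)
  apply: (@mu_cover_le _ _ (fun i => if (i < n)%N then X i else Y (i - n)%N)).
  - exact: ltW.
  - exact: measurable_xsection.
  - move=> i x y _; case: ifP => _ h1 h2; rewrite ler_norml lerNl opprB.
      by rewrite !(hX i).
    by rewrite !(hY (i - n)%N).
  - move=> x; rewrite /xsection/= inE => -[[/= ]]; rewrite !in_itv/= mul0r addr0 => x01 c01 zz.
    have [Zx|nZx] := pselect (Z (x, c)).
      have [||i ni Kx] := ZK _ _ _ _ Zx => //; first by lra.
      exists i; first by rewrite /= ltn_addr.
      rewrite ni; split => // Kxr; apply: zz; rewrite /line !mul0r addr0.
      by rewrite /zin (asboolT Zx) (asboolT (KZ _ _ ni Kxr)).
    have Zxr : Z (x + r, c).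
      apply: contrapT => nZ; apply: zz; rewrite /line !mul0r addr0.
      by rewrite /zin (asboolF nZx) (asboolF nZ).
    have [||i ni Kx] := ZK _ _ _ _ Zxr => //; first by lra.
    exists (n + i)%N; first by rewrite /= ltn_add2l.
    rewrite ltnNge leq_addr/= addKn; split => // Kxr; apply: nZx; exact: KZ ni Kxr.
apply: (@le_trans _ _ (((n + n)%:R * r) * (2 * (1 / 4)))%:E).
  apply: mu2_le_slices => //; first by rewrite mulr_ge0// ltW.
  move=> c x [[/= ]]; rewrite !in_itv/= mul0r addr0 => _ /andP[c0 c1] _.
  by rewrite ger0_norm.
rewrite lee_fin natrD mulrC mulrA [leLHS](_ : _ = r * n%:R); last by field.
by apply: ler_wpM2l; [exact: ltW|rewrite ler_nat ltnW// ltn_expl].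
Qed.

Context d (T : measurableType d) (P : probability T R) (Z : T -> set pt).
Context (stZ : standard_random_set P Z) (iZ : isotropic P Z).

(** For [r <= 1 / 4] the expected area [2 * gamma r / 16] is at most [C * r], whence the 8; for
    larger [r] the trivial bound [gamma r <= 1 / 2] is below [4 * r]. *)
Lemma gamma_linear : exists2 C : R, 0 <= C & forall r, 0 <= r -> gamma P Z r <= C * r.
Proof.
have [rZ sZ [N [mN N0 pZ]] fin] := stZ.
pose g w := ((2 ^ Nconv (Z w `&` cball 1))%N%:R)%:E : \bar R.
have g0 w : (0 <= g w)%E by rewrite lee_fin.
have E0 : (0 <= \int[P]_w g w)%E by exact: integral_ge0.
pose C := fine (\int[P]_w g w)%E.
have CE : (\int[P]_w g w)%E = C%:E by rewrite fineK// ge0_fin_numE.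
have C0 : 0 <= C by rewrite fine_ge0.
exists (8 * C + 4) => [|r r0]; first by rewrite addr_ge0// mulr_ge0.
have [r4|r4] := ltP (1 / 4) r.
  have g1 : (2 * gamma P Z r)%:E = P [set w | zin (Z w) (0, 0) <> zin (Z w) (r, 0)].
    by rewrite (P_neq rZ sZ iZ) edist_h sub0r normrN ger0_norm.
  have : ((2 * gamma P Z r)%:E <= 1%:E)%E by rewrite g1; apply: probability_le1; exact: measurable_neq.
  rewrite lee_fin => h; have := mulr_ge0 C0 r0; lra.
have [r00|rn] := eqVneq r 0.
  rewrite r00 mulr0 (gammaE rZ sZ iZ)// (@eq_Ex _ _ _ P _ (cst 0)); last first.
    by move=> w; rewrite /io andbN.
  by rewrite /Ex Rintegral_cst// mul0r.
have {rn}r0 : 0 < r by rewrite lt_neqAle eq_sym rn.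
have eC := expected_crossings rZ sZ iZ 0 (ltW r0) closed_corner_box.
have mf := measurable_mu2_cross rZ 0 r closed_corner_box.
set f := (fun w => mu2 (cross_set _ _ _ _)) in mf.
have f0 w : (0 <= f w)%E by exact: measure_ge0.
have : (\int[P]_w (r^-1%:E * f w) <= \int[P]_w g w)%E.
  apply: (ge0_ae_le_integral mN N0) => //.
  - by move=> w; rewrite mule_ge0// lee_fin invr_ge0 ltW.
  - exact: measurable_funeM.
  - move=> w nN; have pw : locally_polyconvex (Z w) by apply: contrapT => h; apply: nN; exact: pZ.
    have := cross_box_le r0 r4 (rZ.1 w) pw => /(lee_wpmul2l (x := r^-1%:E)) h.
    apply: le_trans (h _) _; first by rewrite lee_fin invr_ge0 ltW.
    by rewrite -EFinM mulrA mulVf ?mul1r// gt_eqF.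
rewrite ge0_integralZl_EFin//; last by rewrite invr_ge0 ltW.
rewrite [X in (_ * X)%E]eC mu2_corner_box CE expr0n/= addr0 sqrtr1 mulr1 -!EFinM lee_fin.
rewrite -ler_pdivlMl ?invr_gt0// invrK => h; lra.
Qed.

Lemma gamma_cvg : exists kappa : R, [/\ 0 <= kappa,
  forall r, 0 < r -> gamma P Z r <= kappa * r & gamma P Z r / r @[r --> 0^'+] --> kappa].
Proof.
have [rZ sZ _ _] := stZ; have [C C0 h] := gamma_linear.
apply: (@subadditive_cvg0 _ _ C) => [r r0|r s r0 s0]; first by rewrite gamma_ge0//= h.
exact: gamma_subadd.
Qed.

End GammaBound.

(** * The specific boundary length *)

Section SpecificBoundaryLength.
Context {R : realType}.
Local Notation mu := lebesgue_measure.
Local Notation mu2 := (mu \x mu)%E.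
Local Notation pt := (R * R)%type.

Lemma boundary_closed (F : set pt) : closed F -> boundary F = F `\` interior F.
Proof. by move=> cF; rewrite /boundary -(closure_id _).1. Qed.

Lemma boundary_window_sup (Z W : set pt) : closed Z -> closed W ->
  (Z `\` interior Z) `&` W `<=` boundary (Z `&` W).
Proof.
move=> cZ cW p [[Zp nZp] Wp]; rewrite boundary_closed; last exact: closedI.
by split => // h; apply: nZp; exact: (interiorS (@subIsetl _ Z W)).
Qed.

Lemma boundary_window_sub (Z W : set pt) : closed Z -> closed W ->
  boundary (Z `&` W) `<=` ((Z `\` interior Z) `&` interior W) `|` (W `\` interior W).
Proof.
move=> cZ cW p; rewrite boundary_closed; last exact: closedI.
move=> [[Zp Wp] nI]; have [iW|niW] := pselect (interior W p); last by right.
by left; split => //; split => // iZ; apply: nI; rewrite interiorI.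
Qed.

Context d (T : measurableType d) (P : probability T R) (Z : T -> set pt).
Context (adm : admissible P Z) (kappa : R) (k0 : 0 <= kappa).
Context (gk : forall r, 0 < r -> gamma P Z r <= kappa * r).
Context (gl : gamma P Z r / r @[r --> 0^'+] --> kappa).

Let rZ : random_closed_set Z. Proof. by case: adm => -[]. Qed.
Let sZ : stationary P Z. Proof. by case: adm => -[]. Qed.
Let iZ : isotropic P Z. Proof. by case: adm. Qed.

Let good : exists N, [/\ measurable N, P N = 0 &
  forall w, ~ N w -> locally_polyconvex (Z w) /\ topologically_regular (Z w)].
Proof.
case: adm => -[_ _ pZ _] _ tZ.
have [N [mN N0 hN]] := negligibleU pZ tZ; exists N; split => // w nN; split.
  by apply: contrapT => h; apply: nN; apply: hN; left.
by apply: contrapT => h; apply: nN; apply: hN; right.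
Qed.

Context (W : set pt) (M A : R) (cW : compact W) (vW : convex2 W) (M0 : 0 <= M).
Context (WM : forall p, W p -> `|p.1| <= M /\ `|p.2| <= M) (AE : mu2 W = A%:E).

Let clW : closed W. Proof. exact: compact_closed_pt. Qed.

Let A0 : 0 <= A. Proof. by rewrite -lee_fin -AE measure_ge0. Qed.

Let I := (\int[P]_w V1 (Z w `&` W))%E.

Let V10 F : (0 <= V1 (R := R) F)%E.
Proof. by rewrite mule_ge0 ?hausdorff1_ge0// lee_fin. Qed.

Let unit_step (u : pt) r : edist (0, 0) u = 1 -> 0 < u.1 ->
  (r * u.1) * Num.sqrt (1 + (u.2 / u.1) ^+ 2) = r.
Proof.
move=> eu u0; have un : u.1 != 0 by rewrite gt_eqF.
have {}eu : u.1 ^+ 2 + u.2 ^+ 2 = 1.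
  by have := sqr_edist (0, 0) u; rewrite eu !sub0r !sqrrN expr1n.
have -> : 1 + (u.2 / u.1) ^+ 2 = (u.1^-1) ^+ 2.
  by rewrite expr_div_n -[1](divff (x := u.1 ^+ 2)) ?expf_neq0// -mulrDl eu mul1r exprVn.
by rewrite sqrtr_sqr gtr0_norm ?invr_gt0// -mulrA divff// mulr1.
Qed.

(** The loss [4 * M * r] bounds the area of the points that a step of length [r] takes out of
    [W]. *)
Lemma V1_window_ge eta r : 0 < eta -> 0 < r ->
  ((gamma P Z r * (A - 4 * M * r) / (r * (2 / pi + 2 * eta)))%:E <= I)%E.
Proof.
move=> eta0 r0; have [m [J [u [nu [sigma [eps [m0 hu hnu net [eps0 ee s1 s2]]]]]]]] := quadrature eta0.
have [N [mN N0 hN]] := good.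
have m0' : 0 < m%:R :> R by rewrite ltr0n.
have pi0 : 0 < 2 / pi :> R by rewrite divr_gt0// pi_gt0.
pose f k w := mu2 (cross_set ((u k).2 / (u k).1) (r * (u k).1)
     (inner_part ((u k).2 / (u k).1) (r * (u k).1) W) (Z w)).
pose c := 2 * (r * (m%:R * (sigma + eps))).
have c0 : 0 < c by rewrite !mulr_gt0//; lra.
have clI k : closed (inner_part ((u k).2 / (u k).1) (r * (u k).1) W).
  exact: closed_inner_part.
have f0 k w : (0 <= f k w)%E by exact: measure_ge0.
have mf k : measurable_fun setT (f k) by apply: (measurable_mu2_cross rZ).
have intf : (\int[P]_w (\sum_(k < m) f k w) = \sum_(k < m) \int[P]_w f k w)%E.
  rewrite ge0_integral_sum//.
have h : (\int[P]_w (c^-1%:E * \sum_(k < m) f k w) <= I)%E.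
  apply: (ge0_ae_le_integral mN N0) => //.
  - by move=> w; apply: mule_ge0; [rewrite lee_fin invr_ge0 ltW|apply: sume_ge0].
  - by apply: measurable_funeM; apply: emeasurable_sum.
  - move=> w nN; have [pw tw] := hN w nN.
    have := boundary_length_ge hu hnu net eps0 r0 (rZ.1 w) pw cW vW.
    move=> /(lee_wpmul2l (x := c^-1%:E)) h; apply: le_trans (h _) _.
      by rewrite lee_fin invr_ge0 ltW.
    rewrite muleA -EFinM /V1 (_ : _ * _ = 2^-1); last first.
      by rewrite /c; field; rewrite !gt_eqF//; lra.
    apply: lee_wpmul2l; first by rewrite lee_fin.
    by apply: hausdorff1S; exact: (boundary_window_sup (rZ.1 w) clW).
apply: le_trans h; rewrite ge0_integralZl_EFin//; last 3 first.
- by move=> w _; apply: sume_ge0.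
- exact: emeasurable_sum.
- by rewrite invr_ge0 ltW.
rewrite intf.
have fk k : (k < m)%N -> ((2 * gamma P Z r * (A - 4 * M * r))%:E <= \int[P]_w f k w)%E.
  move=> km; have [eu u0] := hu k km; have ru0 : 0 <= r * (u k).1 by rewrite ltW// mulr_gt0.
  rewrite /f (expected_crossings rZ sZ iZ)// unit_step// EFinM.
  apply: lee_wpmul2l; first by rewrite lee_fin mulr_ge0//; exact: gamma_ge0.
  have := mu2_inner_part ((u k).2 / (u k).1) ru0 M0 clW vW WM.
  rewrite AE => h; rewrite EFinB leeBlDr//; apply: le_trans h _; apply: leeD => //.
  have e1 : (u k).1 * (1 + `|(u k).2 / (u k).1|) = (u k).1 + `|(u k).2|.
    by rewrite normrM normfV (gtr0_norm u0); field; rewrite gt_eqF.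
  rewrite lee_fin.
  have -> : r * (u k).1 * (2 * ((1 + `|(u k).2 / (u k).1|) * M)) =
      2 * r * M * ((u k).1 * (1 + `|(u k).2 / (u k).1|)) by ring.
  rewrite e1; have := edist_fst (0, 0) (u k); have := edist_snd (0, 0) (u k).
  rewrite eu !sub0r !normrN (gtr0_norm u0) => h1 h2.
  have rM : 0 <= 2 * r * M by rewrite !mulr_ge0// ltW.
  have := ler_wpM2l rM (lerD h2 h1); lra.
(* Enlarging the denominator lowers the quotient only if this factor is nonnegative; otherwise the
   bound is at most 0 and trivial. *)
have [Am|Am] := leP 0 (A - 4 * M * r); last first.
  apply: (@le_trans _ _ 0%E).
    rewrite lee_fin ler_pdivrMr ?mul0r; last by rewrite mulr_gt0//; lra.
    by apply: mulr_ge0_le0; [exact: gamma_ge0|exact: ltW].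
  by apply: mule_ge0; [rewrite lee_fin invr_ge0 ltW|apply: sume_ge0 => k _; exact: integral_ge0].
apply: (@le_trans _ _ (c^-1 * (m%:R * (2 * gamma P Z r * (A - 4 * M * r))))%:E).
  rewrite lee_fin.
  have -> : c^-1 * (m%:R * (2 * gamma P Z r * (A - 4 * M * r))) =
     gamma P Z r * (A - 4 * M * r) / (r * (sigma + eps)).
    by rewrite /c; field; rewrite !gt_eqF//; lra.
  apply: ler_wpM2l; first by rewrite mulr_ge0//; exact: gamma_ge0.
  rewrite lef_pV2 ?posrE ?mulr_gt0//; [|lra..].
  by apply: ler_wpM2l; [exact: ltW|lra].
rewrite EFinM; apply: lee_wpmul2l; first by rewrite lee_fin invr_ge0 ltW.
rewrite mulr_natl -[in X in (_ *+ X)](card_ord m) -sumr_const -sumEFin.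
by apply: lee_sum => k _; exact: fk.
Qed.

(** Fatou's lemma is applied once more, over the realizations, and [gamma r <= kappa * r] bounds the
    expectation for every step. The boundary of [W] enters only through [c * M]. *)
Lemma V1_window_le (c eta : R) :
  (hausdorff1 (W `\` interior W) <= (c * M)%:E)%E -> 0 < eta -> 2 * eta < 2 / pi ->
  (I <= (kappa * A / (2 / pi - 2 * eta) + c * M / 2)%:E)%E.
Proof.
move=> hc eta0 eta1; have [m [J [u [nu [sigma [eps [m0 hu hnu net [eps0 ee s1 s2]]]]]]]] := quadrature eta0.
have [N [mN N0 hN]] := good.
have m0' : 0 < m%:R :> R by rewrite ltr0n.
have cM : 0 <= c * M by rewrite -lee_fin (le_trans (hausdorff1_ge0 _) hc).
pose tau := sigma - 2 * eps; have tau0 : 0 < tau by rewrite /tau; lra.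
pose a := (2 * (m%:R * tau))^-1; have a0 : 0 <= a by rewrite invr_ge0 !mulr_ge0// ltW.
pose f k n w := ((n.+1%:R)%:E * mu2 (cross_set ((u k).2 / (u k).1) (n.+1%:R^-1 * (u k).1) W (Z w)))%E.
pose S w := (\sum_(k < m) limn_einf (fun n => f k n w))%E.
have f0 k n w : (0 <= f k n w)%E by rewrite mule_ge0//; exact: measure_ge0.
have mf k n : measurable_fun setT (f k n).
  by apply: measurable_funeM; exact: (measurable_mu2_cross rZ).
have l0 k w : (0 <= limn_einf (fun n => f k n w))%E by apply: limn_einf_ge; exact: nearW.
have ml k : measurable_fun setT (fun w => limn_einf (fun n => f k n w)).
  exact: (@measurable_fun_limn_einf _ _ _ (f k)).
have S0 w : (0 <= S w)%E by apply: sume_ge0.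
have mS : measurable_fun setT S by apply: emeasurable_sum.
have b0 : 0 <= c * M / 2 by rewrite divr_ge0.
have h : (I <= \int[P]_w (a%:E * S w + (c * M / 2)%:E))%E.
  apply: (le_ae_ge0_integral mN N0) => //.
  - by move=> w; rewrite adde_ge0// mule_ge0.
  - by apply: emeasurable_funD => //; exact: measurable_funeM.
  - move=> w nN; have [pw tw] := hN w nN.
    have := boundary_length_le hu hnu net eps0 (_ : 2 * eps <= sigma) (rZ.1 w) pw tw cW.
    move=> /(_ _)/(lee_wpmul2l (x := a%:E)) h.
    rewrite /V1; apply: (@le_trans _ _ (2^-1%:E * (hausdorff1 ((Z w `\` interior (Z w)) `&` interior W) +
      hausdorff1 (W `\` interior W)))%E).
      apply: lee_wpmul2l => //; apply: le_trans (hausdorff1U _ _).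
      by apply: hausdorff1S; exact: (boundary_window_sub (rZ.1 w) clW).
    rewrite ge0_muleDr ?hausdorff1_ge0//; apply: leeD.
      apply: le_trans (h _ _); [|by rewrite lee_fin|by rewrite /tau in tau0; lra].
      rewrite muleA -EFinM (_ : a * _ = 2^-1)//.
      by rewrite /a -/tau; field; rewrite !gt_eqF.
    rewrite -[(c * M / 2)]mulrC EFinM; apply: lee_wpmul2l => //.
apply: le_trans h _; rewrite ge0_integralD//; last 2 first.
- by move=> w _; rewrite mule_ge0.
- exact: measurable_funeM.
have intb : (\int[P]_w (c * M / 2)%:E = (c * M / 2)%:E)%E.
  by rewrite integral_cst// -[RHS]mule1; congr (_ * _)%E; exact: probability_setT.
rewrite ge0_integralZl_EFin// intb EFinD; apply: leeD => //.
have intS : (\int[P]_w S w <= (m%:R * (2 * kappa * A))%:E)%E.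
  rewrite /S ge0_integral_sum//.
  rewrite mulr_natl -[in X in (_ *+ X)](card_ord m) -sumr_const -sumEFin.
  apply: lee_sum => k _; have [eu u0] := hu k (ltn_ord k).
  apply: le_trans (fatou P measurableT (mf k) _) _ => //.
  rewrite limn_einf_lim; apply: lime_le; first exact: is_cvg_einfs.
  apply: nearW => n; apply: (@le_trans _ _ (\int[P]_w f k n w)%E).
    by apply: ereal_inf_lbound; exists n => /=.
  rewrite ge0_integralZl_EFin//; last exact: (measurable_mu2_cross rZ).
  have r0 : 0 < n.+1%:R^-1 :> R by rewrite invr_gt0.
  rewrite (expected_crossings rZ sZ iZ)//; last by rewrite ltW// mulr_gt0.
  rewrite unit_step// AE -!EFinM lee_fin mulrA; apply: ler_wpM2r => //.
  have := gk r0; rewrite ler_pdivlMr// => h; lra.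
apply: (@le_trans _ _ (a%:E * (m%:R * (2 * kappa * A))%:E)%E).
  by apply: lee_wpmul2l; rewrite ?lee_fin.
rewrite -EFinM lee_fin (_ : a * _ = kappa * A / tau); last first.
  by rewrite /a; field; rewrite !gt_eqF.
apply: ler_wpM2l; first exact: mulr_ge0.
by rewrite lef_pV2 ?posrE// /tau; lra.
Qed.

Lemma V1_window (c : R) : (hausdorff1 (W `\` interior W) <= (c * M)%:E)%E ->
  exists v, [/\ I = v%:E, pi * kappa / 2 * A <= v & v <= pi * kappa / 2 * A + c * M / 2].
Proof.
move=> hc; have ppi : 0 < pi :> R by exact: pi_gt0.
have := fun eta => @V1_window_le c eta hc; have := @V1_window_ge; move: ppi; generalize (pi : R) => q q0 hge hle.
have q2 : 0 < 2 / q by rewrite divr_gt0.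
have q2q t : t * (2 / q) * (q / 2) = t by field; rewrite gt_eqF.
have I0 : (0 <= I)%E by exact: integral_ge0.
have kA : 0 <= kappa * A by exact: mulr_ge0.
have Ifin : I \is a fin_num.
  rewrite ge0_fin_numE//; have := hle (2 / q / 4); rewrite divr_gt0// => /(_ isT).
  by move=> h; apply: le_lt_trans (h _) (ltry _); lra.
have [v vE] : exists v, I = v%:E by exists (fine I); rewrite fineK.
rewrite vE lee_fin in I0; have v0 := I0.
have {}hge eta r : 0 < eta -> 0 < r ->
    ((gamma P Z r * (A - 4 * M * r) / (r * (2 / q + 2 * eta)))%:E <= v%:E)%E.
  by rewrite -vE; exact: hge.
have {}hle eta : 0 < eta -> 2 * eta < 2 / q ->
    (v%:E <= (kappa * A / (2 / q - 2 * eta) + c * M / 2)%:E)%E.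
  by rewrite -vE; exact: hle.
exists v; split => //.
  rewrite leNgt; apply/negP => hlt.
  have {}hlt : v * (2 / q) < kappa * A.
    by rewrite -(ltr_pM2r (_ : 0 < q / 2)) ?divr_gt0// q2q; lra.
  (* This choice keeps [v * (2 / q + 2 * eta)] below [kappa * A]; the 1 added to [v] allows for
     [v = 0]. *)
  pose eta := (kappa * A - v * (2 / q)) / (4 * (v + 1)).
  have v1 : 0 < 4 * (v + 1) by lra.
  have eta0 : 0 < eta by rewrite divr_gt0// subr_gt0.
  have eE : eta * (4 * (v + 1)) = kappa * A - v * (2 / q) by rewrite /eta mulfVK// gt_eqF.
  have w0 : 0 < 2 / q + 2 * eta by lra.
  suff : kappa * A <= v * (2 / q + 2 * eta) by nra.
  have lim : gamma P Z r / r * (A - 4 * M * r) @[r --> 0^'+] --> kappa * (A - 4 * M * 0).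
    apply: cvgM => //; apply: cvgB; first exact: cvg_cst.
    apply: cvgM; first exact: cvg_cst.
    exact: cvg_at_right_filter.
  rewrite (_ : kappa * A = kappa * (A - 4 * M * 0)); last by ring.
  apply: (cvgr_to_le lim); near=> r.
  have r0 : 0 < r by near: r; exact: nbhs_right_gt.
  have := hge _ _ eta0 r0; rewrite lee_fin ler_pdivrMr ?mulr_gt0// => h.
  rewrite mulrAC ler_pdivrMr//; nra.
rewrite leNgt; apply/negP => hlt.
pose t := v - c * M / 2; have ht : q * kappa / 2 * A < t by rewrite /t; lra.
have {}ht : kappa * A < t * (2 / q).
  by rewrite -(ltr_pM2r (_ : 0 < q / 2)) ?divr_gt0// q2q; lra.
have t0 : 0 < t by rewrite -(pmulr_lgt0 _ q2); exact: le_lt_trans ht.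
pose eta := (t * (2 / q) - kappa * A) / (4 * t).
have eta0 : 0 < eta by rewrite divr_gt0// ?subr_gt0// mulr_gt0.
have eE : 4 * t * eta = t * (2 / q) - kappa * A.
  by rewrite /eta mulrC mulfVK// gt_eqF// mulr_gt0.
have eta1 : 2 * eta < 2 / q by nra.
have := hle _ eta0 eta1; rewrite lee_fin -lerBlDr -/t ler_pdivlMr ?subr_gt0//; nra.
Unshelve. all: by end_near. Qed.

End SpecificBoundaryLength.

(** * Dilated windows *)

Section Dilation.
Context {R : realType}.
Local Notation mu := lebesgue_measure.
Local Notation mu2 := (mu \x mu)%E.
Local Notation pt := (R * R)%type.

Lemma dilate_compact s (W : set pt) : compact W -> compact (dilate s W).
Proof.
move=> cW; apply: continuous_compact => //; apply: continuous_subspaceT => p.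
have c1 : {for p, continuous (fun p : pt => s * p.1)} by apply: cvgM; [exact: cvg_cst|exact: cvg_fst].
have c2 : {for p, continuous (fun p : pt => s * p.2)} by apply: cvgM; [exact: cvg_cst|exact: cvg_snd].
exact: (cvg_pair c1 c2).
Qed.

Lemma dilate_convex s (W : set pt) : convex2 W -> convex2 (dilate s W).
Proof.
move=> vW _ _ [p Wp <-] [q Wq <-] t t01.
exists ((1 - t) * p.1 + t * q.1, (1 - t) * p.2 + t * q.2); first exact: vW.
by congr (_, _) => /=; ring.
Qed.

Lemma mu2_square (x y l : R) : 0 <= l ->
  mu2 (`[x, x + l]%classic `*` `[y, y + l]%classic : set pt) = (l * l)%:E.
Proof.
move=> l0; have h z : mu (`[z, z + l]%classic : set R) = l%:E.
  rewrite lebesgue_measure_itv/= lte_fin ltrDl; case: ltP => h.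
    by rewrite -EFinD addrAC subrr add0r.
  by congr EFin; apply/eqP; rewrite eq_le l0.
transitivity (mu (`[x, (x + l)%R]%classic : set R) * mu (`[y, (y + l)%R]%classic : set R))%E.
  by apply: product_measure1E; exact: measurable_itv.
by rewrite !h EFinM.
Qed.

(** Quadratic growth is all that the limit requires, so a small square inside [W] replaces the exact
    scaling of the area. *)
Lemma area_dilate (W : set pt) : compact W -> interior W !=set0 ->
  exists2 e : R, 0 < e & forall s, 0 < s ->
    exists2 A, mu2 (dilate s W) = A%:E & (s * e) ^+ 2 <= A.
Proof.
move=> cW [p0 /nbhs_edist[e e0 We]]; have [M M0 WM] := compact_edist_bounded cW.
exists (e / 4) => [|s s0]; first by rewrite divr_gt0.
have mW : measurable (dilate s W).
  by apply: closed_measurable2; apply: compact_closed_pt; exact: dilate_compact.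
have msq x y l : measurable (`[x, x + l]%classic `*` `[y, y + l]%classic : set pt).
  by apply: measurableX; exact: measurable_itv.
have up : (mu2 (dilate s W) <= (2 * (s * M) * (2 * (s * M)))%:E)%E.
  have sM0 : 0 <= 2 * (s * M) by rewrite !mulr_ge0// ltW.
  rewrite -(mu2_square (- (s * M)) (- (s * M)) sM0).
  apply: (@le_measure _ _ _ (@plane_measure R)); [exact: (mem_set mW)|exact: (mem_set (msq _ _ _))|].
  move=> _ [p /WM[p1 p2] <-] /=.
  by rewrite !in_itv/=; move: p1 p2; rewrite !ler_norml => /andP[? ?] /andP[? ?]; split; nra.
exists (fine (mu2 (dilate s W))).
  by rewrite fineK// ge0_fin_numE// (le_lt_trans up)// ltry.
rewrite -lee_fin fineK ?ge0_fin_numE// ?(le_lt_trans up) ?ltry//.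
have se0 : 0 <= s * (e / 4) by rewrite mulr_ge0 ?divr_ge0 ?ltW.
rewrite expr2 -(mu2_square (s * p0.1) (s * p0.2) se0).
apply: (@le_measure _ _ _ (@plane_measure R)); [exact: (mem_set (msq _ _ _))|exact: (mem_set mW)|].
move=> -[x y] [/=]; rewrite !in_itv/= => /andP[x1 x2] /andP[y1 y2].
exists (x / s, y / s); last by congr (_, _) => /=; rewrite mulrC mulfVK// gt_eqF.
apply: We; apply: le_lt_trans (edist_le_add _ _) _ => /=.
have h a b : s * a <= b -> b <= s * a + s * (e / 4) -> `|a - b / s| <= e / 4.
  have [c ->] : exists c, b = s * c by exists (b / s); field; rewrite gt_eqF.
  rewrite -mulrDr !ler_pM2l// [s * c]mulrC mulfK ?gt_eqF// ler_norml; lra.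
by have := h _ _ x1 x2; have := h _ _ y1 y2; lra.
Qed.

End Dilation.

(** In the dilated window the boundary term is linear in [s] while the area is at least
    [(s * e) ^+ 2], so the quotient exceeds its limit by at most a multiple of [1 / s]. *)
Lemma specific_V1E (R : realType) d (T : measurableType d) (P : probability T R)
    (Z : T -> set (R * R)) (kappa : R) : admissible P Z -> 0 <= kappa ->
  (forall r, 0 < r -> gamma P Z r <= kappa * r) ->
  gamma P Z r / r @[r --> 0^'+] --> kappa ->
  is_specific_V1 P Z (pi * kappa / 2).
Proof.
move=> adm k0 gk gl W cW vW iW.
have [c c0 hc] := @hausdorff1_boundary R.
have [M M0 WM] := compact_edist_bounded cW.
have [e e0 he] := area_dilate cW iW.
set L := _ / 2.
have key s : 0 < s -> exists2 x, ((\int[P]_w V1 (Z w `&` dilate s W)) *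
    ((fine (area (dilate s W)))^-1)%:E)%E = x%:E & L <= x <= L + c * M / 2 / e ^+ 2 / s.
  move=> s0; have [A AE Ae] := he s s0.
  have cs := dilate_compact (s := s) cW; have vs := dilate_convex (s := s) vW.
  have sM0 : 0 <= s * M by rewrite mulr_ge0// ltW.
  have sM p : dilate s W p -> `|p.1| <= s * M /\ `|p.2| <= s * M.
    by move=> [q /WM[q1 q2] <-]; rewrite /= !normrM (gtr0_norm s0) !ler_pM2l.
  have [v [vE v1 v2]] := V1_window adm k0 gk gl cs vs sM0 sM AE (hc _ _ sM0 cs vs sM).
  have A0 : 0 < A by apply: lt_le_trans Ae; rewrite exprn_gt0// mulr_gt0.
  exists (v / A); first by rewrite vE /area AE.
  rewrite ler_pdivlMr// v1/= ler_pdivrMr// mulrDl; apply: le_trans v2 _; rewrite lerD2l.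
  have -> : c * M / 2 / e ^+ 2 / s * A = c * M / (2 * s * e ^+ 2) * A.
    by field; rewrite !gt_eqF.
  apply: le_trans (ler_wpM2l _ Ae); last by rewrite divr_ge0 ?mulr_ge0 ?sqr_ge0// ltW.
  by rewrite le_eqVlt; apply/orP; left; apply/eqP; field; rewrite !gt_eqF.
apply/fine_cvgP; split.
  near=> s; have s0 : 0 < s by near: s; exact: nbhs_pinfty_gt.
  by have [x -> _] := key s s0.
apply/cvgrPdist_lt => eps eps0; near=> s.
have s0 : 0 < s by near: s; exact: nbhs_pinfty_gt.
have [x /= -> /= /andP[x1 x2]] := key s s0.
rewrite distrC ger0_norm ?subr_ge0// ltrBlDl; apply: le_lt_trans x2 _; rewrite ltrD2l.
rewrite ltr_pdivrMr// [ltRHS]mulrC -ltr_pdivrMr//.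
by near: s; apply: nbhs_pinfty_gt; exact: num_real.
Unshelve. all: by end_near. Qed.

(** * Random stripes *)

Section PeriodicShift.
Context {R : realType}.
Local Notation mu := (@lebesgue_measure R).

Lemma mu_shift_restr (B : set R) (b lo hi : R) : measurable B ->
  mu ([set x | B (x + b)] `&` `[lo, hi[) = mu (B `&` `[lo + b, hi + b[).
Proof.
move=> mB; have mI : measurable (B `&` `[lo + b, hi + b[).
  by apply: measurableI => //; exact: measurable_itv.
rewrite -(lebesgue_measure_shift b mI); congr mu.
by apply/seteqP; split => x /=; rewrite !in_itv/= lerD2r ltrD2r.
Qed.

Lemma mu_split (B : set R) (lo mid hi : R) : measurable B -> lo <= mid -> mid <= hi ->
  (mu (B `&` `[lo, hi[) = mu (B `&` `[lo, mid[) + mu (B `&` `[mid, hi[))%E.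
Proof.
move=> mB h1 h2.
have mI x y : measurable (B `&` `[x, y[) by apply: measurableI => //; exact: measurable_itv.
rewrite -measureU; [|exact: mI|exact: mI|]; last first.
  by apply/seteqP; split => x //= [[_ +] [_ +]]; rewrite !in_itv/=; lra.
congr mu; apply/seteqP; split => x /=; rewrite !in_itv/=.
  by move=> [Bx /andP[x1 x2]]; have [x3|x3] := ltP x mid; [left|right]; rewrite ?x1 ?x2.
by move=> [] [Bx /andP[x1 x2]]; split => //; lra.
Qed.

Context (a : R) (a0 : 0 < a) (B : set R) (mB : measurable B).
Context (hB : forall x, B (x + a) <-> B x).

Lemma periodic_int (k : int) x : B (x + k%:~R * a) <-> B x.
Proof.
have hn n y : B (y + n%:R * a) <-> B y.
  elim: n y => [|n ih] y; first by rewrite mul0r addr0.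
  by rewrite -natr1 mulrDl mul1r addrA; apply: (iff_trans (hB _)).
case: k => n; first exact: hn.
rewrite NegzE mulrNz mulNr; rewrite -[X in _ <-> B X](subrK (n.+1%:R * a)).
by apply: iff_sym; exact: hn.
Qed.

(** For a shift within one period, what is pushed beyond [a] comes back at the start; any other
    shift differs from such a one by a whole number of periods. *)
Lemma mu_periodic_shift (b : R) :
  mu ([set x | B (x + b)] `&` `[0, a[) = mu (B `&` `[0, a[).
Proof.
have key c : 0 <= c <= a -> mu ([set x | B (x + c)] `&` `[0, a[) = mu (B `&` `[0, a[).
  move=> /andP[c0 ca]; rewrite mu_shift_restr// add0r.
  rewrite (@mu_split B c a)// ?lerDl//.
  rewrite addeC (@mu_split B 0 c a)//; congr (_ + _)%E.
  rewrite [RHS](_ : _ = mu ([set x | B (x + a)] `&` `[0, c[)).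
    by rewrite mu_shift_restr// add0r [c + a]addrC.
  by congr mu; apply/seteqP; split => x [/hB].
pose k := Num.floor (b / a); pose c := b - k%:~R * a.
have -> : [set x | B (x + b)] = [set x | B (x + c)].
  have e x : x + b = (x + c) + k%:~R * a by rewrite /c; ring.
  by apply/seteqP; split => x /=; rewrite e => /periodic_int.
apply: key; rewrite /c; have := floor_le_tmp (b / a); have := floorD1_gt (b / a).
rewrite -/k intrD ler_pdivlMr// ltr_pdivrMr// => h1 h2; lra.
Qed.

End PeriodicShift.

(** * The uniform law on one period *)

Section UniformAngle.
Context {R : realType}.
Local Notation mu := (@lebesgue_measure R).

Let tau0 : 0 < pi *+ 2 :> R. Proof. by rewrite mulrn_wgt0// pi_gt0. Qed.

Definition unif : probability (measurableTypeR R) R := uniform_prob tau0.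

(** The half-open interval is the one whose translates by the period tile the line; the endpoint
    removed has measure 0. *)
Lemma unifE (A : set R) : measurable A ->
  unif A = (((pi *+ 2)^-1)%:E * mu (A `&` `[0%R, (pi *+ 2)%R[))%E.
Proof.
move=> mA; have h := integral_uniform tau0 (f := fun x => (\1_A x)%:E).
transitivity (\int[uniform_prob tau0]_x (\1_A x)%:E)%E.
  by rewrite integral_indic// setIT.
rewrite h; last 2 first.
- by apply/measurable_EFinP; exact: measurable_indic.
- by move=> x; rewrite lee_fin.
rewrite subr0; congr (_ * _)%E; rewrite integral_indic//.
have m1 : measurable (A `&` `[0, (pi *+ 2)[) by apply: measurableI => //; exact: measurable_itv.
have m2 : measurable (A `&` [set pi *+ 2]) by apply: measurableI => //; exact: measurable_set1.
have z : mu (A `&` [set pi *+ 2]) = 0%E.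
  apply/eqP; rewrite -measure_le0 -(lebesgue_measure_set1 (pi *+ 2)).
  by apply: le_measure; rewrite ?inE//; exact: measurable_set1.
transitivity (mu ((A `&` `[0, (pi *+ 2)[) `|` (A `&` [set pi *+ 2]))).
  congr mu; rewrite -setIUr; congr (_ `&` _).
  by rewrite setUitv1//= bnd_simp ltW.
exact: measureU0.
Qed.

Lemma unif_shift (B : set R) b : measurable B -> (forall x, B (x + pi *+ 2) <-> B x) ->
  unif [set x | B (x + b)] = unif B.
Proof.
move=> mB hB; rewrite !unifE//; first by rewrite mu_periodic_shift.
have := @measurable_funD _ _ R setT id (cst b) (@measurable_id _ _ _) (measurable_cst _).
by move=> /(_ measurableT _ mB); rewrite setTI.
Qed.

End UniformAngle.

(** * Stripes as regular polyconvex sets *)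

Section Stripes.
Context {R : realType}.
Local Notation pt := (R * R)%type.
Implicit Types (w p q : pt) (k j : int).

Lemma sin_ge0E (x : R) :
  0 <= sin x <-> exists k : int, k%:~R * (pi *+ 2) <= x <= k%:~R * (pi *+ 2) + pi.
Proof.
have p0 : 0 < pi :> R := pi_gt0 R.
have h k (y : R) : 0 <= sin (y + k%:~R * (pi *+ 2)) <-> 0 <= sin y.
  by apply: (periodic_int (B := [set x | 0 <= sin x])) => z /=; rewrite sinD2pi.
split=> [x0|[k /andP[k1 k2]]]; last first.
  rewrite -(subrK (k%:~R * (pi *+ 2)) x); apply: (h k (x - k%:~R * (pi *+ 2))).2; apply: sin_ge0_pi; lra.
pose k := Num.floor (x / (pi *+ 2)); exists k; pose y := x - k%:~R * (pi *+ 2).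
have t0 : 0 < pi *+ 2 :> R by rewrite mulrn_wgt0.
have := floor_le_tmp (x / (pi *+ 2)); have := floorD1_gt (x / (pi *+ 2)).
rewrite -/k intrD ler_pdivlMr// ltr_pdivrMr// => h1 h2; rewrite h2/=.
rewrite leNgt; apply/negP => h3.
have y0 : 0 <= sin y by apply: (h k y).1; rewrite /y subrK.
have : 0 < sin (y - pi) by apply: sin_gt0_pi; rewrite /y -mulr_natl in h1 *; lra.
by rewrite sinB cospi sinpi mulr0 subr0; lra.
Qed.

Lemma sin_gt0 k (x : R) : k%:~R * (pi *+ 2) < x < k%:~R * (pi *+ 2) + pi -> 0 < sin x.
Proof.
move=> /andP[k1 k2].
have h (y : R) : 0 < sin (y + k%:~R * (pi *+ 2)) <-> 0 < sin y.
  by apply: (periodic_int (B := [set x | 0 < sin x])) => z /=; rewrite sinD2pi.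
rewrite -(subrK (k%:~R * (pi *+ 2)) x); apply: (h (x - k%:~R * (pi *+ 2))).2; apply: sin_gt0_pi; lra.
Qed.

(** [w.1] is the angle of the normal to the stripes and [w.2] their offset: rotations act on the
    first, translations on the second. *)
Definition phase w p : R := p.1 * cos w.1 + p.2 * sin w.1 + w.2.
Definition stripes w : set pt := [set p | 0 <= sin (phase w p)].

Lemma unit_cos_sin (th : R) : edist (0, 0) (cos th, sin th) = 1.
Proof. by rewrite /edist/= !sub0r !sqrrN cos2Dsin2 sqrtr1. Qed.

Lemma phase_lip w p q : `|phase w p - phase w q| <= edist p q.
Proof.
have := dot_norm_le p q (cos w.1, sin w.1); rewrite unit_cos_sin mulr1; apply: le_trans.
rewrite /dot /phase/= le_eqVlt; apply/orP; left; apply/eqP; congr `|_|; ring.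
Qed.

Lemma closed_lip_ge (f : pt -> R) (c : R) :
  (forall p q, `|f p - f q| <= edist p q) -> closed [set p | c <= f p].
Proof.
move=> fl; apply/closed_edist => p h /=; rewrite leNgt; apply/negP => fc.
have /h[q /= fq] : 0 < c - f p by rewrite subr_gt0.
by have := fl p q; rewrite ler_norml; lra.
Qed.

Lemma closed_lip_le (f : pt -> R) (c : R) :
  (forall p q, `|f p - f q| <= edist p q) -> closed [set p | f p <= c].
Proof.
move=> fl; apply/closed_edist => p h /=; rewrite leNgt; apply/negP => fc.
have /h[q /= fq] : 0 < f p - c by rewrite subr_gt0.
by have := fl p q; rewrite ler_norml; lra.
Qed.

Lemma closed_stripes w : closed (stripes w).
Proof.
apply: closed_lip_ge => p q; apply: le_trans (sin_lip _ _) _; exact: phase_lip.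
Qed.

Lemma finite_absz (N : nat) : finite_set [set k : int | (`|k| <= N)%N].
Proof.
pose s : seq int := [seq n%:Z | n <- iota 0 N.+1] ++ [seq - n%:Z | n <- iota 0 N.+1].
apply: (@sub_finite_set _ _ [set` s]); last exact: finite_seq.
move=> k /= kN; rewrite mem_cat; case: k kN => n nN; apply/orP; [left|right].
  by apply: map_f; rewrite mem_iota.
by rewrite NegzE (map_f (fun n : nat => - n%:Z))// mem_iota.
Qed.

Section Grid.
Context (w : pt) (a l : R) (a0 : 0 < a).

(** The coordinate along the bands. *)
Let psi p : R := phase (w.1 + pi / 2, 0) p.

Let band k : set pt := [set p | k%:~R * a <= phase w p <= k%:~R * a + l].
Let tile (kj : int * int) : set pt := band kj.1 `&` [set p | kj.2%:~R <= psi p <= kj.2%:~R + 1].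

Lemma phase_conv w' p q t :
  phase w' ((1 - t) * p.1 + t * q.1, (1 - t) * p.2 + t * q.2) = (1 - t) * phase w' p + t * phase w' q.
Proof. by rewrite /phase/=; ring. Qed.

Lemma convex_phase w' (x y : R) : convex2 [set p | x <= phase w' p <= y].
Proof.
move=> p q /= /andP[p1 p2] /andP[q1 q2] t /andP[t0 t1]; rewrite phase_conv.
have t1' : 0 <= 1 - t by rewrite subr_ge0.
by apply/andP; split; nra.
Qed.

Lemma closed_phase w' (x y : R) : closed [set p | x <= phase w' p <= y].
Proof.
rewrite (_ : [set p | _] = [set p | x <= phase w' p] `&` [set p | phase w' p <= y]).
  by apply: closedI; [apply: closed_lip_ge|apply: closed_lip_le] => p q; exact: phase_lip.
by apply/seteqP; split => p /=; [move=> /andP[]|move=> [-> ->]].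
Qed.

Lemma phase_inv p : p.1 = (phase w p - w.2) * cos w.1 - psi p * sin w.1 /\
                    p.2 = (phase w p - w.2) * sin w.1 + psi p * cos w.1.
Proof.
rewrite /psi /phase/= cosDpihalf sinDpihalf; have := cos2Dsin2 w.1.
move: (cos w.1) (sin w.1) => C S h.
by split; rewrite -[LHS]mulr1 -h; ring.
Qed.

Lemma compact_tile kj : compact (tile kj).
Proof.
pose M := `|kj.1%:~R * a| + l + `|w.2| + (`|kj.2%:~R| + 1).
apply: (@closed_bounded_compact _ _ M).
  by apply: closedI; exact: closed_phase.
move=> p [/= /andP[p1 p2] /andP[q1 q2]].
have h1 : `|phase w p - w.2| <= `|kj.1%:~R * a| + l + `|w.2|.
  by apply: le_trans (ler_normB _ _) _; rewrite lerD2r ler_norml; have := ler_norm (kj.1%:~R * a);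
     have := ler_norm (- (kj.1%:~R * a)); rewrite normrN; lra.
have h2 : `|psi p| <= `|kj.2%:~R| + 1.
  by rewrite ler_norml; have := ler_norm (kj.2%:~R : R); have := ler_norm (- kj.2%:~R : R); rewrite normrN; lra.
have c1 := cos_max w.1; have s1 := sin_max w.1.
have hm (x y : R) : `|y| <= 1 -> `|x * y| <= `|x|.
  by move=> y1; rewrite normrM ler_piMr.
have [-> ->] := phase_inv p; split.
  by apply: le_trans (ler_normB _ _) _; apply: lerD; apply: le_trans (hm _ _ _) _.
by apply: le_trans (ler_normD _ _) _; apply: lerD; apply: le_trans (hm _ _ _) _.
Qed.

(** The bands are cut across into compact tiles, indexed by pairs of integers through [pickle], with
    the empty set at the codes of no pair. Taking [a = l] makes the bands fill the plane, which
    serves for [plane_polyconvex]. *)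
Lemma grid_polyconvex : locally_polyconvex [set p | exists k : int, band k p].
Proof.
exists (fun i => if pickle_inv i is Some kj then tile kj else set0); split.
  move=> i; case: pickle_inv => [kj|]; last by split; [exact: compact0|move=> ? ? []].
  split; first exact: compact_tile.
  by move=> p q [p1 p2] [q1 q2] t t01; split; apply: (convex_phase (w' := _)).
split.
  apply/seteqP; split => [p [k kp]|p [i _]]; last first.
    by case: pickle_inv => [kj [bp _]|//]; exists kj.1.
  pose kj : int * int := (k, Num.floor (psi p)).
  exists (pickle kj); first by [].
  rewrite pickleK_inv; split; first exact: kp.
  by rewrite /= floor_le_tmp/= ltW// -intrD1; exact: floorD1_gt.
move=> C /compact_edist_bounded[M M0 CM].
pose N := (Num.truncn ((2 * M + `|w.2| + l) / a) + Num.truncn (2 * M + 1)).+1.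
pose D := [set kj : int * int | (`|kj.1| <= N)%N /\ (`|kj.2| <= N)%N].
have fD : finite_set D.
  rewrite (_ : D = [set k : int | (`|k| <= N)%N] `*` [set k : int | (`|k| <= N)%N])//.
  by apply: finite_setX; exact: finite_absz.
apply: (@sub_finite_set _ _ (pickle @` D)); last exact: finite_image.
move=> i /=; have := @pickle_invK (int * int)%type i; case: pickle_inv => [kj /= <-|_ [p []]//].
move=> [p [[/= /andP[p1 p2] /andP[q1 q2]] Cp]]; exists kj => //.
have [pM1 pM2] := CM p Cp.
have c1 := cos_max w.1; have s1 := sin_max w.1.
have hm (x y : R) : `|y| <= 1 -> `|x| <= M -> `|x * y| <= M.
  by move=> y1 xM; rewrite normrM (le_trans _ xM)// ler_piMr.
have b1 := hm _ _ c1 pM1; have b2 := hm _ _ s1 pM2.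
have b3 := hm _ _ s1 pM1; have b4 := hm _ _ c1 pM2.
have natz (z : int) (x : R) : `|z%:~R : R| <= x -> (`|z| <= (Num.truncn x).+1)%N.
  move=> zx; rewrite -(ler_nat R); apply/ltW; apply: le_lt_trans (truncnS_gt x).
  by rewrite natr_absz intr_norm.
split.
  apply: leq_trans (natz _ ((2 * M + `|w.2| + l) / a) _) _; last by rewrite ltnS leq_addr.
  rewrite ler_pdivlMr// -[X in _ * X](gtr0_norm a0) -normrM ler_norml.
  move: p1 p2 b1 b2; rewrite /phase !ler_norml; have := ler_norm w.2; have := ler_norm (- w.2).
  by rewrite normrN; lra.
apply: leq_trans (natz _ (2 * M + 1) _) _; last by rewrite ltnS leq_addl.
move: q1 q2 b3 b4; rewrite /psi /phase/= cosDpihalf sinDpihalf !ler_norml; lra.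
Qed.

End Grid.

Lemma stripes_bands w : stripes w =
  [set p | exists k : int, k%:~R * (pi *+ 2) <= phase w p <= k%:~R * (pi *+ 2) + pi].
Proof. by apply/seteqP; split => p /= /sin_ge0E. Qed.

Lemma stripes_polyconvex w : locally_polyconvex (stripes w).
Proof.
rewrite stripes_bands; apply: grid_polyconvex; by rewrite mulrn_wgt0// pi_gt0.
Qed.

Lemma plane_polyconvex : locally_polyconvex [set: pt].
Proof.
have := @grid_polyconvex (0, 0) 1 1 ltr01.
congr locally_polyconvex; apply/seteqP; split => // p _.
exists (Num.floor (phase (0, 0) p)); rewrite /= mulr1 floor_le_tmp/= ltW// -intrD1.
exact: floorD1_gt.
Qed.

Lemma stripes_regular w : topologically_regular (stripes w).
Proof.
apply/seteqP; split => [p|]; last first.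
  by apply: closure_minimal; [exact: closed_stripes|exact: interior_subset].
rewrite stripes_bands => -[k /andP[k1 k2]]; apply/closureE_edist => e e0.
have p0 : 0 < pi :> R := pi_gt0 R.
(* [p] is moved towards the middle line of its band by the proportion [la], which is less than 1 and
   small enough for a displacement below [e]; there the sine is positive and the point interior. *)
pose la := e / (e + pi); have la0 : 0 < la by rewrite divr_gt0// addr_gt0.
have laE : la * (e + pi) = e by rewrite mulfVK// gt_eqF// addr_gt0.
have la1 : la < 1 by move: laE la0; generalize la => z; nra.
pose x := phase w p; pose c := k%:~R * (pi *+ 2) + pi / 2 : R.
pose dl := la * (c - x).
have xc : `|c - x| <= pi / 2 by rewrite ler_norml /c /x; lra.
pose q : pt := (p.1 + dl * cos w.1, p.2 + dl * sin w.1).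
have phq : phase w q = x + dl.
  have := cos2Dsin2 w.1; rewrite /x /phase/= => h.
  by rewrite -[dl in RHS]mulr1 -h; ring.
have pq : edist p q <= `|dl|.
  rewrite edist_le_sqr// real_normK ?num_real//= le_eqVlt; apply/orP; left; apply/eqP.
  by have := cos2Dsin2 w.1 => h; rewrite -[RHS]mulr1 -h; ring.
have dle : `|dl| < e.
  rewrite normrM (gtr0_norm la0); apply: (@le_lt_trans _ _ (la * (pi / 2))).
    by apply: ler_wpM2l => //; exact: ltW.
  by rewrite -[ltRHS]laE; rewrite ltr_pM2l//; lra.
have sq : 0 < sin (phase w q).
  apply: (@sin_gt0 k); rewrite phq /dl /c.
  have la2 : 0 <= 1 - la by rewrite subr_ge0 ltW.
  have h1 : 0 <= x - k%:~R * (pi *+ 2) by rewrite subr_ge0.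
  have h2 : 0 <= k%:~R * (pi *+ 2) + pi - x by rewrite subr_ge0.
  have := mulr_ge0 la2 h1; have := mulr_ge0 la2 h2; have := mulr_gt0 la0 p0; lra.
exists q; last exact: le_lt_trans dle.
apply/nbhs_edist; exists (sin (phase w q)) => // q' qq'; apply/sin_ge0E; clearbody q.
have := le_trans (sin_lip (phase w q) (phase w q')) (phase_lip w q q').
rewrite ler_norml; lra.
Qed.

End Stripes.

(** * Random stripes and constant sets as admissible sets *)

Section Examples.
Context {R : realType}.
Local Notation pt := (R * R)%type.
Local Notation mu := (@lebesgue_measure R).
Local Notation angles := (measurableTypeR R * measurableTypeR R)%type.
Implicit Types (w p q : pt).

Lemma Nconv_le (A : set pt) n : union_of_n_convex A n -> (Nconv A <= n)%N.
Proof.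
move=> An; have ex : exists n, `[< union_of_n_convex A n >] by exists n; apply/asboolP.
have := @xgetPex nat 0%N [set n | union_of_n_convex A n /\
                    forall m, union_of_n_convex A m -> (n <= m)%N].
case; last by move=> _; exact.
case: (ex_minnP ex) => m /asboolP hm nm; exists m; split => // m' hm'.
by apply: nm; apply/asboolP.
Qed.

Lemma lip_continuous (f : pt -> R) :
  (forall p q, `|f p - f q| <= edist p q) -> continuous f.
Proof.
move=> fl p; apply/cvgrPdist_lt => e e0; apply/nbhs_edist; exists e => // q pq /=.
exact: le_lt_trans (fl p q) pq.
Qed.

(** If [stripes w0] misses [K], the sine of the phase stays below a negative constant on [K] by
    compactness; at points of [K] the phase is Lipschitz in [w] with constant [2 * M + 1], so nearby
    stripes miss [K] too. *)
Lemma closed_stripes_hit (K : set pt) : compact K -> closed [set w | hit K (stripes w)].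
Proof.
move=> cK; apply/closed_edist => w0 h.
have [M M0 KM] := compact_edist_bounded cK.
have K0 : K !=set0 by have [//|w [p [_ Kp]] _] := h 1; exists p.
pose f p := - sin (phase w0 p).
have fl p q : `|f p - f q| <= edist p q.
  rewrite (_ : f p - f q = - (sin (phase w0 p) - sin (phase w0 q))); last by rewrite /f; ring.
  by rewrite normrN; apply: le_trans (sin_lip _ _) _; exact: phase_lip.
have [q Kq qmin] := compact_EVT_min K0 cK (continuous_subspaceT (lip_continuous fl)).
exists q; split; last exact/set_mem.
rewrite /stripes/= leNgt; apply/negP => sq.
have M1 : 0 < 2 * M + 1 by lra.
have [|w [p [pw Kp]] ww] := h (f q / (2 * M + 1)).
  by rewrite divr_gt0// /f oppr_gt0.
have := qmin p (mem_set Kp); rewrite /f => fqp.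
have [p1 p2] := KM p Kp.
have hc : `|phase w0 p - phase w p| <= (2 * M + 1) * edist w0 w.
  have -> : phase w0 p - phase w p = p.1 * (cos w0.1 - cos w.1) + p.2 * (sin w0.1 - sin w.1) +
     (w0.2 - w.2) by rewrite /phase; ring.
  have e1 := edist_fst w0 w; have e2 := edist_snd w0 w.
  have c1 := le_trans (cos_lip w0.1 w.1) e1; have c2 := le_trans (sin_lip w0.1 w.1) e1.
  apply: le_trans (ler_normD _ _) _; apply: le_trans (lerD (ler_normD _ _) e2) _.
  rewrite !normrM; have := ler_pM (normr_ge0 _) (normr_ge0 _) p1 c1.
  have := ler_pM (normr_ge0 _) (normr_ge0 _) p2 c2; lra.
have := le_trans (sin_lip (phase w0 p) (phase w p)) hc.
move: ww; rewrite ltr_pdivlMr// => ww.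
move: pw; rewrite /stripes/= ler_norml /f in ww *; lra.
Qed.

Definition stripe_law : probability angles R := (@unif R \x @unif R)%E.

Definition random_stripes : angles -> set pt := stripes.

Lemma random_stripes_closed : random_closed_set random_stripes.
Proof.
split=> [w|K cK]; first exact: closed_stripes.
exact: (closed_measurable2 (closed_stripes_hit cK)).
Qed.

Lemma measurable_fell d (T : measurableType d) (Z : T -> set pt) (S : set (set pt)) :
  random_closed_set Z -> fell S -> measurable (Z @^-1` S).
Proof.
move=> rZ; move: S; apply: (@smallest_sub _ _ _ [set S | measurable (Z @^-1` S)]).
  split => /=.
  - by rewrite preimage_set0.
  - by move=> A mA; rewrite setTD preimage_setC; exact: measurableC.
  - by move=> F mF; rewrite preimage_bigcup; exact: bigcupT_measurable.
by move=> _ [K cK <-]; exact: rZ.2.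
Qed.

Lemma stripes_translate (v : pt) w :
  translate v (stripes w) = stripes (w.1, w.2 - phase (w.1, 0) v).
Proof.
have e p : phase (w.1, w.2 - phase (w.1, 0) v) (p.1 + v.1, p.2 + v.2) = phase w p.
  by rewrite /phase/=; ring.
apply/seteqP; split => [_ [p wp <-]|q wq]; first by rewrite /stripes/= e.
have qE : q = (q.1 - v.1 + v.1, q.2 - v.2 + v.2) by rewrite !subrK -surjective_pairing.
exists (q.1 - v.1, q.2 - v.2); last by rewrite /= -qE.
by rewrite /stripes/= -(e (_, _))/= -qE.
Qed.

Lemma stripes_rotate (al : R) w : rotate al (stripes w) = stripes (w.1 + al, w.2).
Proof.
have e p : phase (w.1 + al, w.2) (rot al p) = phase w p.
  rewrite /phase/= cosD sinD; have := cos2Dsin2 al.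
  move: (cos al) (sin al) (cos w.1) (sin w.1) => C S c s h.
  by rewrite -[p.1 * c]mulr1 -[p.2 * s]mulr1 -h; ring.
apply/seteqP; split => [_ [p wp <-]|q wq]; first by rewrite /stripes/= (e p).
have qE : q = rot al (rot (- al) q) by rewrite -{1}[al]opprK rotK.
exists (rot (- al) q); last exact: (esym qE).
by rewrite /stripes/= -e -qE.
Qed.

Lemma stripes_period1 th (t : R) : stripes (th + pi *+ 2, t) = stripes (th, t).
Proof. by rewrite /stripes /phase/= sinD2pi cosD2pi. Qed.

Lemma stripes_period2 th (t : R) : stripes (th, t + pi *+ 2) = stripes (th, t).
Proof. by apply/seteqP; split => p; rewrite /stripes /phase/= addrA sinD2pi. Qed.

(** At a fixed angle a translation shifts the offset by a constant, and the events are periodic in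
    the offset. *)
Lemma random_stripes_stationary : stationary stripe_law random_stripes.
Proof.
move=> v S fS; have mA := measurable_fell random_stripes_closed fS.
set A := random_stripes @^-1` S in mA *.
apply: eq_integral => th _ /=.
have mB := measurable_xsection (th : measurableTypeR R) mA.
rewrite -(unif_shift (- phase (th, 0) v) mB); last first.
  by move=> t; rewrite /xsection/= !inE /A /random_stripes/= stripes_period2.
congr (unif _); apply/seteqP; split => t;
  by rewrite /xsection/= !inE /A /random_stripes/= stripes_translate.
Qed.

(** The same argument on the angle with the offset fixed, whence the exchange of the order of
    integration. *)
Lemma random_stripes_isotropic : isotropic stripe_law random_stripes.
Proof.
move=> al S fS; have mA := measurable_fell random_stripes_closed fS.
set A := random_stripes @^-1` S in mA *.
have ms : measurable_fun setT (fun w : angles => (w.1 + al, w.2) : angles).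
  apply/measurable_fun_pair => /=; last exact: measurable_snd.
  by apply: measurable_funD; [exact: measurable_fst|exact: measurable_cst].
have mA' : measurable [set w : angles | A (w.1 + al, w.2)].
  by have := ms measurableT _ mA; rewrite setTI.
have -> : (fun w => rotate al (random_stripes w)) @^-1` S = [set w : angles | A (w.1 + al, w.2)].
  by apply/seteqP; split => w; rewrite /= stripes_rotate.
have swap B : measurable B -> stripe_law B = (\int[@unif R]_t unif (ysection B t))%E.
  by move=> mB; exact: (product_measure_swap (@unif R) (@unif R) mB).
rewrite (swap _ mA) (swap _ mA').
apply: eq_integral => t _ /=.
have mB := measurable_ysection (t : measurableTypeR R) mA.
transitivity (unif [set th | ysection A t (th + al)]).
  apply: esym; apply: unif_shift => // th.
  by rewrite /ysection/= !inE /A /random_stripes/= stripes_period1.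
by congr (unif _); apply/seteqP; split => th; rewrite /ysection/= !inE.
Qed.

(** In the unit disc the phase stays within 1 of [w.2], a range shorter than the period, so only the
    bands [k] and [k + 1] can occur. *)
Lemma stripes_Nconv w : (Nconv (stripes w `&` cball 1) <= 2)%N.
Proof.
apply: Nconv_le; have p0 : 0 < pi :> R := pi_gt0 R.
have t0 : 0 < pi *+ 2 :> R by rewrite mulrn_wgt0.
pose k := Num.floor ((w.2 - 1) / (pi *+ 2)).
exists (fun i => [set p | (k + i%:Z)%:~R * (pi *+ 2) <= phase w p <= (k + i%:Z)%:~R * (pi *+ 2) + pi] `&` cball 1).
split.
  by move=> i p q [p1 p2] [q1 q2] t t01; split; [exact: convex_phase|exact: convex_cball].
apply/seteqP; split => [p [sp Bp]|p [i _ [sp Bp]]]; last first.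
  by split => //; apply/sin_ge0E; exists (k + i%:Z).
have [k' k'p] := (sin_ge0E _).1 sp.
have := floor_le_tmp ((w.2 - 1) / (pi *+ 2)); have := floorD1_gt ((w.2 - 1) / (pi *+ 2)).
rewrite -/k intrD ler_pdivlMr// ltr_pdivrMr// => h1 h2.
have p1 : `|phase w p - w.2| <= 1.
  have := phase_lip w (0, 0) p; rewrite distrC {2}/phase/= !mul0r !add0r => /le_trans; exact.
have pi1 : 1 < pi :> R by have := @pi_ge2 R; lra.
have kk : k <= k'.
  rewrite -ltzD1 -(ltr_int R) -(ltr_pM2r t0) intrD.
  by move: p1 k'p; rewrite ler_norml -mulr_natl in h1 h2 *; lra.
have kk2 : k' < k + 2.
  rewrite -(ltr_int R) -(ltr_pM2r t0) intrD.
  by move: p1 k'p; rewrite ler_norml -mulr_natl in h1 h2 *; lra.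
have kE : `|k' - k|%N%:Z = k' - k by rewrite gez0_abs// subr_ge0.
exists `|k' - k|%N; first by rewrite /= -ltz_nat kE ltrBlDl.
by split => //=; rewrite kE addrC subrK.
Qed.

Lemma integral_2Nconv_lty d (T : measurableType d) (P : probability T R) (Z : T -> set pt) (n : nat) :
  (forall x, (Nconv (Z x `&` cball 1) <= n)%N) ->
  (\int[P]_x ((2 ^ Nconv (Z x `&` cball 1))%N%:R)%:E < +oo)%E.
Proof.
move=> h; apply: (@le_lt_trans _ _ (\int[P]_x (((2 ^ n)%N%:R : R)%:E))%E).
  by apply: ge0_le_integral_nomeas => w /=; rewrite lee_fin// ler_nat leq_pexp2l.
rewrite integral_cst// lte_mul_pinfty//.
by apply: (@le_lt_trans _ _ 1%E); [exact: probability_le1|exact: ltry].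
Qed.

Lemma random_stripes_admissible : admissible stripe_law random_stripes.
Proof.
split; [split|exact: random_stripes_isotropic|by apply: aeW => w; exact: stripes_regular].
- exact: random_stripes_closed.
- exact: random_stripes_stationary.
- by apply: aeW => w; exact: stripes_polyconvex.
- by apply: (@integral_2Nconv_lty _ _ _ _ 2) => w; exact: stripes_Nconv.
Qed.

Lemma admissible_cst d (T : measurableType d) (P : probability T R) (F : set pt) :
  (forall v, translate v F = F) -> (forall al, rotate al F = F) ->
  locally_polyconvex F -> topologically_regular F -> admissible P (fun=> F).
Proof.
move=> tF rF pF gF; split; [split| |by apply: aeW].
- split => [w|K _]; first by rewrite gF; exact: closed_closure.
  have [h|h] := pselect (hit K F).
    by rewrite (_ : _ @^-1` _ = setT)//; apply/seteqP; split.
  by rewrite (_ : _ @^-1` _ = set0)//; apply/seteqP; split.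
- by move=> v S _; rewrite tF.
- by apply: aeW.
- by apply: (@integral_2Nconv_lty _ _ _ _ (Nconv (F `&` cball 1))).
- by move=> al S _; rewrite rF.
Qed.

Lemma unif_itv (x y : R) : 0 <= x -> x <= y -> y < pi *+ 2 ->
  unif `[x, y]%classic = ((pi *+ 2)^-1 * (y - x))%:E.
Proof.
move=> x0 xy y2; rewrite unifE; last exact: measurable_itv.
rewrite EFinM; congr (_ * _)%E; rewrite setIidl; last first.
  by move=> z /=; rewrite !in_itv/= => /andP[z1 z2]; lra.
rewrite lebesgue_measure_itv/= lte_fin; case: ltP => h; first by rewrite EFinB.
by congr EFin; lra.
Qed.

(** One positive value of gamma makes kappa positive, as [gamma r <= kappa * r]. *)
Lemma gamma_random_stripes : 0 < gamma stripe_law random_stripes pi.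
Proof.
have rZ := random_stripes_closed; have sZ := random_stripes_stationary.
have p0 : 0 < pi :> R := pi_gt0 R.
rewrite (gammaE rZ sZ random_stripes_isotropic) ?ltW//.
(* On this box the origin has phase [t] between 0 and [pi], while [(pi, 0)] has its phase between
   [11 / 10 * pi] and [19 / 10 * pi], because [cos th >= 1 / 2]. *)
pose I : set R := `[0, 1 / 2]%classic; pose J : set R := `[3 / 5 * pi, 9 / 10 * pi]%classic.
have mI : measurable I by exact: measurable_itv.
have mJ : measurable J by exact: measurable_itv.
have mIJ : measurable (I `*` J : set angles) by exact: measurableX.
have pi2 := @pi_ge2 R.
have eI : unif I = ((pi *+ 2)^-1 * (1 / 2 - 0))%:E by apply: unif_itv; lra.
have eJ : unif J = ((pi *+ 2)^-1 * (9 / 10 * pi - 3 / 5 * pi))%:E by apply: unif_itv; lra.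
have eIJ : stripe_law (I `*` J) = (unif I * unif J)%E by exact: product_measure1E.
have : 0 < fine (stripe_law (I `*` J)).
  have t0 : 0 < (pi *+ 2)^-1 :> R by rewrite invr_gt0 mulrn_wgt0.
  by rewrite eIJ eI eJ -EFinM/=; do ?[exact: t0|apply: mulr_gt0]; lra.
move=> /lt_le_trans; apply; rewrite -(Ex_indic stripe_law mIJ).
apply: Ex_le => [||[th t]]; [exact: ibl_indic|exact: ibl_io|].
rewrite indicE; case: (boolP (_ \in _)) => [/set_mem[/=]|_]; last by rewrite ler0n.
rewrite /I /J /= !in_itv/= => /andP[th0 th1] /andP[t1 t2].
rewrite /io (_ : _ && _ = true)//; apply/andP; split.
  apply/zinP; rewrite /random_stripes /stripes/= /phase/= !mul0r !add0r.
  by apply: sin_ge0_pi; lra.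
apply/zinP; rewrite /random_stripes /stripes/= /phase/= mul0r addr0.
have c1 := cos_le1 th; have := cos_lip 0 th.
rewrite cos0 sub0r normrN (ger0_norm th0) ler_norml => /andP[_ c2].
have : 0 < sin (pi * cos th + t - pi).
  by apply: sin_gt0_pi; nra.
rewrite sinB cospi sinpi mulr0 subr0; lra.
Qed.

End Examples.

(** * The theorem *)

Section Assembly.
Context {R : realType}.
Local Notation pt := (R * R)%type.

Lemma eta_prob_cst d (T : measurableType d) (P : probability T R) (F : set pt) a j :
  eta_prob P (fun=> F) a j =
  (config_class (zin F (0, 0)) (zin F (a, 0)) (zin F (0, a)) (zin F (a, a)) == j)%:R.
Proof.
rewrite /eta_prob; case: eqP => h.
  by rewrite (_ : [set _ | _] = setT) ?probability_setT//; apply/seteqP; split.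
by rewrite (_ : [set _ | _] = set0) ?measure0//; apply/seteqP; split.
Qed.

Lemma not_cvg_inv (v l : R) : a^-1 * v @[a --> 0^'+] --> l -> v = 0.
Proof.
move=> h; have : a * (a^-1 * v) @[a --> 0^'+] --> 0 * l.
  by apply: cvgM h; exact: cvg_at_right_filter.
rewrite mul0r => h2; have h3 : v @[a --> (0 : R)^'+] --> v by exact: cvg_cst.
have h4 : v @[a --> (0 : R)^'+] --> (0 : R).
  apply: cvg_at0_eq h2; near=> a.
  have a0 : a != 0 by rewrite gt_eqF//; near: a; exact: nbhs_right_gt.
  by rewrite mulrA divff// mul1r.
exact: (cvg_unique _ h3 h4).
Unshelve. all: by end_near. Qed.

Lemma admissible_empty d (T : measurableType d) (P : probability T R) :
  admissible P (fun=> set0 : set pt).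
Proof.
apply: admissible_cst => [v|al||].
- by rewrite /translate image_set0.
- by rewrite /rotate image_set0.
- exists (fun=> set0); split; first by move=> i; split; [exact: compact0|move=> ? ? []].
  split; first by rewrite bigcup0.
  move=> C _; rewrite (_ : [set i | _] = set0); first exact: finite_set0.
  by apply/seteqP; split => // i [p []].
- by rewrite /topologically_regular interior0 closure0.
Qed.

Lemma admissible_plane d (T : measurableType d) (P : probability T R) :
  admissible P (fun=> setT : set pt).
Proof.
apply: admissible_cst => [v|al||].
- apply/seteqP; split => // p _; exists (p.1 - v.1, p.2 - v.2) => //=.
  by rewrite !subrK -surjective_pairing.
- apply/seteqP; split => // p _; exists (rot (- al) p) => //.
  by rewrite -[RHS](rotK (- al)) opprK.
- exact: plane_polyconvex.
- by rewrite /topologically_regular interiorT closureT.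
Qed.

Lemma Ehat_specific w2 w3 w4 w5 d (T : measurableType d) (P : probability T R) (Z : T -> set pt) :
  admissible P Z -> exists kappa : R, [/\ 0 <= kappa,
    forall r, 0 < r -> gamma P Z r <= kappa * r,
    is_specific_V1 P Z (pi * kappa / 2) &
    EhatV1 0 w2 w3 w4 w5 0 P Z a @[a --> 0^'+] --> c3 w2 w3 w5 * (kappa / 2)].
Proof.
move=> adm; have [stZ iZ _] := adm; have [rZ sZ _ _] := stZ.
have [kappa [k0 gk gl]] := gamma_cvg stZ iZ.
exists kappa; split => //; first exact: specific_V1E.
exact: Ehat_cvg.
Qed.

Lemma is_specific_V1_unique d (T : measurableType d) (P : probability T R) (Z : T -> set pt)
    (L L' : R) : is_specific_V1 P Z L -> is_specific_V1 P Z L' -> L = L'.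
Proof.
move=> h h'; pose W : set pt := `[0, 1]%classic `*` `[0, 1]%classic.
have cW : compact W by apply: compact_setX; exact: segment_compact.
have vW : convex2 W.
  move=> p q [/= ]; rewrite !in_itv/= => /andP[p1 p2] /andP[p3 p4] [/=].
  rewrite !in_itv/= => /andP[q1 q2] /andP[q3 q4] t /andP[t0 t1]; split; rewrite /= in_itv/=; nra.
have iW : interior W !=set0.
  exists (1 / 2, 1 / 2); apply/nbhs_edist; exists (1 / 2) => // q pq.
  have := le_lt_trans (edist_fst _ _) pq; have := le_lt_trans (edist_snd _ _) pq.
  by rewrite /= !ltr_norml => ? ?; split; rewrite /= in_itv/=; lra.
by apply: EFin_inj; exact: (cvg_unique _ (h W cW vW iW) (h' W cW vW iW)).
Qed.

End Assembly.

Theorem theorem6p1 (R : realType) (w1 w2 w3 w4 w5 w6 : R) :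
  ((forall (d : measure_display) (T : measurableType d)
           (P : probability T R) (Z : T -> set (R * R)%type),
      admissible P Z ->
      exists l : R, EhatV1 w1 w2 w3 w4 w5 w6 P Z a @[a --> 0^'+] --> l)
   <-> (w1 = 0 /\ w6 = 0))
  /\
  (w1 = 0 -> w6 = 0 ->
    (forall (d : measure_display) (T : measurableType d)
            (P : probability T R) (Z : T -> set (R * R)%type),
       admissible P Z ->
       exists L : R, is_specific_V1 P Z L /\
         EhatV1 w1 w2 w3 w4 w5 w6 P Z a @[a --> 0^'+]
           --> pi^-1 * c3 w2 w3 w5 * L)
    /\
    ((forall (d : measure_display) (T : measurableType d)
             (P : probability T R) (Z : T -> set (R * R)%type),
        admissible P Z -> asympt_unbiased w1 w2 w3 w4 w5 w6 P Z)
     <-> c3 w2 w3 w5 = pi)).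
Proof.
have pi0 : pi != 0 :> R by rewrite gt_eqF// pi_gt0.
split; [split=> [h|[-> ->] d T P Z adm]|move=> -> ->; split; [|split]].
(* A constant set can live on any probability space. Its class is surely 1 for the empty set and 6
   for the plane, so the estimator is [w1 / a] or [w6 / a]. *)
- have [l1 h1] := h _ _ (@stripe_law R) _ (admissible_empty _).
  have [l6 h6] := h _ _ (@stripe_law R) _ (admissible_plane _).
  have z0 (p : R * R) : zin set0 p = false by apply/negP => /zinP.
  have zT (p : R * R) : zin setT p = true by apply/zinP.
  split.
    apply: (@not_cvg_inv _ _ l1); move: h1; rewrite /EhatV1.
    under eq_fun do rewrite !eta_prob_cst !z0 /= mulr1 !mulr0 !addr0.
    exact.
  apply: (@not_cvg_inv _ _ l6); move: h6; rewrite /EhatV1.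
  under eq_fun do rewrite !eta_prob_cst !zT /= mulr1 !mulr0 !add0r.
  exact.
- by have [kappa [_ _ _ hE]] := Ehat_specific w2 w3 w4 w5 adm; exists (c3 w2 w3 w5 * (kappa / 2)).
- move=> d T P Z adm; have [kappa [_ _ hS hE]] := Ehat_specific w2 w3 w4 w5 adm.
  exists (pi * kappa / 2); split => //.
  rewrite (_ : _ * (pi * kappa / 2) = c3 w2 w3 w5 * (kappa / 2))//.
  by move: (pi) (c3 _ _ _) pi0 => q c q0; field.
- move=> h; have adm := @random_stripes_admissible R.
  have [L [hS hE]] := h _ _ _ _ adm.
  have [kappa [k0 gk hS' hE']] := Ehat_specific w2 w3 w4 w5 adm.
  (* The two limits agree up to the common factor [kappa / 2], which has to be cancelled. *)
  have kn : kappa != 0.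
    apply/eqP => k00; have := gk _ (pi_gt0 R); rewrite k00 mul0r leNgt.
    by rewrite gamma_random_stripes.
  have LE := is_specific_V1_unique hS hS'.
  have e : pi * kappa / 2 = c3 w2 w3 w5 * (kappa / 2).
    by rewrite -LE; exact: (cvg_unique _ hE hE').
  by apply: (mulIf kn) => /=; lra.
- move=> c3E d T P Z adm; have [kappa [_ _ hS hE]] := Ehat_specific w2 w3 w4 w5 adm.
  exists (pi * kappa / 2); split => //; move: hE; rewrite c3E.
  by rewrite mulrA.
Qed.
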